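(* For an $\mathcal{EL}^{\rightarrow}$ ontology $\mathcal{O}$, checking (categorical) $\mathcal{EL}^\rightarrow$-consistency of $\mathcal O$ by applying the categorical rules for $\mathcal{EL}^\rightarrow$ until no rule is applicable and testing for an arrow $\{a\}\rightarrow\bot$ runs in time polynomial in the size of $\mathcal{O}$ (the length of the string obtained by serializing its axioms).
   Context: $\mathcal{EL}^{\rightarrow}$: concepts $\top,\bot,A,C\sqcap D, C\bar\sqcup D,\bar\neg C,\exists R.C,\bar\forall R.C$ ($A$ concept name, $R$ role name); an ontology is a finite set of GCIs $C\sqsubseteq D$, role inclusions $R\sqsubseteq S$, transitivity axioms $S\circ S\sqsubseteq S$, concept assertions $\{a\}\sqsubseteq C$, role assertions $\{(a,b)\}\sqsubseteq R$, all concepts in NNF ($\bar\neg$ only in front of concept names). Categorical saturation: one builds a concept structure and a role structure (sets of objects with a binary arrow relation $\rightarrow$). Concept objects are formal expressions (concepts, individual objects $\{a\}$, and $\Pi_\ell(R),\Pi_r(R)$ for role objects $R$), identified up to associativity, commutativity and idempotence of $\sqcap$ and $\bar\sqcup$; role objects are role names, $\{(a,b)\}$, $\mathfrak R_\top,\mathfrak R_\bot$, $S\circ S$, and a fresh $\mathfrak R_{(\exists R.C)}$ for each object $\exists R.C$. Initially: $\top,\bot$, concept names, $\{a\}$ for individuals, $\mathfrak R_\top,\mathfrak R_\bot$, role names; adding an arrow adds its endpoints. $X\leftrightarrows Y$ means $X\rightarrow Y$ and $Y\rightarrow X$. Each rule, when its premises are present and some conclusion is absent, adds its conclusions: (it)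 concept object $X$: $X\rightarrow\top,\bot\rightarrow X,X\rightarrow X$; role object $X$: $X\rightarrow\mathfrak R_\top,\mathfrak R_\bot\rightarrow X,X\rightarrow X$; (r) role object $R$ $\Rightarrow$ objects $\Pi_\ell(R),\Pi_r(R)$; (tr) $X\rightarrow Y\rightarrow Z$ $\Rightarrow$ $X\rightarrow Z$; (f) $\Pi_\ell(R)\rightarrow\bot$ $\Rightarrow$ $\Pi_r(R)\rightarrow\bot$ and conversely; (ax) each axiom $X\sqsubseteq Y\in\mathcal O$ gives $X\rightarrow Y$ (concept arrow for GCIs and concept assertions, role arrow for role axioms); ($\sqcap$d) object $C\sqcap D$ $\Rightarrow$ $C\sqcap D\rightarrow C$, $C\sqcap D\rightarrow D$; ($\sqcap$c) $X\rightarrow C$, $X\rightarrow D$, object $C\sqcap D$ $\Rightarrow$ $X\rightarrow C\sqcap D$; ($\sqcup$d) $C\bar\sqcup D\rightarrow X$ $\Rightarrow$ $C\rightarrow X$, $D\rightarrow X$; ($\sqcup$c) $C\rightarrow X$, $D\rightarrow X$, object $C\bar\sqcup D$ $\Rightarrow$ $C\bar\sqcup D\rightarrow X$; ($\neg$) $X\rightarrow A$, $X\rightarrow\bar\neg A$ $\Rightarrow$ $X\rightarrow\bot$; ($\exists$) object $\exists R.C$ $\Rightarrow$ object $C$, $\mathfrak R_{(\exists R.C)}\rightarrow R$, $\exists R.C\leftrightarrows\Pi_\ell(\mathfrak R_{(\exists R.C)})$, $\Pi_r(\mathfrak R_{(\exists R.C)})\rightarrow C$; ($\exists$H) object $\exists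 R.C$, $R'\rightarrow R$, $\Pi_r(R')\rightarrow C$ $\Rightarrow$ $\Pi_\ell(R')\rightarrow\Pi_\ell(\mathfrak R_{(\exists R.C)})$; ($\exists\circ$) $S\circ S\rightarrow S$, $X\rightarrow\exists S.C$, $C\rightarrow\exists S.D$ $\Rightarrow$ $X\rightarrow\exists S.D$; ($\exists\bar\forall$) $X\rightarrow\exists P.C$, $X\rightarrow\bar\forall R.D$, $P\rightarrow R$ $\Rightarrow$ object $C\sqcap D$; ($\exists\forall$) $X\rightarrow\exists P.C$, $X\rightarrow\bar\forall R.D$, $P\rightarrow R$, $C\sqcap D\rightarrow\bot$ $\Rightarrow$ $X\rightarrow\bot$; ($\exists\forall$I) $\{(a,b)\}\rightarrow P$, $\{a\}\rightarrow\bar\forall R.D$, $P\rightarrow R$ $\Rightarrow$ $\{a\}\rightarrow\exists P.D$, $\{b\}\rightarrow D$; ($\exists\circ\bar\forall$) $P\rightarrow S$, $S\circ S\rightarrow S$, $S\rightarrow R$, $X\rightarrow\exists P.C$, $X\rightarrow\bar\forall R.D$ $\Rightarrow$ object $C\sqcap\bar\forall S.D$; ($\exists\circ\forall$) the same premises plus $C\sqcap\bar\forall S.D\rightarrow\bot$ $\Rightarrow$ $X\rightarrow\bot$; ($\exists\circ\forall$I) $P\rightarrow S$, $S\circ S\rightarrow S$, $S\rightarrow R$, $\{(a,b)\}\rightarrow P$, $\{a\}\rightarrow\bar\forall R.D$ $\Rightarrow$ $\{a\}\rightarrow\exists P.\bar\forall S.D$, $\{b\}\rightarrow\bar\forall S.D$.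 The saturated structures $\mathscr C_c\langle\mathcal O\rangle,\mathscr C_r\langle\mathcal O\rangle$ are obtained when no rule is applicable; $\mathcal O$ is $\mathcal{EL}^\rightarrow$-inconsistent iff $\{a\}\rightarrow\bot\in\mathscr C_c\langle\mathcal O\rangle$ for some individual $a$ of $\mathcal O$, and $\mathcal{EL}^\rightarrow$-consistent otherwise.
   Formalization: Arrows are taken up to associativity, commutativity and idempotence, but objects are recorded and matched by the rules as written: matching on classes would let (⊓d) introduce all 2^n−1 sub-conjunctions of A1⊓…⊓An, making the polynomial bound false. *)

(* Defs.v *)
From HB Require Import structures.
From mathcomp Require Import all_boot all_algebra.

Set Implicit Arguments.
Unset Strict Implicit.
Unset Printing Implicit Defensive.

(** * Syntax *)

(* Concept, role and individual names are words over {0,1}, so that the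
   length of a name is part of the length of a serialized ontology. *)
Definition name : Type := seq bool.

(* Concepts in negation normal form: negation is only applied to names. *)
Inductive concept : Type :=
| CTop
| CBot
| CName of name
| CNot of name
| CAnd of concept & concept
| COr of concept & concept
| CEx of name & concept
| CAll of name & concept.

Inductive axiom : Type :=
| GCI of concept & concept          (* C [= D *)
| RoleIncl of name & name           (* R [= S *)
| Transitivity of name              (* S o S [= S *)
| ConceptAssert of name & concept   (* {a} [= C *)
| RoleAssert of name & name & name. (* {(a,b)} [= R *)

Definition ontology : Type := seq axiom.

Fixpoint concept_cnames (C : concept) : seq name :=
  match C with
  | CTop | CBot => [::]
  | CName A | CNot A => [:: A]
  | CAnd C1 C2 | COr C1 C2 => concept_cnames C1 ++ concept_cnames C2
  | CEx _ C1 | CAll _ C1 => concept_cnames C1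
  end.

Fixpoint concept_rnames (C : concept) : seq name :=
  match C with
  | CTop | CBot | CName _ | CNot _ => [::]
  | CAnd C1 C2 | COr C1 C2 => concept_rnames C1 ++ concept_rnames C2
  | CEx R C1 | CAll R C1 => R :: concept_rnames C1
  end.

Definition axiom_cnames (ax : axiom) : seq name :=
  match ax with
  | GCI C D => concept_cnames C ++ concept_cnames D
  | ConceptAssert _ C => concept_cnames C
  | _ => [::]
  end.

Definition axiom_rnames (ax : axiom) : seq name :=
  match ax with
  | GCI C D => concept_rnames C ++ concept_rnames D
  | RoleIncl R R' => [:: R; R']
  | Transitivity R => [:: R]
  | ConceptAssert _ C => concept_rnames C
  | RoleAssert _ _ R => [:: R]
  end.

Definition axiom_inds (ax : axiom) : seq name :=
  match ax with
  | ConceptAssert a _ => [:: a]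
  | RoleAssert a b _ => [:: a; b]
  | _ => [::]
  end.

Definition cnames (O : ontology) : seq name := flatten (map axiom_cnames O).
Definition rnames (O : ontology) : seq name := flatten (map axiom_rnames O).
Definition inds (O : ontology) : seq name := flatten (map axiom_inds O).

(** * Objects, and their identification *)

Inductive robj : Type :=
| RName of name
| RPair of name & name      (* {(a,b)} *)
| RTop
| RBot
| RComp of name             (* S o S *)
| RFresh of name & concept. (* [RFresh R C] is the role object of [CEx R C] *)

Inductive cobj : Type :=
| OConcept of concept
| OInd of name              (* {a} *)
| OPiL of robj
| OPiR of robj.

Coercion OConcept : concept >-> cobj.

Inductive concept_eqv : concept -> concept -> Prop :=
| eqv_refl C : concept_eqv C C
| eqv_sym C D : concept_eqv C D -> concept_eqv D C
| eqv_trans C D E : concept_eqv C D -> concept_eqv D E -> concept_eqv C E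
| eqv_and C C' D D' : concept_eqv C C' -> concept_eqv D D' ->
    concept_eqv (CAnd C D) (CAnd C' D')
| eqv_or C C' D D' : concept_eqv C C' -> concept_eqv D D' ->
    concept_eqv (COr C D) (COr C' D')
| eqv_ex R C C' : concept_eqv C C' -> concept_eqv (CEx R C) (CEx R C')
| eqv_all R C C' : concept_eqv C C' -> concept_eqv (CAll R C) (CAll R C')
| eqv_andA C D E : concept_eqv (CAnd C (CAnd D E)) (CAnd (CAnd C D) E)
| eqv_andC C D : concept_eqv (CAnd C D) (CAnd D C)
| eqv_andI C : concept_eqv (CAnd C C) C
| eqv_orA C D E : concept_eqv (COr C (COr D E)) (COr (COr C D) E)
| eqv_orC C D : concept_eqv (COr C D) (COr D C)
| eqv_orI C : concept_eqv (COr C C) C.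

Definition robj_eqv (r r' : robj) : Prop :=
  match r, r' with
  | RFresh R C, RFresh R' C' => R = R' /\ concept_eqv C C'
  | _, _ => r = r'
  end.

Definition cobj_eqv (X Y : cobj) : Prop :=
  match X, Y with
  | OConcept C, OConcept D => concept_eqv C D
  | OPiL r, OPiL r' => robj_eqv r r'
  | OPiR r, OPiR r' => robj_eqv r r'
  | _, _ => X = Y
  end.

(** * Structures *)

(* [HasC]/[HasR] state that an expression has been introduced as a concept or
   role object, [ArrC]/[ArrR] are the arrows of the concept and of the role
   structure. *)
Inductive fact : Type :=
| HasC of cobj
| HasR of robj
| ArrC of cobj & cobj
| ArrR of robj & robj.

Lemma concept_comparable : comparable concept.
Proof. by rewrite /comparable /decidable; decide equality; apply: eq_comparable. Qed.
HB.instance Definition _ :=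
  hasDecEq.Build concept (compareP concept_comparable).

Lemma robj_comparable : comparable robj.
Proof. by rewrite /comparable /decidable; decide equality; apply: eq_comparable. Qed.
HB.instance Definition _ := hasDecEq.Build robj (compareP robj_comparable).

Lemma cobj_comparable : comparable cobj.
Proof. by rewrite /comparable /decidable; decide equality; apply: eq_comparable. Qed.
HB.instance Definition _ := hasDecEq.Build cobj (compareP cobj_comparable).

Lemma fact_comparable : comparable fact.
Proof. by rewrite /comparable /decidable; decide equality; apply: eq_comparable. Qed.
HB.instance Definition _ := hasDecEq.Build fact (compareP fact_comparable).

Lemma axiom_comparable : comparable axiom.
Proof. by rewrite /comparable /decidable; decide equality; apply: eq_comparable. Qed.
HB.instance Definition _ := hasDecEq.Build axiom (compareP axiom_comparable).

(* A concept structure together with a role structure. *)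
Definition structure : Type := seq fact.

(* Arrows only depend on the classes of their endpoints. Introduced expressions
   are recorded as written: if [HasC] were read modulo [cobj_eqv] then the rule
   decomposing a conjunction would introduce every sub-conjunction of a
   conjunction of n names, that is, 2^n - 1 objects. *)
Definition present (s : structure) (f : fact) : Prop :=
  match f with
  | HasC _ | HasR _ => f \in s
  | ArrC X Y => [/\ HasC X \in s, HasC Y \in s &
      exists X' Y', [/\ ArrC X' Y' \in s, cobj_eqv X X' & cobj_eqv Y Y']]
  | ArrR r q => [/\ HasR r \in s, HasR q \in s &
      exists r' q', [/\ ArrR r' q' \in s, robj_eqv r r' & robj_eqv q q']]
  end.

Definition with_endpoints (f : fact) : seq fact :=
  match f with
  | ArrC X Y => [:: HasC X; HasC Y; f]
  | ArrR r q => [:: HasR r; HasR q; f]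
  | _ => [:: f]
  end.

Definition initial (O : ontology) : structure :=
  [:: HasC CTop; HasC CBot] ++ [seq HasC (CName A) | A <- cnames O]
  ++ [seq HasC (OInd a) | a <- inds O]
  ++ [:: HasR RTop; HasR RBot] ++ [seq HasR (RName R) | R <- rnames O].

(** * Rules *)

Definition axiom_arrow (ax : axiom) : fact :=
  match ax with
  | GCI C D => ArrC C D
  | RoleIncl R R' => ArrR (RName R) (RName R')
  | Transitivity R => ArrR (RComp R) (RName R)
  | ConceptAssert a C => ArrC (OInd a) C
  | RoleAssert a b R => ArrR (RPair a b) (RName R)
  end.

(* [rule O prems concls]: an instance of a categorical rule. *)
Inductive rule (O : ontology) : seq fact -> seq fact -> Prop :=
| rule_it_c X :
    rule O [:: HasC X] [:: ArrC X CTop; ArrC CBot X; ArrC X X]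
| rule_it_r r :
    rule O [:: HasR r] [:: ArrR r RTop; ArrR RBot r; ArrR r r]
| rule_r r :
    rule O [:: HasR r] [:: HasC (OPiL r); HasC (OPiR r)]
| rule_tr_c X Y Z :
    rule O [:: ArrC X Y; ArrC Y Z] [:: ArrC X Z]
| rule_tr_r r q u :
    rule O [:: ArrR r q; ArrR q u] [:: ArrR r u]
| rule_f_l r :
    rule O [:: ArrC (OPiL r) CBot] [:: ArrC (OPiR r) CBot]
| rule_f_r r :
    rule O [:: ArrC (OPiR r) CBot] [:: ArrC (OPiL r) CBot]
| rule_ax ax :
    ax \in O -> rule O [::] [:: axiom_arrow ax]
| rule_and_d C D :
    rule O [:: HasC (CAnd C D)] [:: ArrC (CAnd C D) C; ArrC (CAnd C D) D]
| rule_and_c X C D :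
    rule O [:: ArrC X (OConcept C); ArrC X (OConcept D); HasC (CAnd C D)]
           [:: ArrC X (CAnd C D)]
| rule_or_d C D X :
    rule O [:: ArrC (COr C D) X] [:: ArrC C X; ArrC D X]
| rule_or_c C D X :
    rule O [:: ArrC (OConcept C) X; ArrC (OConcept D) X; HasC (COr C D)]
           [:: ArrC (COr C D) X]
| rule_neg X A :
    rule O [:: ArrC X (CName A); ArrC X (CNot A)] [:: ArrC X CBot]
| rule_ex R C :
    rule O [:: HasC (CEx R C)]
           [:: HasC C; ArrR (RFresh R C) (RName R);
               ArrC (CEx R C) (OPiL (RFresh R C));
               ArrC (OPiL (RFresh R C)) (CEx R C);
               ArrC (OPiR (RFresh R C)) C]
| rule_exH R C r :
    rule O [:: HasC (CEx R C); ArrR r (RName R); ArrC (OPiR r) C]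
           [:: ArrC (OPiL r) (OPiL (RFresh R C))]
| rule_ex_comp S X C D :
    rule O [:: ArrR (RComp S) (RName S); ArrC X (CEx S C); ArrC C (CEx S D)]
           [:: ArrC X (CEx S D)]
| rule_ex_all_obj X P R C D :
    rule O [:: ArrC X (CEx P C); ArrC X (CAll R D); ArrR (RName P) (RName R)]
           [:: HasC (CAnd C D)]
| rule_ex_all X P R C D :
    rule O [:: ArrC X (CEx P C); ArrC X (CAll R D); ArrR (RName P) (RName R);
               ArrC (CAnd C D) CBot]
           [:: ArrC X CBot]
| rule_ex_all_ind a b P R D :
    rule O [:: ArrR (RPair a b) (RName P); ArrC (OInd a) (CAll R D);
               ArrR (RName P) (RName R)]
           [:: ArrC (OInd a) (CEx P D); ArrC (OInd b) D]
| rule_ex_comp_all_obj X P S R C D :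
    rule O [:: ArrR (RName P) (RName S); ArrR (RComp S) (RName S);
               ArrR (RName S) (RName R);
               ArrC X (CEx P C); ArrC X (CAll R D)]
           [:: HasC (CAnd C (CAll S D))]
| rule_ex_comp_all X P S R C D :
    rule O [:: ArrR (RName P) (RName S); ArrR (RComp S) (RName S);
               ArrR (RName S) (RName R);
               ArrC X (CEx P C); ArrC X (CAll R D);
               ArrC (CAnd C (CAll S D)) CBot]
           [:: ArrC X CBot]
| rule_ex_comp_all_ind a b P S R D :
    rule O [:: ArrR (RName P) (RName S); ArrR (RComp S) (RName S);
               ArrR (RName S) (RName R);
               ArrR (RPair a b) (RName P); ArrC (OInd a) (CAll R D)]
           [:: ArrC (OInd a) (CEx P (CAll S D)); ArrC (OInd b) (CAll S D)].

Definition applicable (s : structure) (prems concls : seq fact) : Prop :=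
  (forall f, f \in prems -> present s f) /\
  (exists2 f, f \in concls & ~ present s f).

Definition add_facts (s : structure) (concls : seq fact) : structure :=
  s ++ flatten (map with_endpoints concls).

(* [run O n s]: [s] is obtained after [n] rule applications, in any order. *)
Inductive run (O : ontology) : nat -> structure -> Prop :=
| run_init : run O 0 (initial O)
| run_step n s prems concls :
    run O n s -> rule O prems concls -> applicable s prems concls ->
    run O n.+1 (add_facts s concls).

Definition saturated (O : ontology) (s : structure) : Prop :=
  forall prems concls, rule O prems concls -> ~ applicable s prems concls.

Definition saturation (O : ontology) (s : structure) : Prop :=
  (exists n, run O n s) /\ saturated O s.

Definition has_clash (O : ontology) (s : structure) : Prop :=
  exists2 a, a \in inds O & present s (ArrC (OInd a) CBot).

Definition inconsistent (O : ontology) : Prop :=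
  exists2 s, saturation O s & has_clash O s.

Definition consistent (O : ontology) : Prop := ~ inconsistent O.

(** * Serialization *)

Inductive symbol : Type :=
| Sbit of bool | Send
| Stop | Sbot | Sname | Snot | Sand | Sor | Sex | Sall
| Srname | Srpair | Srtop | Srbot | Srcomp | Srfresh
| Sconcept | Sind | Spil | Spir
| Shasc | Shasr | Sarrc | Sarrr
| Sgci | Sincl | Strans | Scassert | Srassert
| Syes | Sno.

Definition ser_name (a : name) : seq symbol := rcons (map Sbit a) Send.

(* Prefix notation; names are self-delimiting. *)
Fixpoint ser_concept (C : concept) : seq symbol :=
  match C with
  | CTop => [:: Stop]
  | CBot => [:: Sbot]
  | CName A => Sname :: ser_name A
  | CNot A => Snot :: ser_name A
  | CAnd C1 C2 => Sand :: ser_concept C1 ++ ser_concept C2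
  | COr C1 C2 => Sor :: ser_concept C1 ++ ser_concept C2
  | CEx R C1 => Sex :: ser_name R ++ ser_concept C1
  | CAll R C1 => Sall :: ser_name R ++ ser_concept C1
  end.

Definition ser_axiom (ax : axiom) : seq symbol :=
  match ax with
  | GCI C D => Sgci :: ser_concept C ++ ser_concept D
  | RoleIncl R R' => Sincl :: ser_name R ++ ser_name R'
  | Transitivity R => Strans :: ser_name R
  | ConceptAssert a C => Scassert :: ser_name a ++ ser_concept C
  | RoleAssert a b R => Srassert :: ser_name a ++ ser_name b ++ ser_name R
  end.

Definition ser_ontology (O : ontology) : seq symbol := flatten (map ser_axiom O).

Definition ontology_size (O : ontology) : nat := size (ser_ontology O).

Definition ser_robj (r : robj) : seq symbol :=
  match r with
  | RName R => Srname :: ser_name R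
  | RPair a b => Srpair :: ser_name a ++ ser_name b
  | RTop => [:: Srtop]
  | RBot => [:: Srbot]
  | RComp R => Srcomp :: ser_name R
  | RFresh R C => Srfresh :: ser_name R ++ ser_concept C
  end.

Definition ser_cobj (X : cobj) : seq symbol :=
  match X with
  | OConcept C => Sconcept :: ser_concept C
  | OInd a => Sind :: ser_name a
  | OPiL r => Spil :: ser_robj r
  | OPiR r => Spir :: ser_robj r
  end.

Definition ser_fact (f : fact) : seq symbol :=
  match f with
  | HasC X => Shasc :: ser_cobj X
  | HasR r => Shasr :: ser_robj r
  | ArrC X Y => Sarrc :: ser_cobj X ++ ser_cobj Y
  | ArrR r q => Sarrr :: ser_robj r ++ ser_robj q
  end.

Definition ser_structure (s : structure) : seq symbol :=
  flatten (map ser_fact s).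

Definition ser_verdict (b : bool) : symbol := if b then Syes else Sno.

(** * Deterministic multi-tape Turing machines *)

(* A cell holds a symbol or is blank ([None]). *)
Definition cell : Type := option symbol.

Inductive move : Type := MoveL | MoveR | MoveN.

(* Cells to the left of the head (nearest first), scanned cell, cells to the
   right of the head; all cells beyond the two lists are blank. *)
Record tape : Type := Tape { tleft : seq cell; thead : cell; tright : seq cell }.

Definition tape_move (m : move) (t : tape) : tape :=
  match m with
  | MoveL => Tape (behead (tleft t)) (head None (tleft t)) (thead t :: tright t)
  | MoveR => Tape (thead t :: tleft t) (head None (tright t)) (behead (tright t))
  | MoveN => t
  end.

Definition tape_write (x : cell) (t : tape) : tape := Tape (tleft t) x (tright t).

Definition tape_of (w : seq symbol) : tape :=
  let cells := map Some w in Tape [::] (head None cells) (behead cells).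

Record machine : Type := Machine {
  tm_ntapes : nat; (* the machine has [tm_ntapes.+1] tapes *)
  tm_state : finType;
  tm_start : tm_state;
  tm_halt : pred tm_state;
  tm_trans : tm_state -> {ffun 'I_tm_ntapes.+1 -> cell} ->
             tm_state * {ffun 'I_tm_ntapes.+1 -> cell * move} }.

Definition config (M : machine) : Type :=
  (tm_state M * {ffun 'I_(tm_ntapes M).+1 -> tape})%type.

Definition tm_step (M : machine) (c : config M) : config M :=
  if tm_halt c.1 then c else
  let q' := tm_trans c.1 [ffun i => thead (c.2 i)] in
  (q'.1, [ffun i => tape_move (q'.2 i).2 (tape_write (q'.2 i).1 (c.2 i))]).

(* The input is on tape 0; the other tapes are blank. *)
Definition tm_init (M : machine) (w : seq symbol) : config M :=
  (tm_start M, [ffun i => tape_of (if i == ord0 then w else [::])]).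

(* The output is read on tape 0, from the head up to the first blank cell. *)
Fixpoint read_symbols (cells : seq cell) : seq symbol :=
  if cells is Some x :: cells' then x :: read_symbols cells' else [::].

Definition tm_output (M : machine) (c : config M) : seq symbol :=
  read_symbols (thead (c.2 ord0) :: tright (c.2 ord0)).

(* On input [w], [M] halts after at most [t] steps with output [v]. *)
Definition computes_in (M : machine) (w : seq symbol) (t : nat)
    (v : seq symbol) : Prop :=
  let c := iter t (@tm_step M) (tm_init M w) in tm_halt c.1 /\ tm_output c = v.

(* Main.v *)
From HB Require Import structures.
From mathcomp Require Import all_boot all_algebra.
From mathcomp Require Import zify.
Require Import Defs.

Set Implicit Arguments.
Unset Strict Implicit.
Unset Printing Implicit Defensive.

(* All expressions that the rules can introduce lie in a universe of polynomial size: the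
   concepts under value restrictions are subconcepts of the ontology, and the rules put at
   most one value restriction, then one existential restriction or one conjunction, on top
   of them. Every rule application adds a fact of the universe, which bounds all runs.

   For the machine, programs over four stacks are compiled to Turing machines, and the
   polynomial-time functions on (trees encoding) data are shown to be closed under
   composition, pairing, equality tests and iteration with polynomially bounded states.
   Parsing, serialization and the naive saturation loop are then compositions of list
   comprehensions and such iterations. Since arrows are identified up to associativity,
   commutativity and idempotence, presence is tested on canonical forms, in which every
   junction is a strictly sorted list of canonical forms. Finally, two saturated structures
   contain the same arrows, so the verdict does not depend on the order of the rules. *)

(** * Stack programs *)

Definition symbol_code (a : symbol) : nat :=
  match a with
  | Sbit false => 0 | Sbit true => 1 | Send => 2
  | Stop => 3 | Sbot => 4 | Sname => 5 | Snot => 6 | Sand => 7 | Sor => 8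
  | Sex => 9 | Sall => 10 | Srname => 11 | Srpair => 12 | Srtop => 13
  | Srbot => 14 | Srcomp => 15 | Srfresh => 16 | Sconcept => 17 | Sind => 18
  | Spil => 19 | Spir => 20 | Shasc => 21 | Shasr => 22 | Sarrc => 23
  | Sarrr => 24 | Sgci => 25 | Sincl => 26 | Strans => 27 | Scassert => 28
  | Srassert => 29 | Syes => 30 | Sno => 31
  end.

Definition symbols : seq symbol :=
  [:: Sbit false; Sbit true; Send; Stop; Sbot; Sname; Snot; Sand; Sor; Sex;
      Sall; Srname; Srpair; Srtop; Srbot; Srcomp; Srfresh; Sconcept; Sind;
      Spil; Spir; Shasc; Shasr; Sarrc; Sarrr; Sgci; Sincl; Strans; Scassert;
      Srassert; Syes; Sno].

Definition symbol_decode (n : nat) : symbol := nth Sno symbols n.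

Lemma symbol_codeK : cancel symbol_code symbol_decode.
Proof. by case=> // -[]. Qed.

HB.instance Definition _ := Equality.copy symbol (can_type symbol_codeK).

Inductive ix : Type := I0 | I1 | I2 | I3.

Definition ix_ord (i : ix) : 'I_4 :=
  match i with
  | I0 => @Ordinal 4 0 isT | I1 => @Ordinal 4 1 isT
  | I2 => @Ordinal 4 2 isT | I3 => @Ordinal 4 3 isT
  end.

Record stacks : Type :=
  Stacks { stk0 : seq symbol; stk1 : seq symbol;
           stk2 : seq symbol; stk3 : seq symbol }.

Definition get (T : stacks) (i : ix) : seq symbol :=
  match i with I0 => stk0 T | I1 => stk1 T | I2 => stk2 T | I3 => stk3 T end.

Definition put (T : stacks) (i : ix) (w : seq symbol) : stacks :=
  let: Stacks a b c d := T in
  match i with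
  | I0 => Stacks w b c d | I1 => Stacks a w c d
  | I2 => Stacks a b w d | I3 => Stacks a b c w
  end.

Inductive guard : Type := TopIs of ix & cell | SameTop of ix & ix
  | GNot of guard | GAnd of guard & guard.

Fixpoint holds (g : guard) (f : ix -> cell) : bool :=
  match g with
  | TopIs i x => f i == x
  | SameTop i j => f i == f j
  | GNot g => ~~ holds g f
  | GAnd g h => holds g f && holds h f
  end.

Lemma eq_holds g f f' : f =1 f' -> holds g f = holds g f'.
Proof.
move=> e; elim: g => [i x|i j|g IH|g IHg h IHh] /=; rewrite ?e //.
- by rewrite IH.
- by rewrite IHg IHh.
Qed.

Definition top (T : stacks) (i : ix) : cell := ohead (get T i).

Inductive cmd : Type :=
| Skip
| Push of ix & symbol
| Pop of ix
| Seq of cmd & cmd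
| If of guard & cmd & cmd
| While of guard & cmd.

Inductive exec : cmd -> stacks -> nat -> stacks -> Prop :=
| exec_skip T : exec Skip T 0 T
| exec_push i a T : exec (Push i a) T 2 (put T i (a :: get T i))
| exec_pop i T : exec (Pop i) T 1 (put T i (behead (get T i)))
| exec_seq c1 c2 T1 T2 T3 m n : exec c1 T1 m T2 -> exec c2 T2 n T3 ->
    exec (Seq c1 c2) T1 (m + n).+1 T3
| exec_if g c1 c2 T T' n : exec (if holds g (top T) then c1 else c2) T n T' ->
    exec (If g c1 c2) T n.+1 T'
| exec_while_false g c T : ~~ holds g (top T) -> exec (While g c) T 1 T
| exec_while_true g c T1 T2 T3 m n : holds g (top T1) ->
    exec c T1 m T2 -> exec (While g c) T2 n T3 ->
    exec (While g c) T1 (m + n).+2 T3.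

(** * Compilation to Turing machines *)

Local Notation heads := {ffun 'I_4 -> cell}.
Local Notation actions := {ffun 'I_4 -> cell * move}.
Local Notation tapes := {ffun 'I_4 -> tape}.

Record frag : Type := Frag {
  fstate : finType;
  fstart : fstate;
  fhalt : pred fstate;
  ftrans : fstate -> heads -> fstate * actions }.

Definition frag_machine (F : frag) : machine :=
  @Machine 3 (fstate F) (fstart F) (@fhalt F) (@ftrans F).

Definition stay (hd : heads) : actions := [ffun i => (hd i, MoveN)].
Definition moving (i : ix) (m : move) (hd : heads) : actions :=
  [ffun j => (hd j, if j == ix_ord i then m else MoveN)].
Definition writing (i : ix) (a : symbol) (hd : heads) : actions :=
  [ffun j => (if j == ix_ord i then Some a else hd j, MoveN)].
Definition holds_at (g : guard) (hd : heads) : bool :=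
  holds g (fun i => hd (ix_ord i)).

Definition skip_frag : frag :=
  @Frag unit tt predT (fun _ hd => (tt, stay hd)).

Definition push_frag (i : ix) (a : symbol) : frag :=
  @Frag (option bool) None (fun q => q == Some true) (fun q hd =>
    if q is None then (Some false, moving i MoveL hd)
    else (Some true, writing i a hd)).

Definition pop_frag (i : ix) : frag :=
  @Frag bool false id (fun _ hd => (true, moving i MoveR hd)).

Definition seq_frag (F G : frag) : frag :=
  @Frag (fstate F + fstate G)%type (inl (fstart F))
    (fun q => if q is inr q then fhalt q else false)
    (fun q hd => match q with
     | inl q => if fhalt q then (inr (fstart G), stay hd)
                else (inl (ftrans q hd).1, (ftrans q hd).2)
     | inr q => (inr (ftrans q hd).1, (ftrans q hd).2) end).

Definition if_frag (g : guard) (F G : frag) : frag :=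
  @Frag (option (fstate F + fstate G)) None
    (fun q => match q with
     | Some (inl q) => fhalt q | Some (inr q) => fhalt q | None => false end)
    (fun q hd => match q with
     | None => (Some (if holds_at g hd then inl (fstart F)
                      else inr (fstart G)), stay hd)
     | Some (inl q) => (Some (inl (ftrans q hd).1), (ftrans q hd).2)
     | Some (inr q) => (Some (inr (ftrans q hd).1), (ftrans q hd).2) end).

Definition while_frag (g : guard) (F : frag) : frag :=
  @Frag (option (option (fstate F))) None (fun q => q == Some None)
    (fun q hd => match q with
     | None => (Some (if holds_at g hd then Some (fstart F) else None), stay hd)
     | Some None => (Some None, stay hd)
     | Some (Some q) => if fhalt q then (None, stay hd)
                        else (Some (Some (ftrans q hd).1), (ftrans q hd).2)
     end).

Fixpoint compile (c : cmd) : frag :=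
  match c with
  | Skip => skip_frag
  | Push i a => push_frag i a
  | Pop i => pop_frag i
  | Seq c1 c2 => seq_frag (compile c1) (compile c2)
  | If g c1 c2 => if_frag g (compile c1) (compile c2)
  | While g c => while_frag g (compile c)
  end.

Definition fstep (F : frag) (c : fstate F * tapes) : fstate F * tapes :=
  @tm_step (frag_machine F) c.

Definition tape_holds (t : tape) (w : seq symbol) : Prop :=
  exists k, thead t :: tright t = map Some w ++ nseq k None.

Definition represents (tp : tapes) (T : stacks) : Prop :=
  forall i, tape_holds (tp (ix_ord i)) (get T i).

Lemma ix_ord_inj : injective ix_ord.
Proof. by case; case. Qed.

Lemma get_put T i j w : get (put T i w) j = if ix_ord j == ix_ord i then w else get T j.
Proof. by case: T i j => [????] [] []. Qed.

Lemma tape_holds_top t w : tape_holds t w -> thead t = ohead w.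
Proof. by case=> k; case: w => [|a w] /=; [case: k => [|k]|]; case. Qed.

Lemma holds_atE g tp T : represents tp T ->
  holds_at g [ffun i => thead (tp i)] = holds g (top T).
Proof.
move=> r; apply: eq_holds => i; rewrite ffunE; exact: tape_holds_top.
Qed.

Lemma tape_write_head t : tape_write (thead t) t = t.
Proof. by case: t. Qed.

Lemma fstepE F q (tp : tapes) : ~~ @fhalt F q ->
  fstep (q, tp) = let q' := ftrans q [ffun i => thead (tp i)] in
   (q'.1, [ffun i => tape_move (q'.2 i).2 (tape_write (q'.2 i).1 (tp i))]).
Proof. by rewrite /fstep /tm_step /= => /negbTE ->. Qed.

Lemma fstep_stay F q q' (tp : tapes) : ~~ @fhalt F q ->
  ftrans q [ffun i => thead (tp i)] = (q', stay [ffun i => thead (tp i)]) ->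
  fstep (q, tp) = (q', tp).
Proof.
move=> h e; rewrite fstepE // e /=; congr pair.
by apply/ffunP=> i; rewrite !ffunE /= tape_write_head.
Qed.

Definition reaches (F : frag) q (tp : tapes) n q' tp' : Prop :=
  exists2 m, m <= n & iter m (@fstep F) (q, tp) = (q', tp').

Lemma reaches_trans F q1 tp1 m q2 tp2 n q3 tp3 :
  @reaches F q1 tp1 m q2 tp2 -> reaches q2 tp2 n q3 tp3 ->
  reaches q1 tp1 (m + n) q3 tp3.
Proof.
case=> a la ea [b lb eb]; exists (b + a); first by lia.
by rewrite iterD ea.
Qed.

Lemma reaches_step F q tp q' tp' :
  @fstep F (q, tp) = (q', tp') -> @reaches F q tp 1 q' tp'.
Proof. by exists 1. Qed.

Lemma reaches_le F q tp m n q' tp' : m <= n ->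
  @reaches F q tp m q' tp' -> reaches q tp n q' tp'.
Proof. by move=> l [a la ea]; exists a => //; lia. Qed.

Lemma reaches_lift (F G : frag) (e : fstate F -> fstate G) q tp n q' tp' :
  (forall q, ~~ fhalt q -> ~~ fhalt (e q)) ->
  (forall q hd, ~~ fhalt q ->
     ftrans (e q) hd = (e (ftrans q hd).1, (ftrans q hd).2)) ->
  reaches q tp n q' tp' -> fhalt q' -> reaches (e q) tp n (e q') tp'.
Proof.
move=> eh et [m lm em] hq'; apply: (reaches_le lm).
elim: m q tp em {lm} => [|m IH] q tp.
  by case=> -> ->; exists 0.
rewrite iterSr; case: (boolP (fhalt q)) => hq.
  rewrite /fstep /tm_step /= hq => /IH; exact: reaches_le.
rewrite fstepE //= => /IH h.
rewrite -add1n; apply: reaches_trans h; apply: reaches_step.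
by rewrite fstepE ?eh //= et.
Qed.

Lemma tape_holds_pop t w :
  tape_holds t w -> tape_holds (tape_move MoveR t) (behead w).
Proof.
case: t w => l h r [|a w] [k] /=.
  case: k => [//|k] [_ e]; exists k.-1.+1 => /=.
  by case: k e => [|k] ->.
case: w => [|b w] [_ e] /=; rewrite /tape_holds /= e /=.
  by exists k.-1.+1; case: k {e}.
by exists k.
Qed.

Lemma tape_holds_push a t w : tape_holds t w ->
  tape_holds (tape_write (Some a) (tape_move MoveL t)) (a :: w).
Proof. by case=> k e; exists k; rewrite /= e. Qed.

Lemma compile_correct c T n T' : exec c T n T' -> forall tp, represents tp T ->
  exists q tp', [/\ reaches (fstart (compile c)) tp n q tp', fhalt q
    & represents tp' T'].
Proof.
elim=> {c T n T'}.
- by move=> T tp r; exists tt, tp; split=> //; exists 0.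
- move=> i a T tp r; exists (Some true).
  set tp1 : tapes := [ffun j => if j == ix_ord i then tape_move MoveL (tp j) else tp j].
  set tp2 : tapes := [ffun j => if j == ix_ord i then tape_write (Some a) (tp1 j) else tp j].
  exists tp2; split=> //.
    apply: (@reaches_trans (push_frag i a) _ _ 1 (Some false) tp1 1).
      apply: reaches_step; rewrite fstepE //=; congr pair.
      apply/ffunP=> j; rewrite !ffunE /=.
      by case: ifP => _ /=; rewrite ?tape_write_head //; case: (tp j).
    apply: reaches_step; rewrite fstepE //=; congr pair.
    apply/ffunP=> j; rewrite /tp2 /tp1 !ffunE /=.
    by case: ifP => h /=; rewrite ?h ?tape_write_head.
  move=> j; rewrite /tp2 /tp1 !ffunE get_put.
  case: ifP => [/eqP /ix_ord_inj ->|_]; last exact: r.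
  rewrite eqxx; exact: tape_holds_push.
- move=> i T tp r; exists true.
  exists [ffun j => if j == ix_ord i then tape_move MoveR (tp j) else tp j].
  split=> //.
    apply: reaches_step; rewrite fstepE //=; congr pair.
    apply/ffunP=> j; rewrite !ffunE /= tape_write_head.
    by case: ifP.
  move=> j; rewrite !ffunE get_put; case: ifP => [/eqP e|_]; last exact: r.
  rewrite (ix_ord_inj e); exact: tape_holds_pop.
- move=> c1 c2 T1 T2 T3 m n _ IH1 _ IH2 tp r1.
  have [q1 [tp1 [h1 hq1 r2]]] := IH1 _ r1.
  have [q2 [tp2 [h2 hq2 r3]]] := IH2 _ r2.
  exists (inr q2), tp2; split=> //.
  have -> : (m + n).+1 = m + (1 + n) by lia.
  apply: (@reaches_trans (compile (Seq c1 c2)) _ _ _ (inl q1) tp1).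
    apply: (@reaches_lift (compile c1) (compile (Seq c1 c2)) inl) h1 hq1 => //=.
    by move=> q hd /negbTE ->.
  apply: (@reaches_trans (compile (Seq c1 c2)) _ _ _ (inr (fstart (compile c2))) tp1).
    by apply: reaches_step; apply: fstep_stay => //=; rewrite hq1.
  exact: (@reaches_lift (compile c2) (compile (Seq c1 c2)) inr) h2 hq2.
- move=> g c1 c2 T T' n _ IH tp r.
  have [q [tp' [h hq r']]] := IH _ r.
  have st : reaches (fstart (compile (If g c1 c2))) tp 1
     (Some (if holds g (top T) then inl (fstart (compile c1))
            else inr (fstart (compile c2)))) tp.
    by apply: reaches_step; apply: fstep_stay => //=; rewrite (holds_atE _ r).
  case: (holds g (top T)) q h hq st => q h hq st.
    exists (Some (inl q)), tp'; split=> //; rewrite -add1n.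
    apply: reaches_trans st _.
    exact: (@reaches_lift (compile c1) (compile (If g c1 c2)) (Some \o inl)) h hq.
  exists (Some (inr q)), tp'; split=> //; rewrite -add1n.
  apply: reaches_trans st _.
  exact: (@reaches_lift (compile c2) (compile (If g c1 c2)) (Some \o inr)) h hq.
- move=> g c T /negbTE h tp r; exists (Some None), tp; split=> //.
  by apply: reaches_step; apply: fstep_stay => //=; rewrite (holds_atE _ r) h.
- move=> g c T1 T2 T3 m n hg _ IH1 _ IH2 tp r1.
  have [q1 [tp1 [h1 hq1 r2]]] := IH1 _ r1.
  have [q2 [tp2 [h2 hq2 r3]]] := IH2 _ r2.
  exists q2, tp2; split=> //.
  have -> : (m + n).+2 = 1 + (m + (1 + n)) by lia.
  apply: (@reaches_trans (compile (While g c)) _ _ _ (Some (Some (fstart (compile c)))) tp).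
    by apply: reaches_step; apply: fstep_stay => //=; rewrite (holds_atE _ r1) hg.
  apply: (@reaches_trans (compile (While g c)) _ _ _ (Some (Some q1)) tp1).
    apply: (@reaches_lift (compile c) (compile (While g c)) (Some \o Some)) h1 hq1 => //=.
    by move=> q hd /negbTE ->.
  apply: reaches_trans h2.
  by apply: reaches_step; apply: fstep_stay => //=; rewrite hq1.
Qed.

Lemma iter_fstep_halt F q (tp : tapes) n : @fhalt F q ->
  iter n (@fstep F) (q, tp) = (q, tp).
Proof. by move=> h; elim: n => //= n ->; rewrite /fstep /tm_step /= h. Qed.

Lemma read_symbols_holds w k : read_symbols (map Some w ++ nseq k None) = w.
Proof. by elim: w => [|a w IH] /=; [case: k | rewrite IH]. Qed.

Lemma compile_computes c w n v a b d : exec c (Stacks w [::] [::] [::]) n (Stacks v a b d) ->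
  forall t, n <= t -> computes_in (frag_machine (compile c)) w t v.
Proof.
move=> h t lt.
set tp : tapes := [ffun i => tape_of (if i == ord0 then w else [::])].
have r : represents tp (Stacks w [::] [::] [::]).
  move=> i; rewrite ffunE /tape_holds.
  case: i => /=; [|by exists 1..].
  by case: (w) => [|x u]; [exists 1|exists 0; rewrite /= cats0].
have [q [tp' [[m lm em] hq r']]] := compile_correct h r.
have e : iter t (@fstep (compile c)) (fstart (compile c), tp) = (q, tp').
  by rewrite -(subnK (leq_trans lm lt)) iterD em iter_fstep_halt.
rewrite /computes_in /tm_init; split.
  by rewrite [iter _ _ _]e.
rewrite [iter _ _ _]e /tm_output [X in X.2]/=.
have [k] := r' I0; rewrite (_ : ix_ord I0 = ord0); last exact: val_inj.
by move=> ek; rewrite [_ :: _]ek read_symbols_holds.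
Qed.

(** * Polynomial bounds *)

Definition pbounded (I : Type) (s f : I -> nat) : Prop :=
  exists k, forall i, f i <= (s i + 2) ^ k.

Section PolyBounds.
Variables (I : Type) (s : I -> nat).
Implicit Types f g : I -> nat.

Lemma pbounded_le f g : (forall i, f i <= g i) -> pbounded s g -> pbounded s f.
Proof. by move=> l [k b]; exists k => i; apply: leq_trans (l i) (b i). Qed.

Lemma pbounded_refl : pbounded s s.
Proof. by exists 1 => i; rewrite expn1 leq_addr. Qed.

Lemma pbounded_const n : pbounded s (fun=> n).
Proof.
exists n => i; case: n => // n; apply: leq_trans (ltnW (ltn_expl n.+1 (ltnSn 1))) _.
by rewrite leq_exp2r // leq_addl.
Qed.

Lemma pbounded_mul f g : pbounded s f -> pbounded s g -> pbounded s (fun i => f i * g i).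
Proof. by move=> [k bf] [l bg]; exists (k + l) => i; rewrite expnD leq_mul. Qed.

Lemma pbounded_add f g : pbounded s f -> pbounded s g -> pbounded s (fun i => f i + g i).
Proof.
move=> [k bf] [l bg]; exists (k + l).+1 => i.
have h m : 0 < (s i + 2) ^ m by rewrite expn_gt0 addnS.
rewrite expnS expnD; move: (bf i) (bg i) (h k) (h l).
move: (f i) (g i) (_ ^ k) (_ ^ l) => a b x y la lb x0 y0.
apply: (@leq_trans (2 * (x * y))); first by nia.
by rewrite leq_mul2r leq_addl orbT.
Qed.

Lemma pbounded_trans f g : pbounded s f -> pbounded f g -> pbounded s g.
Proof.
move=> [k bf] [l bg]; exists (k.+2 * l) => i; apply: leq_trans (bg i) _.
rewrite expnM; case: l {bg} => [|l]; first by rewrite !expn0.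
rewrite leq_exp2r // !expnS; have : 0 < (s i + 2) ^ k by rewrite expn_gt0 addnS.
move: (bf i); move: (_ ^ k) => x b x0.
have : 2 * (2 * x) <= (s i + 2) * ((s i + 2) * x) by rewrite !leq_mul ?leq_addl.
by lia.
Qed.

End PolyBounds.

Ltac pbound := first
  [ assumption
  | exact: pbounded_refl
  | lazymatch goal with
    | |- pbounded ?s (fun i => @?f i + @?g i) => apply: (@pbounded_add _ s f g); pbound
    | |- pbounded ?s (fun i => @?f i * @?g i) => apply: (@pbounded_mul _ s f g); pbound
    | |- pbounded _ _ => exact: pbounded_const
    end
  | idtac ].

(** * Trees on stacks *)

Inductive tree : Type := L | N of tree & tree.

Fixpoint tser (t : tree) : seq symbol :=
  match t with L => [:: Stop] | N t u => Sand :: tser t ++ tser u end.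

Definition tsize (t : tree) : nat := size (tser t).

Lemma tsize_N t u : tsize (N t u) = (tsize t + tsize u).+1.
Proof. by rewrite /tsize /= size_cat. Qed.

Lemma tsize_gt0 t : 0 < tsize t.
Proof. by case: t. Qed.

Lemma tser_cat_inj t u r r' : tser t ++ r = tser u ++ r' -> t = u /\ r = r'.
Proof.
elim: t u r r' => [|t1 IH1 t2 IH2] [|u1 u2] r r' //=; first by case.
by case; rewrite -!catA => /IH1 [-> /IH2 [-> ->]].
Qed.

Lemma tser_inj : injective tser.
Proof. by move=> t u e; have [] := @tser_cat_inj t u [::] [::]; rewrite ?e. Qed.

Definition digit (a : symbol) : bool := (a == Sand) || (a == Stop).

Lemma tser_digit t : all digit (tser t).
Proof. by elim: t => //= t IH u IH'; rewrite all_cat IH. Qed.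

Definition ex (c : cmd) (T : stacks) (n : nat) (T' : stacks) : Prop :=
  exists2 m, m <= n & exec c T m T'.

Lemma ex_le c T m n T' : ex c T m T' -> m <= n -> ex c T n T'.
Proof. by case=> k lk e l; exists k => //; apply: leq_trans l. Qed.

Lemma ex_eq c T n T1 T2 : ex c T n T1 -> T1 = T2 -> ex c T n T2.
Proof. by move=> ? <-. Qed.

Lemma ex_skip T : ex Skip T 0 T.
Proof. by exists 0 => //; constructor. Qed.

Lemma ex_push i a T : ex (Push i a) T 2 (put T i (a :: get T i)).
Proof. by exists 2 => //; constructor. Qed.

Lemma ex_pop i T : ex (Pop i) T 1 (put T i (behead (get T i))).
Proof. by exists 1 => //; constructor. Qed.

Lemma ex_seq c1 c2 T1 T2 T3 m n :
  ex c1 T1 m T2 -> ex c2 T2 n T3 -> ex (Seq c1 c2) T1 (m + n).+1 T3.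
Proof.
move=> [a la ea] [b lb eb]; exists (a + b).+1; first by lia.
exact: exec_seq ea eb.
Qed.

Lemma ex_if g c1 c2 T n T' :
  ex (if holds g (top T) then c1 else c2) T n T' -> ex (If g c1 c2) T n.+1 T'.
Proof. by case=> m lm e; exists m.+1 => //; constructor. Qed.

Lemma ex_while_false g c T : ~~ holds g (top T) -> ex (While g c) T 1 T.
Proof. by move=> h; exists 1 => //; constructor. Qed.

Lemma ex_while_true g c T1 T2 T3 m n : holds g (top T1) ->
  ex c T1 m T2 -> ex (While g c) T2 n T3 -> ex (While g c) T1 (m + n).+2 T3.
Proof.
move=> h [a la ea] [b lb eb]; exists (a + b).+2; first by lia.
exact: exec_while_true h ea eb.
Qed.

Lemma exec_size0 c T n T' : exec c T n T' -> size (stk0 T') <= size (stk0 T) + n.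
Proof.
elim=> {c T n T'}; try by move=> *; lia.
- by move=> i a [????]; case: i => /=; lia.
- by move=> i [????]; case: i => /=; rewrite ?size_behead; lia.
Qed.

Lemma ex_size0 c T n T' : ex c T n T' -> size (stk0 T') <= size (stk0 T) + n.
Proof. by case=> m lm /exec_size0 h; lia. Qed.

Infix ";;" := Seq (at level 61, right associativity).

Ltac ex_atom := first [ apply: ex_push | apply: ex_pop | apply: ex_skip ].
Ltac ex_line := repeat (first [ apply: ex_seq; [ex_atom |] | ex_atom ]; cbn [get put stk0 stk1 stk2 stk3 behead]).

Definition aux (i : ix) : bool := if i is (I1 | I2) then true else false.

Definition stash_loop (i : ix) : cmd :=
  While (TopIs I3 (Some Stop))
    (If (TopIs I0 (Some Sand))
       (Pop I0 ;; Push i Sand ;; Push I3 Stop)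
       (Pop I0 ;; Push i Stop ;; Pop I3)).

(* Moves the tree on top of stack 0, reversed, to stack [i], above a mark [Send];
   stack 3 counts in unary the subtrees still to be moved. *)
Definition stash (i : ix) : cmd :=
  Push i Send ;; Push I3 Send ;; Push I3 Stop ;; stash_loop i ;; Pop I3.

Definition shift_loop (i : ix) (js : seq ix) : cmd :=
  While (GNot (TopIs i (Some Send)))
    (If (TopIs i (Some Sand))
       (Pop i ;; foldr (fun j c => Push j Sand ;; c) Skip js)
       (Pop i ;; foldr (fun j c => Push j Stop ;; c) Skip js)).

Definition shift_to (i : ix) (js : seq ix) : cmd := shift_loop i js ;; Pop i.

Definition shift (i j : ix) : cmd := shift_to i [:: j].

Definition drop_tree : cmd := stash I1 ;; shift_to I1 [::].
Definition dup_tree : cmd :=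
  Push I2 Send ;; stash I1 ;; shift_to I1 [:: I0; I2] ;;
  Push I1 Send ;; shift I2 I1 ;; shift I1 I0.
Definition swap_trees : cmd := stash I1 ;; stash I2 ;; shift I1 I0 ;; shift I2 I0.

Lemma stash_loop_tree i T t w r0 r3 n T' : aux i ->
  ex (stash_loop i) (put (put (put T I0 r0) i (rev (tser t) ++ w)) I3 r3) n T' ->
  ex (stash_loop i) (put (put (put T I0 (tser t ++ r0)) i w) I3 (Stop :: r3))
    (n + 12 * tsize t) T'.
Proof.
case: T => a b c d ai.
elim: t w r0 r3 n => [|t IHt u IHu] w r0 r3 n h.
  by case: i ai h => //= _ h; (apply: ex_le; [apply: ex_while_true h => //;
    apply: ex_if; ex_line | rewrite /tsize /=; lia]).
have e : rev (tser (N t u)) ++ w = rev (tser u) ++ rev (tser t) ++ Sand :: w.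
  by rewrite /= rev_cons rev_cat -cats1 -!catA.
rewrite e in h; have {e}h := IHt (Sand :: w) (tser u ++ r0) (Stop :: r3) _ (IHu _ _ _ _ h).
rewrite /= -catA; case: i ai {IHt IHu} h => //= _ h;
  (apply: ex_le; [apply: ex_while_true h => //; apply: ex_if; ex_line | rewrite tsize_N; lia]).
Qed.

Lemma ex_stash i T t r0 : aux i -> stk0 T = tser t ++ r0 ->
  ex (stash i) T (12 * tsize t + 20)
    (put (put T I0 r0) i (rev (tser t) ++ Send :: get T i)).
Proof.
case: T => a b c d ai /= ->.
have := @stash_loop_tree i (Stacks a b c d) t (Send :: get (Stacks a b c d) i) r0
  (Send :: d) 1 _ ai (ex_while_false _ _).
by case: i ai => //= _ /(_ isT) h; (apply: ex_le; [ do 3 (apply: ex_seq; [ex_atom|]);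
  apply: ex_seq; [exact: h | ex_line] | lia]).
Qed.

Lemma ex_clear T w r i : get T i = w ++ Send :: r -> all digit w ->
  ex (shift_to i [::]) T (10 * size w + 10) (put T i r).
Proof.
move=> e dw.
have h : ex (shift_loop i [::]) T (10 * size w + 5) (put T i (Send :: r)).
  elim: w T e dw => [|x w IH] T e.
    move=> _; rewrite (_ : put _ _ _ = T); last by case: T i e => [????] [] /= ->.
    by apply: ex_le; [apply: ex_while_false; rewrite /= /top e|].
  move=> /andP[dx dw]; apply: ex_le; [apply: ex_while_true|].
  - by rewrite /= /top e /=; case/orP: dx => /eqP ->.
  - by apply: ex_if; case: ifP => _; rewrite /=; ex_line.
  - by have := IH (put T i (behead (get T i))); case: T i e {IH} => [????] [] /= ->; apply.
  - by rewrite /=; lia.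
apply: ex_le; first by (apply: ex_seq; [exact: h|case: T i {e h} => [????] []; ex_line]).
by lia.
Qed.

Lemma ex_shift T w r i j : ix_ord i != ix_ord j ->
  get T i = w ++ Send :: r -> all digit w ->
  ex (shift i j) T (10 * size w + 10) (put (put T i r) j (rev w ++ get T j)).
Proof.
move=> ij e dw.
have h : ex (shift_loop i [:: j]) T (10 * size w + 5)
    (put (put T i (Send :: r)) j (rev w ++ get T j)).
  elim: w T e dw => [|x w IH] T e.
    move=> _; rewrite (_ : put _ _ _ = T); last by case: T i j ij e => [????] [] [] //= _ ->.
    by apply: ex_le; [apply: ex_while_false; rewrite /= /top e|].
  move=> /andP[dx dw]; apply: ex_le.
    apply: (@ex_while_true _ _ _ (put (put T i (w ++ Send :: r)) j (x :: get T j))).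
    - by rewrite /= /top e /=; case/orP: dx => /eqP ->.
    - apply: ex_if; rewrite /= /top e /=; case/orP: dx => /eqP -> /=;
        case: T i j ij e {IH} => [????] [] [] //= _ ->; ex_line.
    - have := IH (put (put T i (w ++ Send :: r)) j (x :: get T j)).
      rewrite rev_cons -cats1 -catA /=.
      by case: T i j ij e {IH} => [????] [] [] //= _ _; apply.
  by rewrite /=; lia.
apply: ex_le; first by (apply: ex_seq; [exact: h|
  case: T i j ij {e h} => [????] [] [] //= _; ex_line]).
by lia.
Qed.

Lemma ex_shift2 a b c d w : all digit w ->
  ex (shift_to I1 [:: I0; I2]) (Stacks a (w ++ Send :: b) c d) (12 * size w + 10)
    (Stacks (rev w ++ a) b (rev w ++ c) d).
Proof.
move=> dw.
have h : ex (shift_loop I1 [:: I0; I2]) (Stacks a (w ++ Send :: b) c d) (12 * size w + 5)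
    (Stacks (rev w ++ a) (Send :: b) (rev w ++ c) d).
  elim: w a c dw => [|x w IH] a c.
    by move=> _; apply: ex_le; [exact: ex_while_false|].
  rewrite rev_cons -cats1 -!catA /=.
  move=> /andP[dx /IH{}IH]; apply: ex_le.
    apply: ex_while_true (IH (x :: a) (x :: c)).
    - by case/orP: dx => /eqP ->.
    - by apply: ex_if; case/orP: dx => /eqP ->; ex_line.
  by rewrite /=; lia.
apply: ex_le; first by (apply: ex_seq; [exact: h| ex_line]).
by lia.
Qed.

Lemma ex_drop t r0 b c d :
  ex drop_tree (Stacks (tser t ++ r0) b c d) (30 * tsize t + 60) (Stacks r0 b c d).
Proof.
apply: ex_le; first apply: ex_seq.
- exact: (@ex_stash I1 _ t r0).
- by apply: ex_clear => //=; rewrite all_rev tser_digit.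
by rewrite size_rev -/(tsize t); lia.
Qed.

Lemma ex_dup t r0 b c d : ex dup_tree (Stacks (tser t ++ r0) b c d)
  (60 * tsize t + 100) (Stacks (tser t ++ tser t ++ r0) b c d).
Proof.
apply: ex_le.
  apply: ex_seq; first ex_atom.
  apply: ex_seq; first exact: (@ex_stash I1 _ t r0).
  apply: ex_seq; first by apply: ex_shift2; rewrite all_rev tser_digit.
  rewrite revK; apply: ex_seq; first ex_atom.
  apply: ex_seq; first by apply: (@ex_shift _ (tser t) c) => //; apply: tser_digit.
  apply: ex_eq; first by apply: (@ex_shift _ (rev (tser t)) b) => //; rewrite all_rev tser_digit.
  by rewrite /= revK.
by rewrite !size_rev -/(tsize t); lia.
Qed.

Lemma ex_swap t u r0 b c d : ex swap_trees (Stacks (tser t ++ tser u ++ r0) b c d)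
  (30 * (tsize t + tsize u) + 100) (Stacks (tser u ++ tser t ++ r0) b c d).
Proof.
apply: ex_le.
  apply: ex_seq; first exact: (@ex_stash I1 _ t (tser u ++ r0)).
  apply: ex_seq; first exact: (@ex_stash I2 _ u r0).
  apply: ex_seq; first by apply: (@ex_shift _ (rev (tser t)) b) => //; rewrite all_rev tser_digit.
  apply: ex_eq; first by apply: (@ex_shift _ (rev (tser u)) c) => //; rewrite all_rev tser_digit.
  by rewrite /= !revK.
by rewrite !size_rev -/(tsize t) -/(tsize u); lia.
Qed.

(** * Polynomial-time transformations of trees *)

(* A single program maps every [u i] to [v i], whatever lies below on the stacks. *)
Definition transforms (I : Type) (u v : I -> tree) : Prop :=
  exists c k, forall i r0 r1 r2 r3,
    ex c (Stacks (tser (u i) ++ r0) r1 r2 r3) ((tsize (u i) + 2) ^ k)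
      (Stacks (tser (v i) ++ r0) r1 r2 r3).

Section Transforms.
Variable I : Type.
Implicit Types u v w b : I -> tree.

Lemma transforms_intro u v c cost : pbounded (tsize \o u) cost ->
  (forall i r0 r1 r2 r3, ex c (Stacks (tser (u i) ++ r0) r1 r2 r3) (cost i)
      (Stacks (tser (v i) ++ r0) r1 r2 r3)) -> transforms u v.
Proof.
by move=> [k b] h; exists c, k => i r0 r1 r2 r3; apply: ex_le (h _ _ _ _ _) (b i).
Qed.

Lemma transforms_elim u v : transforms u v -> exists c cost,
  pbounded (tsize \o u) cost /\
  (forall i r0 r1 r2 r3, ex c (Stacks (tser (u i) ++ r0) r1 r2 r3) (cost i)
      (Stacks (tser (v i) ++ r0) r1 r2 r3)).
Proof.
by move=> [c [k h]]; exists c, (fun i => (tsize (u i) + 2) ^ k); split=> //; exists k.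
Qed.

Lemma transforms_size u v : transforms u v -> pbounded (tsize \o u) (tsize \o v).
Proof.
case/transforms_elim=> c [cost [b h]].
apply: (@pbounded_le _ _ _ (fun i => (tsize \o u) i + cost i)); last by pbound.
move=> i; have /= := ex_size0 (h i [::] [::] [::] [::]).
by rewrite !cats0.
Qed.

Lemma transforms_id u : transforms u u.
Proof.
exists Skip, 0 => i r0 r1 r2 r3; exact: ex_le (ex_skip _) _.
Qed.

Lemma transforms_trans u v w : transforms u v -> transforms v w -> transforms u w.
Proof.
move=> uv vw; have sv := transforms_size uv.
case/transforms_elim: uv => c [cost [b h]].
case/transforms_elim: vw => c' [cost' [b' h']].
apply: (@transforms_intro u w (c ;; c') (fun i => cost i + cost' i + 1)).
  have := pbounded_trans sv b' => b''; pbound.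
move=> i r0 r1 r2 r3; apply: ex_le; first exact: ex_seq (h _ _ _ _ _) (h' _ _ _ _ _).
by lia.
Qed.

Definition push_string (j : ix) (w : seq symbol) : cmd :=
  foldr (fun a c => c ;; Push j a) Skip w.

Lemma ex_push_string j (w : seq symbol) T :
  ex (push_string j w) T (3 * size w) (put T j (w ++ get T j)).
Proof.
elim: w => [|a w IH] /=.
  by apply: ex_eq; [exact: ex_skip | case: T j => [????] []].
apply: ex_le; first apply: ex_seq IH _.
  by apply: ex_eq; [exact: ex_push | case: T j => [????] []].
by lia.
Qed.

Lemma transforms_const u t : transforms u (fun=> t).
Proof.
apply: (@transforms_intro _ _ (drop_tree ;; push_string I0 (tser t))
  (fun i => 30 * (tsize \o u) i + (61 + 3 * tsize t))); first by pbound.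
move=> i r0 r1 r2 r3; apply: ex_le.
  exact: ex_seq (ex_drop _ _ _ _ _) (ex_push_string I0 _ _).
by rewrite /= -/(tsize t); lia.
Qed.

Lemma transforms_pair u v w :
  transforms u v -> transforms u w -> transforms u (fun i => N (v i) (w i)).
Proof.
move=> uv uw; have sv := transforms_size uv; have sw := transforms_size uw.
case/transforms_elim: uv => c [cost [b h]].
case/transforms_elim: uw => c' [cost' [b' h']].
apply: (@transforms_intro _ _
  (dup_tree ;; c ;; swap_trees ;; c' ;; swap_trees ;; Push I0 Sand)
  (fun i => 90 * (tsize \o u) i + cost i + cost' i + 60 * (tsize \o v) i + 30 * (tsize \o w) i + 400)).
  by pbound.
move=> i r0 r1 r2 r3; apply: ex_le.
  apply: ex_seq; first exact: ex_dup.
  apply: ex_seq; first exact: h.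
  apply: ex_seq; first exact: ex_swap.
  apply: ex_seq; first exact: h'.
  apply: ex_seq; first exact: ex_swap.
  apply: ex_eq; first exact: ex_push.
  by rewrite /= catA.
by rewrite /=; lia.
Qed.

Lemma transforms_fst u v : transforms (fun i => N (u i) (v i)) u.
Proof.
apply: (@transforms_intro _ _ (Pop I0 ;; swap_trees ;; drop_tree)
  (fun i => 60 * (tsize \o (fun i => N (u i) (v i))) i + 200)); first by pbound.
move=> i r0 r1 r2 r3 /=; rewrite -catA; apply: ex_le.
  apply: ex_seq; first exact: ex_pop.
  apply: ex_seq; first exact: ex_swap.
  exact: ex_drop.
by rewrite tsize_N; lia.
Qed.

Lemma transforms_snd u v : transforms (fun i => N (u i) (v i)) v.
Proof.
apply: (@transforms_intro _ _ (Pop I0 ;; drop_tree)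
  (fun i => 60 * (tsize \o (fun i => N (u i) (v i))) i + 200)); first by pbound.
move=> i r0 r1 r2 r3 /=; rewrite -catA; apply: ex_le.
  apply: ex_seq; first exact: ex_pop.
  exact: ex_drop.
by rewrite tsize_N; lia.
Qed.

Lemma transforms_branch u v b : transforms u b ->
  @transforms {i | b i = L} (u \o sval) (v \o sval) ->
  @transforms {i | b i <> L} (u \o sval) (v \o sval) ->
  transforms u v.
Proof.
move=> ub [cL [kL hL]] [cN [kN hN]]; have sb := transforms_size ub.
case/transforms_elim: ub => c [cost [bd h]].
apply: (@transforms_intro _ _
  (dup_tree ;; c ;; If (TopIs I0 (Some Stop)) (Pop I0 ;; cL) (drop_tree ;; cN))
  (fun i => 60 * (tsize \o u) i + cost i + 30 * (tsize \o b) i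
     + (tsize (u i) + 2) ^ kL + (tsize (u i) + 2) ^ kN + 300)).
  by pbound; [exists kL | exists kN].
move=> i r0 r1 r2 r3; case e : (b i) => [|t1 t2].
  apply: ex_le.
    apply: ex_seq; first exact: ex_dup.
    apply: ex_seq; first exact: h.
    apply: ex_if; rewrite e /=; apply: ex_seq; first exact: ex_pop.
    exact: (hL (exist _ i e)).
  by rewrite /=; lia.
have nL : b i <> L by rewrite e.
apply: ex_le.
  apply: ex_seq; first exact: ex_dup.
  apply: ex_seq; first exact: h.
  apply: ex_if; rewrite (_ : holds _ _ = false); last by rewrite e.
  apply: ex_seq; first exact: ex_drop.
  exact: (hN (exist _ i nL)).
by rewrite /=; lia.
Qed.

Definition tbool (b : bool) : tree := if b then N L L else L.

Definition eq_cmd : cmd :=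
  Pop I0 ;; stash I1 ;; stash I2 ;;
  While (GAnd (SameTop I1 I2) (GNot (TopIs I1 (Some Send)))) (Pop I1 ;; Pop I2) ;;
  If (SameTop I1 I2) (push_string I0 (tser (tbool true))) (push_string I0 (tser (tbool false))) ;;
  shift_to I1 [::] ;; shift_to I2 [::].

Lemma ex_compare (w w' : seq symbol) r0 r1 r2 r3 : all digit w -> all digit w' ->
  exists v v' : seq symbol, [/\ all digit v, all digit v', size v <= size w /\ size v' <= size w',
    ohead (v ++ Send :: r1) == ohead (v' ++ Send :: r2) = (w == w') &
  ex (While (GAnd (SameTop I1 I2) (GNot (TopIs I1 (Some Send)))) (Pop I1 ;; Pop I2))
    (Stacks r0 (w ++ Send :: r1) (w' ++ Send :: r2) r3) (10 * size w + 10)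
    (Stacks r0 (v ++ Send :: r1) (v' ++ Send :: r2) r3)].
Proof.
elim: w w' => [|a w IH] [|a' w'] /=.
- move=> _ _; exists [::], [::]; split=> //.
  by apply: ex_le; first exact: ex_while_false.
- move=> _ /andP[da dw]; exists [::], (a' :: w'); split=> //=; first by rewrite da.
    by case/orP: da => /eqP ->.
  by apply: ex_le; first by apply: ex_while_false; case/orP: da => /eqP ->.
- move=> /andP[da dw] _; exists (a :: w), [::]; split=> //=; first by rewrite da.
    by case/orP: da => /eqP ->.
  apply: ex_le; first by apply: ex_while_false; case/orP: da => /eqP ->.
  by lia.
move=> /andP[da dw] /andP[da' dw'].
case: (eqVneq a a') => [<-|ne].
  have [v [v' [dv dv' [sv sv'] e h]]] := IH _ dw dw'.
  exists v, v'; split=> //; try by lia.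
    by rewrite e eqseq_cons eqxx.
  apply: ex_le.
    apply: ex_while_true h; first by rewrite /= eqxx; case/orP: da => /eqP ->.
    by ex_line.
  by rewrite /=; lia.
exists (a :: w), (a' :: w'); split=> //=; rewrite ?da ?da' //.
  by rewrite eqseq_cons (negbTE ne) -[RHS](negbTE ne).
apply: ex_le; first apply: ex_while_false.
  by rewrite /= negb_and; apply/orP; left; apply: contra ne => /eqP [->].
by lia.
Qed.

Lemma transforms_eq u v (d : I -> bool) : (forall i, reflect (u i = v i) (d i)) ->
  transforms (fun i => N (u i) (v i)) (tbool \o d).
Proof.
move=> dP; apply: (@transforms_intro _ _ eq_cmd
  (fun i => 60 * (tsize \o (fun i => N (u i) (v i))) i + 300)); first by pbound.
move=> i r0 r1 r2 r3.
have du : all digit (rev (tser (u i))) by rewrite all_rev tser_digit.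
have dv : all digit (rev (tser (v i))) by rewrite all_rev tser_digit.
have [w [w' [dw dw' [sw sw'] e h]]] := ex_compare r0 r1 r2 r3 du dv.
have {}e : ohead (w ++ Send :: r1) == ohead (w' ++ Send :: r2) = d i.
  rewrite e; apply/eqP/dP => [/(can_inj revK)/tser_inj//|-> //].
rewrite /= -catA; apply: ex_le.
  apply: ex_seq; first exact: ex_pop.
  apply: ex_seq; first exact: (@ex_stash I1).
  apply: ex_seq; first exact: (@ex_stash I2).
  apply: ex_seq; first exact: h.
  apply: (@ex_seq _ _ _ (Stacks (tser (tbool (d i)) ++ r0) (w ++ Send :: r1) (w' ++ Send :: r2) r3) _ 20).
    apply: (@ex_le _ _ 16) => //; apply: ex_if; rewrite [holds _ _]e.
    by case: (d i); (apply: ex_le; first exact: ex_push_string).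
  apply: ex_seq; first by apply: (@ex_clear _ w r1 I1).
  by apply: (@ex_clear _ w' r2 I2).
move: sw sw'; rewrite !size_rev -!/(tsize _) tsize_N; lia.
Qed.

Lemma transforms_iter (cnt : I -> tree) (st : I -> nat -> tree) :
  transforms (fun p : I * nat => st p.1 p.2) (fun p => st p.1 p.2.+1) ->
  (exists k, forall i n, n <= tsize (cnt i) ->
     tsize (st i n) <= (tsize (cnt i) + tsize (st i 0) + 2) ^ k) ->
  transforms (fun i => N (cnt i) (st i 0)) (fun i => st i (tsize (cnt i))).
Proof.
move=> [c [k h]] [K bK].
pose s := tsize \o (fun i => N (cnt i) (st i 0)).
pose bd i := (s i + 2) ^ K.
apply: (@transforms_intro _ _ (Pop I0 ;; stash I1 ;;
    While (GNot (TopIs I1 (Some Send))) (Pop I1 ;; c) ;; Pop I1)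
  (fun i => 12 * s i + s i * ((bd i + 2) ^ k + 20) + 50)).
  have b1 : pbounded s bd by exists K.
  have b2 : pbounded bd (fun i => (bd i + 2) ^ k) by exists k.
  have b3 := pbounded_trans b1 b2; pbound.
move=> i r0 r1 r2 r3.
have loop (w : seq symbol) n : all digit w -> size w + n = tsize (cnt i) ->
    ex (While (GNot (TopIs I1 (Some Send))) (Pop I1 ;; c))
      (Stacks (tser (st i n) ++ r0) (w ++ Send :: r1) r2 r3)
      (size w * ((bd i + 2) ^ k + 20) + 1)
      (Stacks (tser (st i (size w + n)) ++ r0) (Send :: r1) r2 r3).
  elim: w n => [|a w IH] n /=; first by move=> _ _; exact: ex_while_false.
  move=> /andP[da dw] e; apply: ex_le.
    apply: ex_while_true; first by case/orP: da => /eqP ->.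
      apply: ex_seq; first exact: ex_pop.
      exact: (h (i, n)).
    by rewrite addSnnS in e *; exact: IH dw e.
  have l : (tsize (st i n) + 2) ^ k <= (bd i + 2) ^ k.
    case: (k) => [|k']; first by rewrite !expn0.
    rewrite leq_exp2r // leq_add2r; apply: leq_trans (bK _ _ _) _; first by lia.
    rewrite /bd /s /= tsize_N; case: (K) => [|K']; first by rewrite !expn0.
    by rewrite leq_exp2r //; lia.
  by rewrite /=; lia.
rewrite /= -catA; apply: ex_le.
  apply: ex_seq; first exact: ex_pop.
  apply: ex_seq; first exact: (@ex_stash I1 _ (cnt i)).
  apply: (@ex_seq _ _ _ (Stacks (tser (st i (tsize (cnt i))) ++ r0) (Send :: r1) r2 r3));
    last exact: ex_pop.
  apply: ex_eq; first by apply: loop; [rewrite all_rev tser_digit|rewrite size_rev addn0].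
  by rewrite size_rev addn0.
rewrite size_rev -/(tsize _) /s /= tsize_N.
have : tsize (cnt i) * ((bd i + 2) ^ k + 20) <= (tsize (cnt i) + tsize (st i 0)).+1 * ((bd i + 2) ^ k + 20).
  by rewrite leq_mul2r; apply/orP; right; lia.
by lia.
Qed.

End Transforms.

Lemma transforms_reindex (I J : Type) (u v : I -> tree) (u' v' : J -> tree) :
  transforms u' v' -> (forall i, exists j, u i = u' j /\ v i = v' j) -> transforms u v.
Proof.
move=> [c [k h]] e; exists c, k => i r0 r1 r2 r3.
by have [j [-> ->]] := e i; apply: h.
Qed.

(** * Polynomial-time functions *)

Structure encType : Type :=
  EncType { esort :> Type; enc : esort -> tree; enc_inj : injective enc }.
Arguments enc {e} _ : rename.
Arguments enc_inj {e} [x1 x2] _ : rename.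

Definition esize (A : encType) (a : A) : nat := tsize (enc a).
Arguments esize {A} a : simpl never.

Definition enc_eq (A : encType) (a b : A) : bool := tser (enc a) == tser (enc b).

Lemma enc_eqP (A : encType) (a b : A) : reflect (a = b) (enc_eq a b).
Proof. by apply: (iffP eqP) => [/tser_inj/enc_inj|->]. Qed.

Canonical tree_encType := @EncType tree id (fun _ _ e => e).

Lemma enc_unit_inj : injective (fun _ : unit => L).
Proof. by case=> -[]. Qed.
Canonical unit_encType := EncType enc_unit_inj.

Lemma tbool_inj : injective tbool.
Proof. by case=> -[]. Qed.
Canonical bool_encType := EncType tbool_inj.

Section EncProd.
Variables A B : encType.

Lemma enc_prod_inj : injective (fun p : A * B => N (enc p.1) (enc p.2)).
Proof. by move=> [a b] [a' b'] /= [/enc_inj -> /enc_inj ->]. Qed.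
Canonical prod_encType := EncType enc_prod_inj.

Fixpoint enc_seq (l : seq A) : tree :=
  if l is a :: l' then N (enc a) (enc_seq l') else L.

Lemma enc_seq_inj : injective enc_seq.
Proof. by elim=> [|a l IH] [|b l'] //= [/enc_inj -> /IH ->]. Qed.
Canonical seq_encType := EncType enc_seq_inj.

End EncProd.

Definition ptime (A B : encType) (f : A -> B) : Prop :=
  transforms (@enc A) (fun a => enc (f a)).

Section PtimeBasics.
Variables X A B : encType.

Lemma ptime_id : ptime (fun x : X => x).
Proof. exact: transforms_id. Qed.

Lemma ptime_comp (g : A -> B) (f : X -> A) :
  ptime g -> ptime f -> ptime (fun x => g (f x)).
Proof.
move=> pg pf; apply: transforms_trans pf _; apply: transforms_reindex pg _.
by move=> x; exists (f x).
Qed.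

Lemma ptime_const (a : A) : ptime (fun _ : X => a).
Proof. exact: transforms_const. Qed.

Lemma ptime_pair (f : X -> A) (g : X -> B) :
  ptime f -> ptime g -> ptime (fun x => (f x, g x)).
Proof. exact: transforms_pair. Qed.

Lemma ptime_fst : ptime (@fst A B).
Proof. exact: transforms_fst. Qed.

Lemma ptime_snd : ptime (@snd A B).
Proof. exact: transforms_snd. Qed.

Lemma ptime_cast (f : X -> A) (g : X -> B) :
  (forall x, enc (f x) = enc (g x)) -> ptime f -> ptime g.
Proof. by move=> e pf; apply: transforms_reindex pf _ => x; exists x. Qed.

Lemma ptime_ext (f g : X -> A) : f =1 g -> ptime f -> ptime g.
Proof. by move=> e pf; apply: transforms_reindex pf _ => x; exists x; rewrite e. Qed.

Lemma ptime_if (b : X -> bool) (f g : X -> A) :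
  ptime b -> ptime f -> ptime g -> ptime (fun x => if b x then f x else g x).
Proof.
move=> pb pf pg; apply: (transforms_branch pb).
  by apply: transforms_reindex pg _ => -[x /= e]; exists x; case: (b x) e.
by apply: transforms_reindex pf _ => -[x /= e]; exists x; case: (b x) e.
Qed.

Lemma ptime_esize (f : X -> A) : ptime f -> pbounded (@esize X) (fun x => esize (f x)).
Proof. exact: transforms_size. Qed.

End PtimeBasics.

Lemma ptime_comp2 (X A B C : encType)
    (g : A -> B -> C) (f1 : X -> A) (f2 : X -> B) :
  ptime (fun p => g p.1 p.2) -> ptime f1 -> ptime f2 -> ptime (fun x => g (f1 x) (f2 x)).
Proof. by move=> pg p1 p2; have := ptime_comp pg (ptime_pair p1 p2). Qed.

Lemma ptime_comp3 (X A B C D : encType)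
    (g : A -> B -> C -> D) (f1 : X -> A) (f2 : X -> B) (f3 : X -> C) :
  ptime (fun p => g p.1.1 p.1.2 p.2) -> ptime f1 -> ptime f2 -> ptime f3 ->
  ptime (fun x => g (f1 x) (f2 x) (f3 x)).
Proof.
by move=> pg p1 p2 p3; have := ptime_comp pg (ptime_pair (ptime_pair p1 p2) p3).
Qed.

Section PtimeList.
Variables X A B : encType.

Lemma ptime_eq : ptime (fun p : A * A => enc_eq p.1 p.2).
Proof.
apply: (@transforms_eq _ (fun p : A * A => enc p.1) (fun p => enc p.2) (fun p => enc_eq p.1 p.2)).
by move=> p; apply: (iffP (enc_eqP _ _)) => [->|/enc_inj].
Qed.

Lemma ptime_cons : ptime (fun p : A * seq A => p.1 :: p.2).
Proof. by apply: ptime_cast (ptime_id [the encType of (A * seq A)%type]) => -[]. Qed.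

Lemma ptime_seq_case (l : X -> seq A) (F : X -> A -> seq A -> B) (G : X -> B) :
  ptime l -> ptime (fun p => F p.1 p.2.1 p.2.2) -> ptime G ->
  ptime (fun x => if l x is a :: l' then F x a l' else G x).
Proof.
move=> pl pF pG; apply: (transforms_branch pl).
  by apply: transforms_reindex pG _ => -[x /= e]; exists x; case: (l x) e.
apply: (@transforms_trans _ _ (fun x => N (enc (sval x)) (enc (l (sval x))))).
  have := ptime_pair (ptime_id X) pl.
  by move=> h; apply: transforms_reindex h _ => -[x e]; exists x.
apply: transforms_reindex pF _ => -[x /=]; case: (l x) => [|a l'] // _.
by exists (x, (a, l')).
Qed.

Lemma esize_pair (a : A) (b : B) : esize (a, b) = (esize a + esize b).+1.
Proof. exact: tsize_N. Qed.

Lemma esize_nil : esize ([::] : seq A) = 1.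
Proof. by []. Qed.

Lemma esize_cons (a : A) (l : seq A) : esize (a :: l) = (esize a + esize l).+1.
Proof. exact: tsize_N. Qed.

Lemma esize_gt0 (a : A) : 0 < esize a.
Proof. exact: tsize_gt0. Qed.

Lemma size_esize (l : seq A) : size l < esize l.
Proof. by elim: l => //= a l IH; rewrite esize_cons; lia. Qed.

Lemma esize_cat (l l' : seq A) : esize (l ++ l') = (esize l + esize l').-1.
Proof.
elim: l => [|a l IH] //; rewrite cat_cons !esize_cons IH.
have := size_esize l; lia.
Qed.

Lemma esize_rev (l : seq A) : esize (rev l) = esize l.
Proof.
elim: l => // a l IH; rewrite rev_cons -cats1 esize_cat IH !esize_cons esize_nil.
by lia.
Qed.

Lemma esize_catrev (l l' : seq A) : esize (catrev l l') = (esize l + esize l').-1.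
Proof. by rewrite catrevE esize_cat esize_rev. Qed.

Lemma esize_take n (l : seq A) : esize (take n l) <= esize l.
Proof.
elim: n l => [|n IH] [|a l]; rewrite ?take0 ?take_cons //.
by rewrite !esize_cons ltnS leq_add2l.
Qed.

Lemma esize_drop n (l : seq A) : esize (drop n l) <= esize l.
Proof.
by elim: n l => [|n IH] [|a l] //=; rewrite esize_cons; have := IH l; lia.
Qed.

End PtimeList.

Lemma ptime_mkpair (A B : encType) : ptime (fun p : A * B => (p.1, p.2)).
Proof. by apply: ptime_ext (ptime_id [the encType of (A * B)%type]) => -[]. Qed.

Create HintDb ptime.
#[export] Hint Resolve ptime_mkpair ptime_fst ptime_snd ptime_cons ptime_eq : ptime.

Ltac pt_known := solve [ trivial with ptime nocore ].

Ltac pt := cbv beta; lazymatch goal with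
  | |- ptime (fun x => x) => apply ptime_id
  | |- ptime (fun _ => ?c) => apply ptime_const
  | |- ptime (fun x => match @?b x with true => @?f x | false => @?g x end) =>
      apply (@ptime_if _ _ b f g); pt
  | |- ptime _ =>
    tryif pt_known then idtac else
    tryif (match goal with
      | |- ptime (fun x => ?g (@?f1 x)) =>
          simple refine (ptime_comp (g := g) (f := f1) _ _); [ pt_known | ]
      | |- ptime (fun x => ?g (@?f1 x) (@?f2 x)) =>
          simple refine (ptime_comp2 (g := g) (f1 := f1) (f2 := f2) _ _ _); [ pt_known | | ]
      | |- ptime (fun x => ?g (@?f1 x) (@?f2 x) (@?f3 x)) =>
          simple refine (ptime_comp3 (g := g) (f1 := f1) (f2 := f2) (f3 := f3) _ _ _ _);
          [ pt_known | | | ]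
      end) then pt else idtac
  end.

Lemma ptime_iter (X A C : encType) (cnt : X -> C) (init : X -> A) (f : A -> A) :
  ptime cnt -> ptime init -> ptime f ->
  (exists k, forall x n, n <= esize (cnt x) ->
     esize (iter n f (init x)) <= (esize x + 2) ^ k) ->
  ptime (fun x => iter (esize (cnt x)) f (init x)).
Proof.
move=> pc pi pf [k bk].
(* The size bound must be read off the pair (counter, state), so the input is kept in the state. *)
pose st x n := N (enc x) (enc (iter n f (init x))).
refine (@transforms_trans X _ (fun x => N (enc (cnt x)) (st x 0)) _ _ _).
  apply: transforms_pair => //; apply: transforms_pair => //; exact: transforms_id.
refine (@transforms_trans X _ (fun x => st x (tsize (enc (cnt x)))) _ _ _); last first.
  exact: transforms_snd.
apply: transforms_iter.
  apply: transforms_pair; first exact: transforms_fst.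
  refine (@transforms_trans _ _ (fun p : X * nat => enc (iter p.2 f (init p.1))) _ _ _).
    exact: transforms_snd.
  by apply: transforms_reindex pf _ => -[x n]; exists (iter n f (init x)).
exists k.+2 => x n le; rewrite /st !tsize_N; have := bk x n le.
set s := esize x; rewrite -/(esize _) -/(esize _) -/s => l.
apply: (@leq_trans ((s + 2) ^ k.+2)); last by rewrite leq_exp2r //; lia.
rewrite !expnS; have : 0 < (s + 2) ^ k by rewrite expn_gt0 addnS.
move: ((s + 2) ^ k) l => y; rewrite /esize; nia.
Qed.

Lemma ptime_foldl (X A B : encType) (h : X -> B -> A -> B) (z : X -> B) (l : X -> seq A) :
  ptime (fun p : X * B * A => h p.1.1 p.1.2 p.2) -> ptime z -> ptime l ->
  (exists k, forall x n, esize (foldl (h x) (z x) (take n (l x))) <= (esize x + 2) ^ k) ->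
  ptime (fun x => foldl (h x) (z x) (l x)).
Proof.
move=> ph pz pl [k bk].
pose step (s : X * (B * seq A)) : X * (B * seq A) :=
  if s.2.2 is a :: l' then (s.1, (h s.1 s.2.1 a, l')) else s.
have pstep : ptime step.
  by apply (@ptime_seq_case _ _ _ (fun s : X * (B * seq A) => s.2.2)
    (fun s a l' => (s.1, (h s.1 s.2.1 a, l'))) id); pt;
    apply (ptime_comp3 (g := h)); pt.
have iterE x n : iter n step (x, (z x, l x)) =
    (x, (foldl (h x) (z x) (take n (l x)), drop n (l x))).
  elim: n => [|n IH]; first by rewrite take0 drop0.
  rewrite iterS IH /step /=; case: (ltnP n (size (l x))) => ln; last first.
    by rewrite !drop_oversize ?take_oversize //; lia.
  case e : (l x) ln => [//|a0 l0]; rewrite -e => ln.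
  by rewrite (drop_nth a0) // (take_nth a0) // -cats1 foldl_cat.
have H : ptime (fun x => iter (esize (l x)) step (x, (z x, l x))).
  apply: ptime_iter => //; first by apply: ptime_pair; [exact: ptime_id | exact: ptime_pair].
  have [m bm] := ptime_esize pl.
  have : pbounded (fun p : X * nat => esize p.1)
      (fun p => esize p.1 + (esize p.1 + 2) ^ k + (esize p.1 + 2) ^ m + 2).
    by pbound; [exists k | exists m].
  case=> K bK; exists K => x n _; rewrite iterE !esize_pair.
  apply: leq_trans (bK (x, n)) => /=.
  have b1 := bk x n; have b2 := esize_drop n (l x); have /= b3 := bm x; lia.
apply: (@ptime_ext _ _ (fun x => (iter (esize (l x)) step (x, (z x, l x))).2.1)); last first.
  by apply: ptime_comp; [pt | apply: ptime_comp; [pt | exact: H]].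
move=> x.
rewrite iterE /= take_oversize //; exact: ltnW (size_esize _).
Qed.

Lemma ptime_catrev (A : encType) : ptime (fun p : seq A * seq A => catrev p.1 p.2).
Proof.
apply: (@ptime_ext _ _ (fun p : seq A * seq A => foldl (fun acc a => a :: acc) p.2 p.1)).
  by move=> [l1 l2] /=; elim: l1 l2 => //= a l1 IH l2.
apply: (@ptime_foldl _ _ _ (fun _ acc a => a :: acc) snd fst); try by pt.
exists 1 => -[l1 l2] n; rewrite esize_pair /=.
rewrite (_ : foldl _ _ _ = catrev (take n l1) l2); last first.
  by elim: (take n l1) l2 => //= a l IH l2.
by rewrite esize_catrev; have := esize_take n l1; lia.
Qed.
#[export] Hint Resolve ptime_catrev : ptime.

Lemma ptime_rev (A : encType) : ptime (@rev A).
Proof. by rewrite /rev; pt. Qed.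
#[export] Hint Resolve ptime_rev : ptime.

Lemma ptime_cat (A : encType) : ptime (fun p : seq A * seq A => p.1 ++ p.2).
Proof.
apply: (@ptime_ext _ _ (fun p : seq A * seq A => catrev (rev p.1) p.2)); last by pt.
by move=> [l l'] /=; rewrite catrevE revK.
Qed.
#[export] Hint Resolve ptime_cat : ptime.

Definition flatmap (A B : Type) (f : A -> seq B) (l : seq A) : seq B := flatten (map f l).

Lemma flatmap_cat (A B : Type) (f : A -> seq B) l l' :
  flatmap f (l ++ l') = flatmap f l ++ flatmap f l'.
Proof. by rewrite /flatmap map_cat flatten_cat. Qed.

Lemma ptime_flatmap (X A B : encType) (f : X -> A -> seq B) l :
  ptime (fun p : X * A => f p.1 p.2) -> ptime l -> ptime (fun x => flatmap (f x) (l x)).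
Proof.
move=> pf pl.
pose h x acc a := catrev (f x a) acc.
have hE x l' acc : foldl (h x) acc l' = catrev (flatmap (f x) l') acc.
  elim: l' acc => //= a l' IH acc; rewrite IH /h /flatmap /= !catrevE rev_cat.
  by rewrite catA.
apply: (@ptime_ext _ _ (fun x => rev (foldl (h x) [::] (l x)))).
  by move=> x; rewrite hE catrevE cats0 revK.
apply: ptime_comp; first by pt.
apply: ptime_foldl => //.
- by rewrite /h; pt; apply: (ptime_comp2 (g := f)); pt.
- by pt.
have [k bk] := ptime_esize pf; have bl := ptime_esize pl.
pose m x := (esize x + esize (l x) + 1 + 2) ^ k.
have : pbounded (@esize X) (fun x => esize (l x) * m x + 1).
  have b1 : pbounded (@esize X) (fun x => esize x + esize (l x) + 1) by pbound.
  have b2 : pbounded (fun x => esize x + esize (l x) + 1) m by exists k.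
  by have b3 := pbounded_trans b1 b2; pbound.
case=> K bK; exists K => x n; apply: leq_trans (bK x).
rewrite hE esize_catrev esize_nil addn1.
have bt : esize (take n (l x)) <= esize (l x) by apply: esize_take.
have b : esize (flatmap (f x) (take n (l x))) <= size (take n (l x)) * m x + 1.
  elim: (take n (l x)) bt => // a l' IH; rewrite esize_cons => bt.
  rewrite -[a :: l']cat1s flatmap_cat {1}/flatmap /= cats0 esize_cat mulSn.
  have ba : esize (f x a) <= m x.
    apply: leq_trans (bk (x, a)) _; rewrite esize_pair /m.
    by case: (k) => [|k']; rewrite ?expn0 // leq_exp2r //; lia.
  by have := IH _; lia.
have := size_esize (take n (l x)) => s1.
have : size (take n (l x)) * m x <= esize (l x) * m x.
  by rewrite leq_mul2r; apply/orP; right; lia.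
by lia.
Qed.
Section PtimeSeq.
Variables X A B : encType.

Lemma ptime_map (f : X -> A -> B) l : ptime (fun p : X * A => f p.1 p.2) -> ptime l ->
  ptime (fun x => map (f x) (l x)).
Proof.
move=> pf pl; apply: (@ptime_ext _ _ (fun x => flatmap (fun a => [:: f x a]) (l x))).
  by move=> x; rewrite /flatmap flatten_map1.
by apply: ptime_flatmap => //; pt.
Qed.

Lemma ptime_filter (p : X -> A -> bool) l : ptime (fun q : X * A => p q.1 q.2) -> ptime l ->
  ptime (fun x => filter (p x) (l x)).
Proof.
move=> pp pl; apply: (@ptime_ext _ _ (fun x => flatmap (fun a => if p x a then [:: a] else [::]) (l x))).
  by move=> x; rewrite /flatmap; elim: (l x) => //= a l' ->; case: (p x a).
by apply: ptime_flatmap => //; pt.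
Qed.

Lemma ptime_nilp : ptime (fun l : seq A => nilp l).
Proof.
apply: (@ptime_ext _ _ (fun l : seq A => if l is _ :: _ then false else true)).
  by case.
by apply: (@ptime_seq_case _ _ _ id (fun _ _ _ => false) (fun=> true)); pt.
Qed.

Lemma ptime_head (a : A) : ptime (head a).
Proof.
apply: (@ptime_ext _ _ (fun l : seq A => if l is b :: _ then b else a)); first by case.
by apply: (@ptime_seq_case _ _ _ id (fun _ b _ => b) (fun=> a)); pt.
Qed.

Lemma ptime_behead : ptime (@behead A).
Proof.
apply: (@ptime_ext _ _ (fun l : seq A => if l is _ :: l' then l' else [::])); first by case.
by apply: (@ptime_seq_case _ _ _ id (fun _ _ l' => l') (fun=> [::])); pt.
Qed.

End PtimeSeq.
#[export] Hint Resolve ptime_nilp ptime_head ptime_behead : ptime.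

Lemma ptime_negb : ptime negb.
Proof. by rewrite /negb; pt. Qed.
Lemma ptime_andb : ptime (fun p : bool * bool => p.1 && p.2).
Proof. by rewrite /andb; pt. Qed.
Lemma ptime_orb : ptime (fun p : bool * bool => p.1 || p.2).
Proof. by rewrite /orb; pt. Qed.
#[export] Hint Resolve ptime_negb ptime_andb ptime_orb : ptime.

Section PtimeQuantifiers.
Variables X A : encType.

Lemma ptime_has (p : X -> A -> bool) l : ptime (fun q : X * A => p q.1 q.2) -> ptime l ->
  ptime (fun x => has (p x) (l x)).
Proof.
move=> pp pl; apply: (@ptime_ext _ _ (fun x => ~~ nilp (filter (p x) (l x)))).
  by move=> x; elim: (l x) => //= a l' <-; case: (p x a).
by pt; apply: ptime_filter.
Qed.

Lemma ptime_all (p : X -> A -> bool) l : ptime (fun q : X * A => p q.1 q.2) -> ptime l ->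
  ptime (fun x => all (p x) (l x)).
Proof.
move=> pp pl; apply: (@ptime_ext _ _ (fun x => ~~ has (fun a => ~~ p x a) (l x))).
  by move=> x; cbv beta; rewrite -all_predC; apply: eq_all => a /=; rewrite negbK.
by pt; apply: ptime_has => //; pt.
Qed.

End PtimeQuantifiers.

Ltac pt ::= cbv beta; lazymatch goal with
  | |- ptime (fun x => x) => apply ptime_id
  | |- ptime (fun _ => ?c) => apply ptime_const
  | |- ptime (fun x => match @?b x with true => @?f x | false => @?g x end) =>
      apply (@ptime_if _ _ b f g); pt
  | |- ptime (fun x => flatmap (@?f x) (@?l x)) => apply: (@ptime_flatmap _ _ _ f l); pt
  | |- ptime (fun x => map (@?f x) (@?l x)) => apply: (@ptime_map _ _ _ f l); pt
  | |- ptime (fun x => filter (@?f x) (@?l x)) => apply: (@ptime_filter _ _ f l); pt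
  | |- ptime (fun x => has (@?f x) (@?l x)) => apply: (@ptime_has _ _ f l); pt
  | |- ptime (fun x => all (@?f x) (@?l x)) => apply: (@ptime_all _ _ f l); pt
  | |- ptime _ =>
    tryif pt_known then idtac else
    tryif (match goal with
      | |- ptime (fun x => ?g (@?f1 x)) =>
          simple refine (ptime_comp (g := g) (f := f1) _ _); [ pt_known | ]
      | |- ptime (fun x => ?g (@?f1 x) (@?f2 x)) =>
          simple refine (ptime_comp2 (g := g) (f1 := f1) (f2 := f2) _ _ _); [ pt_known | | ]
      | |- ptime (fun x => ?g (@?f1 x) (@?f2 x) (@?f3 x)) =>
          simple refine (ptime_comp3 (g := g) (f1 := f1) (f2 := f2) (f3 := f3) _ _ _ _);
          [ pt_known | | | ]
      end) then pt else idtac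
  end.

Definition memb (A : encType) (a : A) (l : seq A) : bool := has (enc_eq a) l.

Lemma membP (A : eqType) (e : A -> tree) (ei : injective e) (a : A) (l : seq A) :
  @memb (EncType ei) a l = (a \in l).
Proof.
by rewrite /memb; elim: l => //= b l ->; rewrite inE; congr orb; apply/enc_eqP/eqP.
Qed.

Lemma ptime_memb (A : encType) : ptime (fun p : A * seq A => memb p.1 p.2).
Proof. by rewrite /memb; pt. Qed.
#[export] Hint Resolve ptime_memb : ptime.

Lemma ptime_iter_flatmap (A : encType) (g : A -> seq A) (w : A -> nat) :
  ptime g -> (forall a, sumn (map w (g a)) <= w a) -> (forall a, esize a <= w a) ->
  pbounded (@esize A) w -> ptime (fun l => iter (esize l) (flatmap g) l).
Proof.
move=> pg dec le [k bk].
have pf : ptime (fun l : seq A => flatmap g l) by pt.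
apply: ptime_iter pf _; [by pt | by pt |].
have : pbounded (@esize (seq_encType A)) (fun l => 2 * (esize l * (esize l + 2) ^ k) + 1).
  have b : pbounded (@esize (seq_encType A)) (fun l => (esize l + 2) ^ k) by exists k.
  by pbound.
case=> K bK; exists K => l n _; apply: leq_trans (bK l).
have e (l' : seq A) : esize l' <= 2 * sumn (map w l') + 1.
  elim: l' => //= a l' IH'; rewrite esize_cons.
  by have := le a; have := esize_gt0 a; lia.
have d (l' : seq A) : sumn (map w (flatmap g l')) <= sumn (map w l').
  elim: l' => //= a l' IH'.
  by rewrite -[a :: l']cat1s flatmap_cat {1}/flatmap /= cats0 map_cat sumn_cat leq_add.
have bd : esize (iter n (flatmap g) l) <= 2 * sumn (map w l) + 1.
  apply: leq_trans (e _) _; rewrite leq_add2r leq_mul2l /=.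
  by elim: n => //= n; apply: leq_trans (d _).
apply: leq_trans bd _; rewrite leq_add2r leq_mul2l /=.
suff : sumn (map w l) <= size l * (esize l + 2) ^ k.
  move=> h; apply: leq_trans h _; rewrite leq_mul2r.
  by apply/orP; right; apply: ltnW (size_esize _).
have : forall l', esize l' <= esize l -> sumn (map w l') <= size l' * (esize l + 2) ^ k.
  elim=> //= a l' IH; rewrite esize_cons => h; rewrite mulSn leq_add ?IH //; last by lia.
  apply: leq_trans (bk a) _; case: (k) => [|k']; rewrite ?expn0 // leq_exp2r //; lia.
exact.
Qed.

(** * Encoding of ontologies *)

Fixpoint unary (n : nat) : tree := if n is m.+1 then N L (unary m) else L.

Lemma unary_inj : injective unary.
Proof. by elim=> [|n IH] [|m] //= [/IH ->]. Qed.

Definition tagged (n : nat) (t : tree) : tree := N (unary n) t.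

Section Constructors.
Variables A P : encType.

Lemma ptime_constr (k : P -> A) n : (forall p, enc (k p) = tagged n (enc p)) -> ptime k.
Proof.
move=> e; apply: (@ptime_cast _ (prod_encType tree_encType P) _ (fun p => (unary n, p))).
  by move=> p; rewrite e.
by pt.
Qed.

Lemma ptime_destr (d : A -> seq P) n :
  (forall a, exists m t, enc a = tagged m t /\
     if m == n then exists2 p, t = enc p & d a = [:: p] else d a = [::]) ->
  ptime d.
Proof.
move=> h; apply: (@transforms_branch _ _ _ (fun a => tbool (~~ nilp (d a)))).
- apply: (@transforms_trans _ _ (fun a => if enc a is N t _ then t else L)).
    apply: (transforms_reindex (@transforms_fst (tree * tree) fst snd)) => a.
    by have [m [t [-> _]]] := h a; exists (unary m, t).
  apply: (transforms_reindex (ptime_comp2 (@ptime_eq tree_encType)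
     (ptime_id _) (ptime_const _ (unary n)))) => a.
  have [m [t [-> e]]] := h a; exists (unary m); split=> //=; congr tbool.
  apply/idP/enc_eqP => /=; case: eqP e => [-> [p _ ->] //|ne ->] //.
  by move/unary_inj.
- apply: (transforms_reindex (@ptime_const A (seq_encType P) [::])).
  by move=> [a /=]; case: (d a) => // _; exists a.
- apply: (@transforms_trans _ _ (fun i => head L (map enc (d (sval i))))).
    apply: (transforms_reindex (@transforms_snd (tree * tree) fst snd)) => -[a /= ne].
    have [m [t [-> e]]] := h a; exists (unary m, t); split=> //=.
    by case: eqP e => _ => [[p -> ->]|e] //; rewrite e in ne.
  apply: (transforms_reindex (_ : ptime (fun p : P => [:: p]))); first by pt.
  move=> [a /= ne]; have [m [t [_ e]]] := h a.
  by case: eqP e => _ => [[p _ ->]|e]; [exists p | rewrite e in ne].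
Qed.

End Constructors.

Definition enc_symbol (a : symbol) : tree := unary (symbol_code a).
Lemma enc_symbol_inj : injective enc_symbol.
Proof. by move=> a b /unary_inj /(can_inj symbol_codeK). Qed.
Canonical symbol_encType := EncType enc_symbol_inj.

Fixpoint enc_concept (C : concept) : tree :=
  match C with
  | CTop => tagged 0 L
  | CBot => tagged 1 L
  | CName A => tagged 2 (enc A)
  | CNot A => tagged 3 (enc A)
  | CAnd C D => tagged 4 (N (enc_concept C) (enc_concept D))
  | COr C D => tagged 5 (N (enc_concept C) (enc_concept D))
  | CEx R C => tagged 6 (N (enc R) (enc_concept C))
  | CAll R C => tagged 7 (N (enc R) (enc_concept C))
  end.
Lemma enc_concept_inj : injective enc_concept.
Proof.
elim=> [||A|A|C IHC D IHD|C IHC D IHD|R C IHC|R C IHC]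
  [||A'|A'|C' D'|C' D'|R' C'|R' C'] //=;
  by [case=> /(@enc_seq_inj bool_encType) -> | case=> /IHC -> /IHD -> |
      case=> /(@enc_seq_inj bool_encType) -> /IHC ->].
Qed.
Canonical concept_encType := EncType enc_concept_inj.

Definition enc_robj (r : robj) : tree :=
  match r with
  | RName R => tagged 0 (enc R)
  | RPair a b => tagged 1 (enc (a, b))
  | RTop => tagged 2 L
  | RBot => tagged 3 L
  | RComp R => tagged 4 (enc R)
  | RFresh R C => tagged 5 (enc (R, C))
  end.
Lemma enc_robj_inj : injective enc_robj.
Proof.
by move=> [R|a b|||R|R C] [R'|a' b'|||R'|R' C'] //=;
  [move=> [/(@enc_seq_inj bool_encType) ->]
  |move=> [/(@enc_seq_inj bool_encType) -> /(@enc_seq_inj bool_encType) ->]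
  |move=> [/(@enc_seq_inj bool_encType) ->]
  |move=> [/(@enc_seq_inj bool_encType) -> /enc_concept_inj ->]].
Qed.
Canonical robj_encType := EncType enc_robj_inj.

Definition enc_cobj (X : cobj) : tree :=
  match X with
  | OConcept C => tagged 0 (enc C)
  | OInd a => tagged 1 (enc a)
  | OPiL r => tagged 2 (enc r)
  | OPiR r => tagged 3 (enc r)
  end.
Lemma enc_cobj_inj : injective enc_cobj.
Proof.
by move=> [C|a|r|r] [C'|a'|r'|r'] //=;
  [move=> [/enc_concept_inj ->] | move=> [/(@enc_seq_inj bool_encType) ->]
  | move=> [/enc_robj_inj ->] | move=> [/enc_robj_inj ->]].
Qed.
Canonical cobj_encType := EncType enc_cobj_inj.

Definition enc_fact (f : fact) : tree :=
  match f with
  | HasC X => tagged 0 (enc X)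
  | HasR r => tagged 1 (enc r)
  | ArrC X Y => tagged 2 (enc (X, Y))
  | ArrR r q => tagged 3 (enc (r, q))
  end.
Lemma enc_fact_inj : injective enc_fact.
Proof.
by move=> [X|r|X Y|r q] [X'|r'|X' Y'|r' q'] //=;
  [move=> [/enc_cobj_inj ->] | move=> [/enc_robj_inj ->]
  | move=> [/enc_cobj_inj -> /enc_cobj_inj ->] | move=> [/enc_robj_inj -> /enc_robj_inj ->]].
Qed.
Canonical fact_encType := EncType enc_fact_inj.

Definition enc_axiom (ax : axiom) : tree :=
  match ax with
  | GCI C D => tagged 0 (enc (C, D))
  | RoleIncl R R1 => tagged 1 (enc (R, R1))
  | Transitivity R => tagged 2 (enc R)
  | ConceptAssert a C => tagged 3 (enc (a, C))
  | RoleAssert a b R => tagged 4 (enc (a, b, R))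
  end.
Lemma enc_axiom_inj : injective enc_axiom.
Proof.
by move=> [C D|R R1|R|a C|a b R] [C' D'|R' S'|R'|a' C'|a' b' R'] //=;
  [ move=> [/enc_concept_inj -> /enc_concept_inj ->]
  | move=> [/(@enc_seq_inj bool_encType) -> /(@enc_seq_inj bool_encType) ->]
  | move=> [/(@enc_seq_inj bool_encType) ->]
  | move=> [/(@enc_seq_inj bool_encType) -> /enc_concept_inj ->]
  | move=> [/(@enc_seq_inj bool_encType) -> /(@enc_seq_inj bool_encType) ->
      /(@enc_seq_inj bool_encType) ->]].
Qed.
Canonical axiom_encType := EncType enc_axiom_inj.

Section EncSum.
Variables A B : encType.
Definition enc_sum (x : A + B) : tree :=
  match x with inl a => tagged 0 (enc a) | inr b => tagged 1 (enc b) end.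
Lemma enc_sum_inj : injective enc_sum.
Proof. by move=> [a|b] [a'|b'] //= [/enc_inj ->]. Qed.
Canonical sum_encType := EncType enc_sum_inj.

Lemma ptime_inl : ptime (@inl A B).
Proof. exact: (@ptime_constr _ _ _ 0). Qed.
Lemma ptime_inr : ptime (@inr A B).
Proof. exact: (@ptime_constr _ _ _ 1). Qed.
Definition as_inl (x : A + B) : seq A := if x is inl a then [:: a] else [::].
Definition as_inr (x : A + B) : seq B := if x is inr b then [:: b] else [::].
Lemma ptime_as_inl : ptime as_inl.
Proof.
apply: (@ptime_destr _ _ _ 0); case=> [a|b];
  by [exists 0, (enc a); split=> //; exists a | exists 1, (enc b)].
Qed.
Lemma ptime_as_inr : ptime as_inr.
Proof.
apply: (@ptime_destr _ _ _ 1); case=> [a|b];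
  by [exists 0, (enc a) | exists 1, (enc b); split=> //; exists b].
Qed.
End EncSum.
#[export] Hint Resolve ptime_inl ptime_inr ptime_as_inl ptime_as_inr : ptime.

Ltac destr n := apply: (@ptime_destr _ _ _ n);
  case=> *; do 2 eexists; (split; first reflexivity); rewrite //=; (eexists; last reflexivity); reflexivity.

Lemma ptime_CName : ptime CName.
Proof. exact: (@ptime_constr _ _ _ 2). Qed.
Lemma ptime_CNot : ptime CNot.
Proof. exact: (@ptime_constr _ _ _ 3). Qed.
Lemma ptime_CAnd : ptime (fun p => CAnd p.1 p.2).
Proof. exact: (@ptime_constr _ _ _ 4). Qed.
Lemma ptime_COr : ptime (fun p => COr p.1 p.2).
Proof. exact: (@ptime_constr _ _ _ 5). Qed.
Lemma ptime_CEx : ptime (fun p => CEx p.1 p.2).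
Proof. exact: (@ptime_constr _ _ _ 6). Qed.
Lemma ptime_CAll : ptime (fun p => CAll p.1 p.2).
Proof. exact: (@ptime_constr _ _ _ 7). Qed.
Lemma ptime_RName : ptime RName.
Proof. exact: (@ptime_constr _ _ _ 0). Qed.
Lemma ptime_RPair : ptime (fun p => RPair p.1 p.2).
Proof. exact: (@ptime_constr _ _ _ 1). Qed.
Lemma ptime_RComp : ptime RComp.
Proof. exact: (@ptime_constr _ _ _ 4). Qed.
Lemma ptime_RFresh : ptime (fun p => RFresh p.1 p.2).
Proof. exact: (@ptime_constr _ _ _ 5). Qed.
Lemma ptime_OConcept : ptime OConcept.
Proof. exact: (@ptime_constr _ _ _ 0). Qed.
Lemma ptime_OInd : ptime OInd.
Proof. exact: (@ptime_constr _ _ _ 1). Qed.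
Lemma ptime_OPiL : ptime OPiL.
Proof. exact: (@ptime_constr _ _ _ 2). Qed.
Lemma ptime_OPiR : ptime OPiR.
Proof. exact: (@ptime_constr _ _ _ 3). Qed.
Lemma ptime_HasC : ptime HasC.
Proof. exact: (@ptime_constr _ _ _ 0). Qed.
Lemma ptime_HasR : ptime HasR.
Proof. exact: (@ptime_constr _ _ _ 1). Qed.
Lemma ptime_ArrC : ptime (fun p => ArrC p.1 p.2).
Proof. exact: (@ptime_constr _ _ _ 2). Qed.
Lemma ptime_ArrR : ptime (fun p => ArrR p.1 p.2).
Proof. exact: (@ptime_constr _ _ _ 3). Qed.
Lemma ptime_GCI : ptime (fun p => GCI p.1 p.2).
Proof. exact: (@ptime_constr _ _ _ 0). Qed.
Lemma ptime_RoleIncl : ptime (fun p => RoleIncl p.1 p.2).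
Proof. exact: (@ptime_constr _ _ _ 1). Qed.
Lemma ptime_Transitivity : ptime Transitivity.
Proof. exact: (@ptime_constr _ _ _ 2). Qed.
Lemma ptime_ConceptAssert : ptime (fun p => ConceptAssert p.1 p.2).
Proof. exact: (@ptime_constr _ _ _ 3). Qed.
Lemma ptime_RoleAssert : ptime (fun p => RoleAssert p.1.1 p.1.2 p.2).
Proof. exact: (@ptime_constr _ _ _ 4). Qed.
#[export] Hint Resolve ptime_CName ptime_CNot ptime_CAnd ptime_COr ptime_CEx ptime_CAll
  ptime_RName ptime_RPair ptime_RComp ptime_RFresh ptime_OConcept ptime_OInd ptime_OPiL
  ptime_OPiR ptime_HasC ptime_HasR ptime_ArrC ptime_ArrR ptime_GCI ptime_RoleIncl
  ptime_Transitivity ptime_ConceptAssert ptime_RoleAssert : ptime.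

Definition as_top C := if C is CTop then [:: tt] else [::].
Definition as_bot C := if C is CBot then [:: tt] else [::].
Definition as_name C := if C is CName A then [:: A] else [::].
Definition as_not C := if C is CNot A then [:: A] else [::].
Definition as_and C := if C is CAnd C1 C2 then [:: (C1, C2)] else [::].
Definition as_or C := if C is COr C1 C2 then [:: (C1, C2)] else [::].
Definition as_ex C := if C is CEx R C1 then [:: (R, C1)] else [::].
Definition as_all C := if C is CAll R C1 then [:: (R, C1)] else [::].
Definition as_rname r := if r is RName R then [:: R] else [::].
Definition as_rpair r := if r is RPair a b then [:: (a, b)] else [::].
Definition as_rtop r := if r is RTop then [:: tt] else [::].
Definition as_rbot r := if r is RBot then [:: tt] else [::].
Definition as_rcomp r := if r is RComp R then [:: R] else [::].
Definition as_rfresh r := if r is RFresh R C then [:: (R, C)] else [::].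
Definition as_concept X := if X is OConcept C then [:: C] else [::].
Definition as_ind X := if X is OInd a then [:: a] else [::].
Definition as_pil X := if X is OPiL r then [:: r] else [::].
Definition as_pir X := if X is OPiR r then [:: r] else [::].
Definition as_hasc f := if f is HasC X then [:: X] else [::].
Definition as_hasr f := if f is HasR r then [:: r] else [::].
Definition as_arrc f := if f is ArrC X Y then [:: (X, Y)] else [::].
Definition as_arrr f := if f is ArrR r q then [:: (r, q)] else [::].
Definition as_gci ax := if ax is GCI C D then [:: (C, D)] else [::].
Definition as_incl ax := if ax is RoleIncl R R1 then [:: (R, R1)] else [::].
Definition as_trans ax := if ax is Transitivity R then [:: R] else [::].
Definition as_cassert ax := if ax is ConceptAssert a C then [:: (a, C)] else [::].
Definition as_rassert ax := if ax is RoleAssert a b R then [:: (a, b, R)] else [::].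

Lemma ptime_as_top : ptime as_top. Proof. by destr 0. Qed.
Lemma ptime_as_bot : ptime as_bot. Proof. by destr 1. Qed.
Lemma ptime_as_name : ptime as_name. Proof. by destr 2. Qed.
Lemma ptime_as_not : ptime as_not. Proof. by destr 3. Qed.
Lemma ptime_as_and : ptime as_and. Proof. by destr 4. Qed.
Lemma ptime_as_or : ptime as_or. Proof. by destr 5. Qed.
Lemma ptime_as_ex : ptime as_ex. Proof. by destr 6. Qed.
Lemma ptime_as_all : ptime as_all. Proof. by destr 7. Qed.
Lemma ptime_as_rname : ptime as_rname. Proof. by destr 0. Qed.
Lemma ptime_as_rpair : ptime as_rpair. Proof. by destr 1. Qed.
Lemma ptime_as_rtop : ptime as_rtop. Proof. by destr 2. Qed.
Lemma ptime_as_rbot : ptime as_rbot. Proof. by destr 3. Qed.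
Lemma ptime_as_rcomp : ptime as_rcomp. Proof. by destr 4. Qed.
Lemma ptime_as_rfresh : ptime as_rfresh. Proof. by destr 5. Qed.
Lemma ptime_as_concept : ptime as_concept. Proof. by destr 0. Qed.
Lemma ptime_as_ind : ptime as_ind. Proof. by destr 1. Qed.
Lemma ptime_as_pil : ptime as_pil. Proof. by destr 2. Qed.
Lemma ptime_as_pir : ptime as_pir. Proof. by destr 3. Qed.
Lemma ptime_as_hasc : ptime as_hasc. Proof. by destr 0. Qed.
Lemma ptime_as_hasr : ptime as_hasr. Proof. by destr 1. Qed.
Lemma ptime_as_arrc : ptime as_arrc. Proof. by destr 2. Qed.
Lemma ptime_as_arrr : ptime as_arrr. Proof. by destr 3. Qed.
Lemma ptime_as_gci : ptime as_gci. Proof. by destr 0. Qed.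
Lemma ptime_as_incl : ptime as_incl. Proof. by destr 1. Qed.
Lemma ptime_as_trans : ptime as_trans. Proof. by destr 2. Qed.
Lemma ptime_as_cassert : ptime as_cassert. Proof. by destr 3. Qed.
Lemma ptime_as_rassert : ptime as_rassert. Proof. by destr 4. Qed.
#[export] Hint Resolve ptime_as_top ptime_as_bot ptime_as_name ptime_as_not ptime_as_and
  ptime_as_or ptime_as_ex ptime_as_all ptime_as_rname ptime_as_rpair ptime_as_rtop
  ptime_as_rbot ptime_as_rcomp ptime_as_rfresh ptime_as_concept ptime_as_ind ptime_as_pil
  ptime_as_pir ptime_as_hasc ptime_as_hasr ptime_as_arrc ptime_as_arrr ptime_as_gci
  ptime_as_incl ptime_as_trans ptime_as_cassert ptime_as_rassert : ptime.

(** * Serialization in polynomial time *)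

Lemma flatmap_id (A B : Type) (f : A -> seq B) a : flatmap f [:: a] = f a.
Proof. by rewrite /flatmap /= cats0. Qed.

Lemma flatmap_cons (A B : Type) (f : A -> seq B) a l : flatmap f (a :: l) = f a ++ flatmap f l.
Proof. by []. Qed.

Lemma iter_flatmap_cat (A : Type) (g : A -> seq A) n l l' :
  iter n (flatmap g) (l ++ l') = iter n (flatmap g) l ++ iter n (flatmap g) l'.
Proof. by elim: n => //= n ->; rewrite flatmap_cat. Qed.

Lemma iter_flatmap_fixed (A : Type) (g : A -> seq A) n l :
  flatmap g l = l -> iter n (flatmap g) l = l.
Proof. by move=> e; elim: n => //= n ->. Qed.

Definition bit_symbol (b : bool) : symbol := if b then Sbit true else Sbit false.
Definition name_symbols (a : name) : seq symbol := map bit_symbol a ++ [:: Send].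

Lemma name_symbolsE a : name_symbols a = ser_name a.
Proof.
rewrite /ser_name -cats1 /name_symbols; congr cat.
by apply: eq_map => -[].
Qed.

Lemma ptime_bit_symbol : ptime bit_symbol.
Proof. by rewrite /bit_symbol; pt. Qed.
#[export] Hint Resolve ptime_bit_symbol : ptime.

Lemma ptime_ser_name : ptime ser_name.
Proof.
by apply: (@ptime_ext _ _ name_symbols _ name_symbolsE); rewrite /name_symbols; pt.
Qed.
#[export] Hint Resolve ptime_ser_name : ptime.

Local Notation done := (map (@inl symbol concept)).
Local Notation todo := (@inr symbol concept).

Definition ser_expand (x : symbol + concept) : seq (symbol + concept) :=
  map inl (as_inl x) ++
  flatmap (fun C : concept =>
    map (fun=> inl Stop) (as_top C) ++ map (fun=> inl Sbot) (as_bot C) ++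
    flatmap (fun A : name => inl Sname :: done (ser_name A)) (as_name C) ++
    flatmap (fun A : name => inl Snot :: done (ser_name A)) (as_not C) ++
    flatmap (fun p : concept * concept => [:: inl Sand; todo p.1; todo p.2]) (as_and C) ++
    flatmap (fun p : concept * concept => [:: inl Sor; todo p.1; todo p.2]) (as_or C) ++
    flatmap (fun p : name * concept => inl Sex :: done (ser_name p.1) ++ [:: todo p.2]) (as_ex C) ++
    flatmap (fun p : name * concept => inl Sall :: done (ser_name p.1) ++ [:: todo p.2]) (as_all C))
  (as_inr x).

Lemma ptime_ser_expand : ptime ser_expand.
Proof. by rewrite /ser_expand; pt. Qed.
#[export] Hint Resolve ptime_ser_expand : ptime.

Definition ser_weight (x : symbol + concept) : nat :=
  if x is inr C then 100 * esize C else 100.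

Lemma tsize_unary n : tsize (unary n) = 2 * n + 1.
Proof. by elim: n => // n IH; rewrite [unary _]/= tsize_N IH (_ : tsize L = 1) //; lia. Qed.

Lemma esize_symbol (a : symbol) : esize a <= 63.
Proof. by rewrite /esize [enc a]/= tsize_unary; case: a => // -[]. Qed.

Lemma size_ser_name (a : name) : size (ser_name a) <= esize a.
Proof. by rewrite size_rcons size_map size_esize. Qed.

Lemma tsize_tagged n t : tsize (tagged n t) = 2 * n + 2 + tsize t.
Proof. by rewrite tsize_N tsize_unary; lia. Qed.

Lemma esize_CAnd C D : esize (CAnd C D) = esize C + esize D + 11.
Proof. by rewrite -[LHS]/(tsize (tagged 4 (N (enc C) (enc D)))) tsize_tagged tsize_N /esize; lia. Qed.
Lemma esize_COr C D : esize (COr C D) = esize C + esize D + 13.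
Proof. by rewrite -[LHS]/(tsize (tagged 5 (N (enc C) (enc D)))) tsize_tagged tsize_N /esize; lia. Qed.
Lemma esize_CEx (R : name) C : esize (CEx R C) = esize R + esize C + 15.
Proof. by rewrite -[LHS]/(tsize (tagged 6 (N (enc R) (enc C)))) tsize_tagged tsize_N /esize; lia. Qed.
Lemma esize_CAll (R : name) C : esize (CAll R C) = esize R + esize C + 17.
Proof. by rewrite -[LHS]/(tsize (tagged 7 (N (enc R) (enc C)))) tsize_tagged tsize_N /esize; lia. Qed.
Lemma esize_CName (A : name) : esize (CName A) = esize A + 6.
Proof. by rewrite -[LHS]/(tsize (tagged 2 (enc A))) tsize_tagged /esize; lia. Qed.
Lemma esize_CNot (A : name) : esize (CNot A) = esize A + 8.
Proof. by rewrite -[LHS]/(tsize (tagged 3 (enc A))) tsize_tagged /esize; lia. Qed.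

Lemma esize_inl (A B : encType) (a : A) : esize (inl a : A + B) = esize a + 2.
Proof. by rewrite -[LHS]/(tsize (tagged 0 (enc a))) tsize_tagged /esize; lia. Qed.
Lemma esize_inr (A B : encType) (b : B) : esize (inr b : A + B) = esize b + 4.
Proof. by rewrite -[LHS]/(tsize (tagged 1 (enc b))) tsize_tagged /esize; lia. Qed.

Lemma ser_weight_done w : sumn (map ser_weight (done w)) = 100 * size w.
Proof. by elim: w => //= a w ->; lia. Qed.

Lemma ser_expand_weight x : sumn (map ser_weight (ser_expand x)) <= ser_weight x.
Proof.
case: x => [a|C] //; rewrite /ser_expand flatmap_id.
case: C => [||A|A|C D|C D|R C|R C] /=; rewrite ?cats0 //=.
- by rewrite ser_weight_done esize_CName; have := size_ser_name A; lia.
- by rewrite ser_weight_done esize_CNot; have := size_ser_name A; lia.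
- by rewrite esize_CAnd; lia.
- by rewrite esize_COr; lia.
- by rewrite map_cat sumn_cat ser_weight_done esize_CEx /=; have := size_ser_name R; lia.
- by rewrite map_cat sumn_cat ser_weight_done esize_CAll /=; have := size_ser_name R; lia.
Qed.

Lemma iter_ser_expand n C : esize C <= n ->
  iter n (flatmap ser_expand) [:: todo C] = done (ser_concept C).
Proof.
have fix_done m w : iter m (flatmap ser_expand) (done w) = done w.
  apply: iter_flatmap_fixed; elim: w => //= a w IH; rewrite flatmap_cons IH.
  by rewrite /ser_expand /=.
have fix1 m a : iter m (flatmap ser_expand) [:: inl a] = [:: inl a] by apply: (fix_done m [:: a]).
have cons1 m (x : symbol + concept) l : iter m (flatmap ser_expand) (x :: l) =
    iter m (flatmap ser_expand) [:: x] ++ iter m (flatmap ser_expand) l.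
  by rewrite -iter_flatmap_cat.
elim: C n => [||A|A|C IHC D IHD|C IHC D IHD|R C IHC|R C IHC] [|n];
  try (by rewrite leqNgt esize_gt0); rewrite iterSr flatmap_id [X in iter _ _ X]/ser_expand /= ?flatmap_id ?cats0.
- by rewrite (fix_done n [:: Stop]).
- by rewrite (fix_done n [:: Sbot]).
- by rewrite cons1 fix1 fix_done.
- by rewrite cons1 fix1 fix_done.
- rewrite esize_CAnd => le; rewrite cons1 fix1 cons1 IHC ?IHD ?map_cat //; lia.
- rewrite esize_COr => le; rewrite cons1 fix1 cons1 IHC ?IHD ?map_cat //; lia.
- rewrite esize_CEx => le; rewrite cons1 fix1 iter_flatmap_cat fix_done IHC ?map_cat //; lia.
- rewrite esize_CAll => le; rewrite cons1 fix1 iter_flatmap_cat fix_done IHC ?map_cat //; lia.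
Qed.

Lemma ptime_ser_concept : ptime ser_concept.
Proof.
have p : ptime (fun l : seq (symbol + concept) => iter (esize l) (flatmap ser_expand) l).
  apply: (@ptime_iter_flatmap _ ser_expand ser_weight); first by pt.
  - exact: ser_expand_weight.
  - case=> [a|C] /=; rewrite ?esize_inl ?esize_inr.
      by have := esize_symbol a; lia.
    by have := esize_gt0 C; lia.
  - apply: (@pbounded_le _ _ _ (fun x => 100 * esize x + 100)); last by pbound.
    by case=> [a|C] /=; rewrite ?leq_addl // esize_inr; lia.
apply: (@ptime_ext _ _ (fun C => flatmap (@as_inl _ _)
    (iter (esize [:: todo C]) (flatmap ser_expand) [:: todo C]))); last first.
  by pt; apply: (ptime_comp p); pt.
move=> C; rewrite iter_ser_expand; last first.
  by rewrite esize_cons esize_inr; lia.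
by elim: (ser_concept C) => //= a w IH; rewrite flatmap_cons IH.
Qed.
#[export] Hint Resolve ptime_ser_concept : ptime.

Definition robj_symbols (r : robj) : seq symbol :=
  flatmap (fun R : name => Srname :: ser_name R) (as_rname r) ++
  flatmap (fun p : name * name => Srpair :: ser_name p.1 ++ ser_name p.2) (as_rpair r) ++
  map (fun=> Srtop) (as_rtop r) ++ map (fun=> Srbot) (as_rbot r) ++
  flatmap (fun R : name => Srcomp :: ser_name R) (as_rcomp r) ++
  flatmap (fun p : name * concept => Srfresh :: ser_name p.1 ++ ser_concept p.2) (as_rfresh r).

Lemma ptime_ser_robj : ptime ser_robj.
Proof.
apply: (@ptime_ext _ _ robj_symbols); last by rewrite /robj_symbols; pt.
by case=> *; rewrite /robj_symbols /= ?cats0 /flatmap /= ?cats0.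
Qed.
#[export] Hint Resolve ptime_ser_robj : ptime.

Definition cobj_symbols (X : cobj) : seq symbol :=
  flatmap (fun C : concept => Sconcept :: ser_concept C) (as_concept X) ++
  flatmap (fun a : name => Sind :: ser_name a) (as_ind X) ++
  flatmap (fun r : robj => Spil :: ser_robj r) (as_pil X) ++
  flatmap (fun r : robj => Spir :: ser_robj r) (as_pir X).

Lemma ptime_ser_cobj : ptime ser_cobj.
Proof.
apply: (@ptime_ext _ _ cobj_symbols); last by rewrite /cobj_symbols; pt.
by case=> *; rewrite /cobj_symbols /= ?cats0 /flatmap /= ?cats0.
Qed.
#[export] Hint Resolve ptime_ser_cobj : ptime.

Definition fact_symbols (f : fact) : seq symbol :=
  flatmap (fun X : cobj => Shasc :: ser_cobj X) (as_hasc f) ++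
  flatmap (fun r : robj => Shasr :: ser_robj r) (as_hasr f) ++
  flatmap (fun p : cobj * cobj => Sarrc :: ser_cobj p.1 ++ ser_cobj p.2) (as_arrc f) ++
  flatmap (fun p : robj * robj => Sarrr :: ser_robj p.1 ++ ser_robj p.2) (as_arrr f).

Lemma ptime_ser_structure : ptime ser_structure.
Proof.
apply: (@ptime_ext _ _ (fun s : seq fact => flatmap fact_symbols s)).
  move=> s; congr flatten; apply: eq_map.
  by case=> *; rewrite /fact_symbols /= ?cats0 /flatmap /= ?cats0.
by rewrite /fact_symbols; pt.
Qed.
#[export] Hint Resolve ptime_ser_structure : ptime.

(** * Parsing in polynomial time *)

Definition pstate : Type := (seq name * seq concept * seq axiom)%type.

Section Parser.
Variables mk_and mk_or : concept -> concept -> concept.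

(* Reads a serialization from right to left, keeping the names, the concepts and the
   axioms read so far on three stacks; [mk_and] and [mk_or] interpret the connectives. *)
Definition pstep (st : pstate) (a : symbol) : pstate :=
  if enc_eq a (Sbit false) then ((false :: head [::] st.1.1) :: behead st.1.1, st.1.2, st.2)
  else if enc_eq a (Sbit true) then ((true :: head [::] st.1.1) :: behead st.1.1, st.1.2, st.2)
  else if enc_eq a Send then ([::] :: st.1.1, st.1.2, st.2)
  else if enc_eq a Stop then (st.1.1, CTop :: st.1.2, st.2)
  else if enc_eq a Sbot then (st.1.1, CBot :: st.1.2, st.2)
  else if enc_eq a Sname then (behead st.1.1, CName (head [::] st.1.1) :: st.1.2, st.2)
  else if enc_eq a Snot then (behead st.1.1, CNot (head [::] st.1.1) :: st.1.2, st.2)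
  else if enc_eq a Sand then
    (st.1.1, mk_and (head CTop st.1.2) (head CTop (behead st.1.2)) :: behead (behead st.1.2), st.2)
  else if enc_eq a Sor then
    (st.1.1, mk_or (head CTop st.1.2) (head CTop (behead st.1.2)) :: behead (behead st.1.2), st.2)
  else if enc_eq a Sex then
    (behead st.1.1, CEx (head [::] st.1.1) (head CTop st.1.2) :: behead st.1.2, st.2)
  else if enc_eq a Sall then
    (behead st.1.1, CAll (head [::] st.1.1) (head CTop st.1.2) :: behead st.1.2, st.2)
  else if enc_eq a Sgci then
    (st.1.1, behead (behead st.1.2), GCI (head CTop st.1.2) (head CTop (behead st.1.2)) :: st.2)
  else if enc_eq a Sincl then
    (behead (behead st.1.1), st.1.2,
     RoleIncl (head [::] st.1.1) (head [::] (behead st.1.1)) :: st.2)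
  else if enc_eq a Strans then
    (behead st.1.1, st.1.2, Transitivity (head [::] st.1.1) :: st.2)
  else if enc_eq a Scassert then
    (behead st.1.1, behead st.1.2, ConceptAssert (head [::] st.1.1) (head CTop st.1.2) :: st.2)
  else if enc_eq a Srassert then
    (behead (behead (behead st.1.1)), st.1.2,
     RoleAssert (head [::] st.1.1) (head [::] (behead st.1.1))
       (head [::] (behead (behead st.1.1))) :: st.2)
  else st.

Definition parse (w : seq symbol) (st : pstate) : pstate := foldr (fun a st => pstep st a) st w.

Fixpoint cfold (C : concept) : concept :=
  match C with
  | CTop | CBot | CName _ | CNot _ => C
  | CAnd C D => mk_and (cfold C) (cfold D)
  | COr C D => mk_or (cfold C) (cfold D)
  | CEx R C => CEx R (cfold C)
  | CAll R C => CAll R (cfold C)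
  end.

Lemma parse_cat w w' st : parse (w ++ w') st = parse w (parse w' st).
Proof. exact: foldr_cat. Qed.

Lemma parse_name a ns cs axs :
  parse (ser_name a) (ns, cs, axs) = (a :: ns, cs, axs).
Proof.
by rewrite /ser_name -cats1 parse_cat /=; elim: a => //= -[] a ->.
Qed.

Lemma parse_concept C ns cs axs :
  parse (ser_concept C) (ns, cs, axs) = (ns, cfold C :: cs, axs).
Proof.
elim: C ns cs axs => [||A|A|C IHC D IHD|C IHC D IHD|R C IHC|R C IHC] ns cs axs //=;
  by rewrite -?/(parse _ _) ?parse_cat ?IHD ?IHC ?parse_name.
Qed.

Lemma ptime_pstep : ptime (fun p => mk_and p.1 p.2) -> ptime (fun p => mk_or p.1 p.2) ->
  ptime (fun p => pstep p.1 p.2).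
Proof. by move=> pa po; rewrite /pstep; pt. Qed.

Lemma esize_head_behead (A : encType) (a : A) l :
  esize (head a l) + esize (behead l) <= esize l + esize a.
Proof. by case: l => [|b l]; rewrite ?esize_cons /= ?esize_nil; lia. Qed.

Lemma esize_pstep k st a :
  (forall C D, esize (mk_and C D) <= esize C + esize D + k) ->
  (forall C D, esize (mk_or C D) <= esize C + esize D + k) ->
  esize (pstep st a) <= esize st + (k + 40).
Proof.
move=> ba bo; case: st => [[ns cs] axs].
have hn (l : seq name) : esize (head [::] l) + esize (behead l) <= esize l + 1.
  exact: (esize_head_behead ([::] : name)).
have hc (l : seq concept) : esize (head CTop l) + esize (behead l) <= esize l + 3.
  exact: (esize_head_behead CTop).
have n1 := hn ns; have n2 := hn (behead ns); have n3 := hn (behead (behead ns)).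
have c1 := hc cs; have c2 := hc (behead cs).
have eg C D : esize (GCI C D) = esize C + esize D + 3.
  by rewrite -[LHS]/(tsize (tagged 0 (N (enc C) (enc D)))) tsize_tagged tsize_N /esize; lia.
have ei (R S : name) : esize (RoleIncl R S) = esize R + esize S + 5.
  by rewrite -[LHS]/(tsize (tagged 1 (N (enc R) (enc S)))) tsize_tagged tsize_N /esize; lia.
have et (R : name) : esize (Transitivity R) = esize R + 6.
  by rewrite -[LHS]/(tsize (tagged 2 (enc R))) tsize_tagged /esize; lia.
have ec (R : name) C : esize (ConceptAssert R C) = esize R + esize C + 9.
  by rewrite -[LHS]/(tsize (tagged 3 (N (enc R) (enc C)))) tsize_tagged tsize_N /esize; lia.
have er (R S T : name) : esize (RoleAssert R S T) = esize R + esize S + esize T + 12.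
  rewrite -[LHS]/(tsize (tagged 4 (N (N (enc R) (enc S)) (enc T)))) tsize_tagged !tsize_N.
  by rewrite /esize; lia.
have baa := ba (head CTop cs) (head CTop (behead cs)).
have boo := bo (head CTop cs) (head CTop (behead cs)).
have e0 : esize ([::] : name) = 1 by [].
have eT : esize CTop = 3 by [].
have eB : esize CBot = 5 by [].
have P (ns' : seq name) (cs' : seq concept) (axs' : seq axiom) :
  esize (ns', cs', axs') = esize ns' + esize cs' + esize axs' + 2 by rewrite !esize_pair; lia.
have cn (n : name) l : esize (n :: l) = esize n + esize l + 1 by rewrite esize_cons addn1.
have cc (C : concept) l : esize (C :: l) = esize C + esize l + 1 by rewrite esize_cons addn1.
have ca (ax : axiom) l : esize (ax :: l) = esize ax + esize l + 1 by rewrite esize_cons addn1.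
have cb (b : bool) (l : name) : esize (b :: l : name) <= esize l + 4.
  by rewrite esize_cons; have : esize b <= 3 by [case: b]; lia.
rewrite (P ns cs axs) /pstep /=.
case: ifP => _; first by rewrite P cn; move: (cb false (head [::] ns)); lia.
case: ifP => _; first by rewrite P cn; move: (cb true (head [::] ns)); lia.
case: ifP => _; first by rewrite P cn e0; lia.
case: ifP => _; first by rewrite P cc eT; lia.
case: ifP => _; first by rewrite P cc eB; lia.
case: ifP => _; first by rewrite P cc esize_CName; lia.
case: ifP => _; first by rewrite P cc esize_CNot; lia.
case: ifP => _; first by rewrite P cc; lia.
case: ifP => _; first by rewrite P cc; lia.
case: ifP => _; first by rewrite P cc esize_CEx; lia.
case: ifP => _; first by rewrite P cc esize_CAll; lia.
case: ifP => _; first by rewrite P ca eg; lia.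
case: ifP => _; first by rewrite P ca ei; lia.
case: ifP => _; first by rewrite P ca et; lia.
case: ifP => _; first by rewrite P ca ec; lia.
case: ifP => _; first by rewrite P ca er; lia.
by rewrite P; lia.
Qed.

Lemma ptime_parse k : ptime (fun p => mk_and p.1 p.2) -> ptime (fun p => mk_or p.1 p.2) ->
  (forall C D, esize (mk_and C D) <= esize C + esize D + k) ->
  (forall C D, esize (mk_or C D) <= esize C + esize D + k) ->
  ptime (fun w => foldl pstep ([::], [::], [::]) w).
Proof.
move=> pa po ba bo; have ps := ptime_pstep pa po.
have := @ptime_foldl (seq_encType symbol_encType) _ _ (fun=> pstep) (fun=> ([::], [::], [::])) id.
apply; [by apply: (ptime_comp2 (g := pstep)); pt | by pt | by pt |].
have : pbounded (@esize (seq_encType symbol_encType)) (fun w => 20 + (k + 40) * esize w).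
  by pbound.
case=> K bK; exists K => w n; apply: leq_trans (bK w).
have : esize (take n w) <= esize w by apply: esize_take.
move: (take n w) => v le.
have : esize (foldl pstep ([::], [::], [::]) v) <= 20 + (k + 40) * size v.
  elim/last_ind: v {le} => [|v a IH]; first by [].
  rewrite -cats1 foldl_cat size_cat /= addn1 mulnS.
  apply: leq_trans (esize_pstep _ _ ba bo) _.
  by rewrite [X in _ <= X]addnCA [X in _ <= X]addnC leq_add2r.
move=> h; apply: leq_trans h _; rewrite leq_add2l leq_mul2l; apply/orP; right.
by have := size_esize v; lia.
Qed.

End Parser.

Lemma cfold_id C : cfold CAnd COr C = C.
Proof.
by elim: C => [||A|A|C IHC D IHD|C IHC D IHD|R C IHC|R C IHC] //=; rewrite ?IHC ?IHD.
Qed.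

Definition parse_ontology (w : seq symbol) : ontology :=
  (foldl (pstep CAnd COr) ([::], [::], [::]) w).2.

Lemma parse_ontologyK O : parse_ontology (rev (ser_ontology O)) = O.
Proof.
rewrite /parse_ontology foldl_rev -/(parse CAnd COr _ _).
suff -> : parse CAnd COr (ser_ontology O) ([::], [::], [::]) = ([::], [::], O) by [].
rewrite /ser_ontology; elim: O => //= ax O IH; rewrite parse_cat IH.
by case: ax => [C D|R S|R|a C|a b R]; rewrite /= -/(parse _ _ _ _) ?parse_cat
  ?parse_concept ?parse_name ?parse_concept ?parse_name ?cfold_id.
Qed.

Lemma ptime_parse_ontology : ptime parse_ontology.
Proof.
apply: ptime_comp; first by pt.
apply: (@ptime_parse _ _ 13); [by pt | by pt | |] => C D.
  by rewrite esize_CAnd; lia.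
by rewrite esize_COr.
Qed.
#[export] Hint Resolve ptime_parse_ontology : ptime.

Lemma ser_concept_inj : injective ser_concept.
Proof.
move=> C D e; have := parse_concept CAnd COr C [::] [::] [::].
by rewrite e parse_concept !cfold_id => -[].
Qed.

(** * Subconcepts and junctions *)

Fixpoint conjs (C : concept) : seq concept :=
  if C is CAnd C1 C2 then conjs C1 ++ conjs C2 else [:: C].
Fixpoint disjs (C : concept) : seq concept :=
  if C is COr C1 C2 then disjs C1 ++ disjs C2 else [:: C].

Fixpoint subs (C : concept) : seq concept :=
  C :: match C with
  | CTop | CBot | CName _ | CNot _ => [::]
  | CAnd C1 C2 | COr C1 C2 => subs C1 ++ subs C2
  | CEx _ C1 | CAll _ C1 => subs C1
  end.

Definition split_and (C : concept) : seq concept :=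
  if nilp (as_and C) then [:: C]
  else flatmap (fun p : concept * concept => [:: p.1; p.2]) (as_and C).
Definition split_or (C : concept) : seq concept :=
  if nilp (as_or C) then [:: C]
  else flatmap (fun p : concept * concept => [:: p.1; p.2]) (as_or C).

Lemma iter_split_and n C : esize C <= n -> iter n (flatmap split_and) [:: C] = conjs C.
Proof.
elim: C n => [||A|A|C IHC D IHD|C IHC D IHD|R C IHC|R C IHC] [|n] le;
  try (by rewrite leqNgt esize_gt0 in le); try exact: iter_flatmap_fixed.
rewrite esize_CAnd in le; rewrite iterSr flatmap_id -[split_and _]/([:: C] ++ [:: D]).
by rewrite iter_flatmap_cat IHC ?IHD //; lia.
Qed.

Lemma iter_split_or n C : esize C <= n -> iter n (flatmap split_or) [:: C] = disjs C.
Proof.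
elim: C n => [||A|A|C IHC D IHD|C IHC D IHD|R C IHC|R C IHC] [|n] le;
  try (by rewrite leqNgt esize_gt0 in le); try exact: iter_flatmap_fixed.
rewrite esize_COr in le; rewrite iterSr flatmap_id -[split_or _]/([:: C] ++ [:: D]).
by rewrite iter_flatmap_cat IHC ?IHD //; lia.
Qed.

Lemma ptime_conjs : ptime conjs.
Proof.
have p : ptime (fun l : seq concept => iter (esize l) (flatmap split_and) l).
  apply: (@ptime_iter_flatmap _ split_and (@esize concept_encType)) => //.
  - by rewrite /split_and; pt.
  - by case=> *; rewrite /split_and /= ?esize_CAnd; lia.
  - by pbound.
apply: (@ptime_ext _ _ (fun C => iter (esize [:: C]) (flatmap split_and) [:: C])).
  by move=> C; rewrite iter_split_and // esize_cons; lia.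
by apply: (ptime_comp p); pt.
Qed.

Lemma ptime_disjs : ptime disjs.
Proof.
have p : ptime (fun l : seq concept => iter (esize l) (flatmap split_or) l).
  apply: (@ptime_iter_flatmap _ split_or (@esize concept_encType)) => //.
  - by rewrite /split_or; pt.
  - by case=> *; rewrite /split_or /= ?esize_COr; lia.
  - by pbound.
apply: (@ptime_ext _ _ (fun C => iter (esize [:: C]) (flatmap split_or) [:: C])).
  by move=> C; rewrite iter_split_or // esize_cons; lia.
by apply: (ptime_comp p); pt.
Qed.
#[export] Hint Resolve ptime_conjs ptime_disjs : ptime.

Definition children (C : concept) : seq concept :=
  flatmap (fun p : concept * concept => [:: p.1; p.2]) (as_and C ++ as_or C) ++
  map (fun p : name * concept => p.2) (as_ex C ++ as_all C).

(* [inl] marks the concepts already listed, [inr] those still to be expanded. *)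
Definition sub_expand (x : concept + concept) : seq (concept + concept) :=
  map inl (as_inl x) ++
  flatmap (fun C : concept => inl C :: map inr (children C)) (as_inr x).

Lemma iter_sub_expand n C : esize C <= n ->
  iter n (flatmap sub_expand) [:: inr C] = map inl (subs C).
Proof.
have fix1 m (D : concept) : iter m (flatmap sub_expand) [:: inl D] = [:: inl D].
  by apply: iter_flatmap_fixed.
have cons1 m (x : concept + concept) l : iter m (flatmap sub_expand) (x :: l) =
    iter m (flatmap sub_expand) [:: x] ++ iter m (flatmap sub_expand) l.
  by rewrite -iter_flatmap_cat.
elim: C n => [||A|A|C IHC D IHD|C IHC D IHD|R C IHC|R C IHC] [|n] le;
  try (by rewrite leqNgt esize_gt0 in le);
  rewrite iterSr flatmap_id [X in iter _ _ X]/sub_expand /= ?flatmap_id ?cats0 /= ?fix1 //.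
- rewrite esize_CAnd in le; rewrite cons1 fix1 cons1 IHC ?IHD ?map_cat //; lia.
- rewrite esize_COr in le; rewrite cons1 fix1 cons1 IHC ?IHD ?map_cat //; lia.
- rewrite esize_CEx in le; rewrite cons1 fix1 IHC //; lia.
- rewrite esize_CAll in le; rewrite cons1 fix1 IHC //; lia.
Qed.

Lemma ptime_subs : ptime subs.
Proof.
pose w (x : concept + concept) :=
  match x with inl C => 5 * esize C | inr C => 5 * esize C * esize C end.
have p : ptime (fun l : seq (concept + concept) => iter (esize l) (flatmap sub_expand) l).
  apply: (@ptime_iter_flatmap _ sub_expand w).
  - by rewrite /sub_expand /children; pt.
  - case=> [C|C]; first by rewrite /sub_expand /= addn0.
    rewrite /sub_expand flatmap_id.
    have := esize_gt0 C.
    case: C => [||A|A|C D|C D|R C|R C] /=; rewrite ?addn0; try by nia.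
    + by rewrite esize_CAnd; nia.
    + by rewrite esize_COr; nia.
    + by rewrite esize_CEx; nia.
    + by rewrite esize_CAll; nia.
  - by case=> C; rewrite ?esize_inl ?esize_inr /=; have := esize_gt0 C; nia.
  - apply: (@pbounded_le _ _ _ (fun x => 5 * esize x * esize x)); last by pbound.
    by case=> C; rewrite ?esize_inl ?esize_inr /=; nia.
apply: (@ptime_ext _ _ (fun C => flatmap (@as_inl _ _)
    (iter (esize [:: inr C : concept + concept]) (flatmap sub_expand) [:: inr C]))); last first.
  by pt; apply: (ptime_comp p); pt.
move=> C; rewrite iter_sub_expand; last by rewrite esize_cons esize_inr; lia.
by elim: (subs C) => //= D l IH; rewrite flatmap_cons IH.
Qed.
#[export] Hint Resolve ptime_subs : ptime.

(** * Canonical forms *)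

Fixpoint lexlt (s t : seq symbol) : bool :=
  match s, t with
  | _, [::] => false
  | [::], _ :: _ => true
  | a :: s', b :: t' => if a == b then lexlt s' t' else symbol_code a < symbol_code b
  end.

Lemma lexlt_irr : irreflexive lexlt.
Proof. by elim=> //= a s IH; rewrite eqxx. Qed.

Lemma lexlt_trans : transitive lexlt.
Proof.
move=> s; elim: s => [|a s IH] [|b t] [|c u] //=.
case: (eqVneq b a) => [->|ba]; first by case: eqVneq => // _; apply: IH.
case: (eqVneq a c) => [<-|ac]; first by rewrite (negbTE ba).
move=> l1 l2; case: eqVneq => [e|_]; last exact: ltn_trans l1 l2.
by rewrite e in l1; lia.
Qed.

Lemma lexlt_total s t : s != t -> lexlt s t || lexlt t s.
Proof.
elim: s t => [|a s IH] [|b t] //=; rewrite eqseq_cons [b == a]eq_sym.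
case: eqVneq => [_ /IH //|ne _]; rewrite -neq_ltn.
by apply: contra ne => /eqP /(can_inj symbol_codeK) ->.
Qed.

(* Locked, so that conversion never enumerates the 32 * 32 pairs. *)
Definition symbol_lt_pairs : seq (symbol * symbol) := locked
  [seq p <- [seq (x, y) | x <- symbols, y <- symbols] | symbol_code p.1 < symbol_code p.2].

Definition symbol_ltb (a b : symbol) : bool :=
  has (fun p : symbol * symbol => enc_eq p.1 a && enc_eq p.2 b) symbol_lt_pairs.

Lemma mem_symbols a : a \in symbols.
Proof. by case: a => // -[]. Qed.

Lemma symbol_ltbE a b : symbol_ltb a b = (symbol_code a < symbol_code b).
Proof.
rewrite /symbol_ltb /symbol_lt_pairs -lock; apply/hasP/idP => [[p]|lt].
  by rewrite mem_filter => /andP[lt _] /andP[/enc_eqP <- /enc_eqP <-].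
exists (a, b); last by apply/andP; split; apply/enc_eqP.
by rewrite mem_filter lt; apply: allpairs_f; apply: mem_symbols.
Qed.

Lemma ptime_symbol_ltb : ptime (fun p => symbol_ltb p.1 p.2).
Proof. by rewrite /symbol_ltb; pt. Qed.
#[export] Hint Resolve ptime_symbol_ltb : ptime.

Definition strip1 (p : seq symbol * seq symbol) : seq symbol * seq symbol :=
  if [&& ~~ nilp p.1, ~~ nilp p.2 & enc_eq (head Sno p.1) (head Sno p.2)]
  then (behead p.1, behead p.2) else p.

Lemma ptime_lexlt : ptime (fun p => lexlt p.1 p.2).
Proof.
have ps : ptime strip1 by rewrite /strip1; pt.
have pi : ptime (fun p : seq symbol * seq symbol => iter (esize p.1) strip1 p).
  apply: ptime_iter ps _; [by pt | by pt |].
  exists 1 => p n _; rewrite expn1; apply: leq_trans (leq_addr _ _).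
  elim: n => //= n; apply: leq_trans; rewrite /strip1.
  case: ifP => // _; case: (iter _ _ _) => s t; rewrite !esize_pair /=.
  by rewrite ltnS leq_add // -drop1; apply: esize_drop.
apply: (@ptime_ext _ _ (fun p : seq symbol * seq symbol =>
  ~~ nilp (iter (esize p.1) strip1 p).2 && (nilp (iter (esize p.1) strip1 p).1 ||
   symbol_ltb (head Sno (iter (esize p.1) strip1 p).1) (head Sno (iter (esize p.1) strip1 p).2))));
  last first.
  by pt; apply: ptime_comp pi; pt.
move=> [s t] /=; have := size_esize s => /ltnW; move: (esize s) => n.
elim: n s t => [|n IH] s t; first by rewrite leqn0 size_eq0 => /eqP ->; case: t.
case: s t => [|a s] [|b t] le; rewrite ?iterSr.
- by rewrite iter_fix.
- by rewrite iter_fix.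
- by rewrite iter_fix.
rewrite [X in iter n _ X](_ : _ = if a == b then (s, t) else (a :: s, b :: t)); last first.
  by rewrite /strip1 /=; congr (if _ then _ else _); apply/enc_eqP/eqP.
rewrite /=; case: eqVneq => [_|ne]; first exact: IH.
by rewrite iter_fix /strip1 /= ?symbol_ltbE //; case: enc_eqP => // e; rewrite e eqxx in ne.
Qed.
#[export] Hint Resolve ptime_lexlt : ptime.

Definition clt (C D : concept) : bool := lexlt (ser_concept C) (ser_concept D).

Lemma clt_irr : irreflexive clt.
Proof. by move=> C; apply: lexlt_irr. Qed.
Lemma clt_trans : transitive clt.
Proof. by move=> C D E; apply: lexlt_trans. Qed.
Lemma clt_total C D : C != D -> clt C D || clt D C.
Proof. by move=> ne; apply: lexlt_total; apply: contra ne => /eqP /ser_concept_inj ->. Qed.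

Definition insert (l : seq concept) (x : concept) : seq concept :=
  filter (fun y => clt y x) l ++ x :: filter (fun y => clt x y) l.
Definition canon (l : seq concept) : seq concept := foldl insert [::] l.

Lemma mem_insert l x : insert l x =i x :: l.
Proof.
move=> y; rewrite mem_cat inE !mem_filter; case: (eqVneq y x) => [->|ne] /=.
  by rewrite inE eqxx orbT.
rewrite inE (negbTE ne) /=; case: (y \in l); rewrite ?andbF ?andbT //.
exact: clt_total.
Qed.

Lemma sorted_insert l x : sorted clt l -> sorted clt (insert l x).
Proof.
move=> sl; rewrite /insert.
have sf p : sorted clt (filter p l) by apply: sorted_filter sl; apply: clt_trans.
rewrite sorted_pairwise; last exact: clt_trans.
rewrite pairwise_cat /= -!sorted_pairwise ?sf; try exact: clt_trans.
rewrite !andbT; apply/andP; split; last by apply/allP=> y; rewrite mem_filter => /andP[].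
apply/allrelP=> y z; rewrite mem_filter inE mem_filter => /andP[yx _].
case/orP=> [/eqP ->//|/andP[xz _]]; exact: clt_trans yx xz.
Qed.

Lemma foldl_insert l acc : sorted clt acc ->
  sorted clt (foldl insert acc l) /\ foldl insert acc l =i acc ++ l.
Proof.
elim: l acc => [|x l IH] acc sa; first by split=> // y; rewrite cats0.
have [s m] := IH _ (sorted_insert x sa); split=> // y.
by rewrite m mem_cat mem_insert mem_cat !inE; case: (y == x); rewrite ?orbT.
Qed.

Lemma sorted_canon l : sorted clt (canon l).
Proof. by have [] := @foldl_insert l [::]. Qed.

Lemma mem_canon l : canon l =i l.
Proof. by have [] := @foldl_insert l [::]. Qed.

Lemma eq_canon l l' : l =i l' -> canon l = canon l'.
Proof.
move=> e; apply: (irr_sorted_eq clt_trans clt_irr); try exact: sorted_canon.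
by move=> x; rewrite !mem_canon.
Qed.

Lemma canon_id l : sorted clt l -> canon l = l.
Proof.
move=> s; apply: (irr_sorted_eq clt_trans clt_irr) => //; first exact: sorted_canon.
exact: mem_canon.
Qed.

Section Weights.
Variable w : concept -> nat.

Lemma sumn_filter_disjoint (p q : pred concept) l : (forall x, ~~ (p x && q x)) ->
  sumn (map w (filter p l)) + sumn (map w (filter q l)) <= sumn (map w l).
Proof.
by move=> d; elim: l => //= x l IH; have := d x; case: (p x); case: (q x) => //= _; lia.
Qed.

Lemma sumn_canon l : sumn (map w (canon l)) <= sumn (map w l).
Proof.
have h acc : sumn (map w (foldl insert acc l)) <= sumn (map w acc) + sumn (map w l).
  elim: l acc => [|x l IH] acc /=; first by rewrite addn0.
  apply: leq_trans (IH _) _; rewrite /insert map_cat sumn_cat /=.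
  have d : forall y, ~~ (clt y x && clt x y).
    by move=> y; apply/negP=> /andP[/clt_trans t /t]; rewrite clt_irr.
  have := @sumn_filter_disjoint (fun y => clt y x) (fun y => clt x y) acc d.
  by lia.
exact: h.
Qed.

End Weights.

Lemma esize_seqE (A : encType) (l : seq A) : esize l = sumn (map (fun a => (esize a).+1) l) + 1.
Proof. by elim: l => // a l IH; rewrite esize_cons IH /=; lia. Qed.

Lemma ptime_clt : ptime (fun p => clt p.1 p.2).
Proof. by rewrite /clt; pt. Qed.
#[export] Hint Resolve ptime_clt : ptime.

Lemma ptime_canon : ptime canon.
Proof.
have := @ptime_foldl (seq_encType concept_encType) _ _ (fun=> insert) (fun=> [::]) id.
apply; [by rewrite /insert; pt | by pt | by pt |].
exists 1 => l n; rewrite expn1; apply: leq_trans (leq_addr _ _).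
apply: leq_trans (esize_take n l); rewrite !esize_seqE leq_add2r.
exact: sumn_canon.
Qed.
#[export] Hint Resolve ptime_canon : ptime.

Section Junction.
Variable op : concept -> concept -> concept.

Fixpoint join (l : seq concept) : concept :=
  match l with [::] => CTop | [:: x] => x | x :: l' => op x (join l') end.

Lemma join_cons x l : l != [::] -> join (x :: l) = op x (join l).
Proof. by case: l. Qed.

Lemma join_foldl l :
  join l = foldl (fun acc x => op x acc) (head CTop (rev l)) (behead (rev l)).
Proof.
elim: l => // x l IH; case: (eqVneq l [::]) => [->//|ne].
rewrite join_cons // IH rev_cons.
by case: (lastP l) ne => // l' y _; rewrite rev_rcons /= -cats1 foldl_cat.
Qed.

Lemma esize_join k l : (forall C D, esize (op C D) = esize C + esize D + k) ->
  l != [::] -> esize (join l) + k = sumn (map (fun x => esize x + k) l).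
Proof.
move=> e; elim: l => // x l IH _; case: (eqVneq l [::]) => [->|ne]; first by rewrite /= addn0.
by rewrite join_cons // e /= -IH //; lia.
Qed.

Lemma ptime_join k : ptime (fun p => op p.1 p.2) ->
  (forall C D, esize (op C D) = esize C + esize D + k) -> ptime join.
Proof.
move=> po e; apply: (@ptime_ext _ _ (fun l => foldl (fun acc x => op x acc)
  (head CTop (rev l)) (behead (rev l)))); first by move=> l; rewrite join_foldl.
have := @ptime_foldl (seq_encType concept_encType) _ _ (fun _ acc x => op x acc)
  (fun l => head CTop (rev l)) (fun l => behead (rev l)).
apply; [by apply: (ptime_comp2 (g := op)); pt | by pt | by pt |].
have : pbounded (@esize (seq_encType concept_encType)) (fun l => (k + 1) * (esize l + 3)).
  by pbound.
case=> K bK; exists K => l n; apply: leq_trans (bK l).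
have b z m : esize (foldl (fun acc x => op x acc) z m) <= esize z + (k + 1) * esize m.
  elim: m z => [|x m IH] z /=; first by rewrite leq_addr.
  apply: leq_trans (IH _) _; rewrite e esize_cons.
  have := esize_gt0 x; nia.
apply: leq_trans (b _ _) _.
have bt : esize (take n (behead (rev l))) <= esize (behead (rev l)) by apply: esize_take.
have bh : esize (head CTop (rev l)) + esize (behead (rev l)) <= esize l + 3.
  by rewrite -(esize_rev l); apply: (esize_head_behead CTop).
apply: (@leq_trans ((k + 1) * (esize (head CTop (rev l)) + esize (behead (rev l))))).
  by rewrite mulnDr leq_add ?leq_mul2l ?bt ?orbT // leq_pmull // addn1.
by rewrite leq_mul2l bh orbT.
Qed.

End Junction.

Definition nfA (C D : concept) : concept := join CAnd (canon (conjs C ++ conjs D)).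
Definition nfO (C D : concept) : concept := join COr (canon (disjs C ++ disjs D)).
Definition nf : concept -> concept := cfold nfA nfO.

Lemma ptime_nfA : ptime (fun p => nfA p.1 p.2).
Proof.
have pj := ptime_join ptime_CAnd esize_CAnd.
by rewrite /nfA; apply: (ptime_comp pj); pt.
Qed.
Lemma ptime_nfO : ptime (fun p => nfO p.1 p.2).
Proof.
have pj := ptime_join ptime_COr esize_COr.
by rewrite /nfO; apply: (ptime_comp pj); pt.
Qed.

Lemma conjs_neq0 C : conjs C != [::].
Proof. by elim: C => //= C IH D _; case: (conjs C) IH. Qed.
Lemma disjs_neq0 C : disjs C != [::].
Proof. by elim: C => //= C IH D _; case: (disjs C) IH. Qed.

Lemma canon_neq0 l : l != [::] -> canon l != [::].
Proof.
case: l => // x l _; have : x \in canon (x :: l) by rewrite mem_canon mem_head.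
by case: canon.
Qed.

Lemma cat_neq0 (A : eqType) (l l' : seq A) : l != [::] -> l ++ l' != [::].
Proof. by case: l. Qed.

Lemma esize_conjs C : esize C + 11 = sumn (map (fun x => esize x + 11) (conjs C)).
Proof.
elim: C => [||A|A|C IHC D IHD|C IHC D IHD|R C IHC|R C IHC] /=; rewrite ?addn0 //.
by rewrite map_cat sumn_cat -IHC -IHD esize_CAnd; lia.
Qed.
Lemma esize_disjs C : esize C + 13 = sumn (map (fun x => esize x + 13) (disjs C)).
Proof.
elim: C => [||A|A|C IHC D IHD|C IHC D IHD|R C IHC|R C IHC] /=; rewrite ?addn0 //.
by rewrite map_cat sumn_cat -IHC -IHD esize_COr; lia.
Qed.

Lemma esize_nfA C D : esize (nfA C D) <= esize C + esize D + 13.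
Proof.
have ne : canon (conjs C ++ conjs D) != [::] by rewrite canon_neq0 ?cat_neq0 ?conjs_neq0.
have := esize_join esize_CAnd ne; rewrite -/(nfA C D) => e.
have := sumn_canon (fun x => esize x + 11) (conjs C ++ conjs D).
by rewrite -e map_cat sumn_cat -!esize_conjs; lia.
Qed.
Lemma esize_nfO C D : esize (nfO C D) <= esize C + esize D + 13.
Proof.
have ne : canon (disjs C ++ disjs D) != [::] by rewrite canon_neq0 ?cat_neq0 ?disjs_neq0.
have := esize_join esize_COr ne; rewrite -/(nfO C D) => e.
have := sumn_canon (fun x => esize x + 13) (disjs C ++ disjs D).
by rewrite -e map_cat sumn_cat -!esize_disjs; lia.
Qed.

Lemma ptime_nf : ptime nf.
Proof.
have pp := ptime_parse ptime_nfA ptime_nfO esize_nfA esize_nfO.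
apply: (@ptime_ext _ _ (fun C =>
  head CTop (foldl (pstep nfA nfO) ([::], [::], [::]) (rev (ser_concept C))).1.2)).
  by move=> C; rewrite foldl_rev -/(parse nfA nfO _ _) parse_concept.
by pt; apply: (ptime_comp pp); pt.
Qed.
#[export] Hint Resolve ptime_nf : ptime.

Definition is_and C := if C is CAnd _ _ then true else false.
Definition is_or C := if C is COr _ _ then true else false.

Lemma conjs_not_and C x : x \in conjs C -> ~~ is_and x.
Proof.
elim: C => [||A|A|C IHC D IHD|C IHC D IHD|R C IHC|R C IHC] /=;
  rewrite ?inE; try by move/eqP->.
by rewrite mem_cat => /orP[/IHC|/IHD].
Qed.
Lemma disjs_not_or C x : x \in disjs C -> ~~ is_or x.
Proof.
elim: C => [||A|A|C IHC D IHD|C IHC D IHD|R C IHC|R C IHC] /=;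
  rewrite ?inE; try by move/eqP->.
by rewrite mem_cat => /orP[/IHC|/IHD].
Qed.

Lemma conjs_id C : ~~ is_and C -> conjs C = [:: C].
Proof. by case: C. Qed.
Lemma disjs_id C : ~~ is_or C -> disjs C = [:: C].
Proof. by case: C. Qed.

Lemma conjs_join l : l != [::] -> (forall x, x \in l -> ~~ is_and x) ->
  conjs (join CAnd l) = l.
Proof.
elim: l => // x l IH _ h; have hx := h x (mem_head _ _).
case: (eqVneq l [::]) => [->|ne]; first by rewrite /= conjs_id.
rewrite join_cons //= conjs_id // IH // => y yl; apply: h.
by rewrite inE yl orbT.
Qed.
Lemma disjs_join l : l != [::] -> (forall x, x \in l -> ~~ is_or x) ->
  disjs (join COr l) = l.
Proof.
elim: l => // x l IH _ h; have hx := h x (mem_head _ _).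
case: (eqVneq l [::]) => [->|ne]; first by rewrite /= disjs_id.
rewrite join_cons //= disjs_id // IH // => y yl; apply: h.
by rewrite inE yl orbT.
Qed.

Lemma conjs_nfA C D : conjs (nfA C D) = canon (conjs C ++ conjs D).
Proof.
apply: conjs_join; first by rewrite canon_neq0 ?cat_neq0 ?conjs_neq0.
by move=> x; rewrite mem_canon mem_cat => /orP[]; apply: conjs_not_and.
Qed.
Lemma disjs_nfO C D : disjs (nfO C D) = canon (disjs C ++ disjs D).
Proof.
apply: disjs_join; first by rewrite canon_neq0 ?cat_neq0 ?disjs_neq0.
by move=> x; rewrite mem_canon mem_cat => /orP[]; apply: disjs_not_or.
Qed.

Definition normal1 (x : concept) : bool :=
  [&& sorted clt (conjs x), join CAnd (conjs x) == x, sorted clt (disjs x)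
    & join COr (disjs x) == x].
Definition normal (x : concept) : bool := all normal1 (subs x).

Lemma subs_refl C : C \in subs C.
Proof. by case: C => *; rewrite mem_head. Qed.

Lemma subs_trans C D : D \in subs C -> {subset subs D <= subs C}.
Proof.
elim: C => [||A|A|C1 IH1 C2 IH2|C1 IH1 C2 IH2|R C IHC|R C IHC] /=;
  rewrite inE; try (by move/eqP->); move=> /orP[/eqP -> //|].
- by rewrite mem_cat => /orP[/IH1|/IH2] h x /h xs; rewrite inE mem_cat xs ?orbT.
- by rewrite mem_cat => /orP[/IH1|/IH2] h x /h xs; rewrite inE mem_cat xs ?orbT.
- by move=> /IHC h x /h xs; rewrite inE xs orbT.
- by move=> /IHC h x /h xs; rewrite inE xs orbT.
Qed.

Lemma conjs_subs C : {subset conjs C <= subs C}.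
Proof.
elim: C => [||A|A|C IHC D IHD|C IHC D IHD|R C IHC|R C IHC] x;
  rewrite ?inE; try by move/eqP->; rewrite ?subs_refl ?inE ?eqxx.
by rewrite /= mem_cat => /orP[/IHC|/IHD] h; rewrite !(inE, mem_cat) h ?orbT.
Qed.
Lemma disjs_subs C : {subset disjs C <= subs C}.
Proof.
elim: C => [||A|A|C IHC D IHD|C IHC D IHD|R C IHC|R C IHC] x;
  rewrite ?inE; try by move/eqP->; rewrite ?subs_refl ?inE ?eqxx.
by rewrite /= mem_cat => /orP[/IHC|/IHD] h; rewrite !(inE, mem_cat) h ?orbT.
Qed.

Lemma normal_sub C D : D \in subs C -> normal C -> normal D.
Proof. by move=> /subs_trans h /allP n; apply/allP=> x /h /n. Qed.

Lemma normal_join_and l : l != [::] -> sorted clt l ->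
  (forall x, x \in l -> normal x && ~~ is_and x) -> normal (join CAnd l).
Proof.
elim: l => // x l IH _ sl h; case: (eqVneq l [::]) => [->|ne].
  by have /andP[] := h x (mem_head _ _).
have /andP[nx ax] := h x (mem_head _ _).
have hl y : y \in l -> normal y && ~~ is_and y by move=> yl; apply: h; rewrite inE yl orbT.
have nj := IH ne (path_sorted sl) hl.
have cj : conjs (join CAnd (x :: l)) = x :: l.
  by apply: conjs_join => // y /h /andP[].
rewrite join_cons // in cj *; rewrite /normal /= all_cat -!/(normal _) nx nj !andbT /normal1.
by rewrite cj sl -join_cons // eqxx join_cons //= eqxx.
Qed.
Lemma normal_join_or l : l != [::] -> sorted clt l ->
  (forall x, x \in l -> normal x && ~~ is_or x) -> normal (join COr l).
Proof.
elim: l => // x l IH _ sl h; case: (eqVneq l [::]) => [->|ne].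
  by have /andP[] := h x (mem_head _ _).
have /andP[nx ax] := h x (mem_head _ _).
have hl y : y \in l -> normal y && ~~ is_or y by move=> yl; apply: h; rewrite inE yl orbT.
have nj := IH ne (path_sorted sl) hl.
have cj : disjs (join COr (x :: l)) = x :: l.
  by apply: disjs_join => // y /h /andP[].
rewrite join_cons // in cj *; rewrite /normal /= all_cat -!/(normal _) nx nj !andbT /normal1.
by rewrite cj sl -join_cons // eqxx join_cons //= eqxx.
Qed.

Lemma normal_nf C : normal (nf C).
Proof.
rewrite /nf; elim: C => [||A|A|C IHC D IHD|C IHC D IHD|R C IHC|R C IHC] /=;
  try by rewrite /normal /= /normal1 /= !eqxx.
- apply: normal_join_and; first by rewrite canon_neq0 ?cat_neq0 ?conjs_neq0.
    exact: sorted_canon.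
  move=> x; rewrite mem_canon mem_cat => /orP[] h; rewrite (conjs_not_and h) andbT.
    exact: normal_sub (conjs_subs h) IHC.
  exact: normal_sub (conjs_subs h) IHD.
- apply: normal_join_or; first by rewrite canon_neq0 ?cat_neq0 ?disjs_neq0.
    exact: sorted_canon.
  move=> x; rewrite mem_canon mem_cat => /orP[] h; rewrite (disjs_not_or h) andbT.
    exact: normal_sub (disjs_subs h) IHC.
  exact: normal_sub (disjs_subs h) IHD.
Qed.

Lemma nf_complete C D : concept_eqv C D -> nf C = nf D.
Proof.
rewrite /nf.
elim=> {C D} //=; try by [move=> ? ? ? ? ? -> ? -> | move=> ? ? ? ? -> ? -> | move=> ? ? ? ? ->].
- move=> C D E; congr (join CAnd); apply: eq_canon => x.
  by rewrite !mem_cat !conjs_nfA !mem_canon !mem_cat orbA.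
- by move=> C D; congr (join CAnd); apply: eq_canon => x; rewrite !mem_cat orbC.
- move=> C; have /allP/(_ _ (subs_refl _))/and4P[s /eqP e _ _] := normal_nf C.
  rewrite -[RHS]e -[X in _ = join _ X](canon_id s); congr (join CAnd).
  by apply: eq_canon => x; rewrite mem_cat orbb.
- move=> C D E; congr (join COr); apply: eq_canon => x.
  by rewrite !mem_cat !disjs_nfO !mem_canon !mem_cat orbA.
- by move=> C D; congr (join COr); apply: eq_canon => x; rewrite !mem_cat orbC.
- move=> C; have /allP/(_ _ (subs_refl _))/and4P[_ _ s /eqP e] := normal_nf C.
  rewrite -[RHS]e -[X in _ = join _ X](canon_id s); congr (join COr).
  by apply: eq_canon => x; rewrite mem_cat orbb.
Qed.

Section Absorption.
Variable op : concept -> concept -> concept.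
Hypothesis opE : forall C C' D D', concept_eqv C C' -> concept_eqv D D' ->
  concept_eqv (op C D) (op C' D').
Hypothesis opA : forall C D E, concept_eqv (op C (op D E)) (op (op C D) E).
Hypothesis opC : forall C D, concept_eqv (op C D) (op D C).

Definition absorbs C D := concept_eqv (op C D) C.

Lemma absorbs_op C D E : absorbs C D -> absorbs C E -> absorbs C (op D E).
Proof.
move=> cd ce; apply: eqv_trans (opA _ _ _) _.
by apply: eqv_trans (opE cd (eqv_refl _)) _.
Qed.

Lemma absorbs_r C D E : absorbs D E -> absorbs (op C D) E.
Proof.
move=> de; apply: eqv_trans (eqv_sym (opA _ _ _)) _.
exact: opE (eqv_refl _) de.
Qed.

Lemma absorbs_l C D E : absorbs C E -> absorbs (op C D) E.
Proof.
move=> ce; apply: eqv_trans (opE (opC _ _) (eqv_refl _)) _.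
exact: eqv_trans (absorbs_r _ ce) (opC _ _).
Qed.

Lemma absorbs_anti C D : absorbs C D -> absorbs D C -> concept_eqv C D.
Proof.
move=> cd dc; apply: eqv_trans (eqv_sym cd) _.
exact: eqv_trans (opC _ _) dc.
Qed.

End Absorption.

Lemma absorbs_conjs C x : x \in conjs C -> absorbs CAnd C x.
Proof.
elim: C => [||A|A|C IHC D IHD|C IHC D IHD|R C IHC|R C IHC] /=;
  rewrite ?inE; try (by move/eqP->; constructor).
rewrite mem_cat => /orP[/IHC|/IHD]; [apply: absorbs_l | apply: absorbs_r]; by constructor.
Qed.
Lemma absorbs_disjs C x : x \in disjs C -> absorbs COr C x.
Proof.
elim: C => [||A|A|C IHC D IHD|C IHC D IHD|R C IHC|R C IHC] /=;
  rewrite ?inE; try (by move/eqP->; constructor).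
rewrite mem_cat => /orP[/IHC|/IHD]; [apply: absorbs_l | apply: absorbs_r]; by constructor.
Qed.

Lemma absorbs_all_conjs C D : (forall x, x \in conjs D -> absorbs CAnd C x) ->
  absorbs CAnd C D.
Proof.
elim: D => [||A|A|D1 IH1 D2 IH2|D1 _ D2 _|R D _|R D _] h; try by apply: h; rewrite mem_head.
apply: absorbs_op; try by constructor.
  by apply: IH1 => x xd; apply: h; rewrite /= mem_cat xd.
by apply: IH2 => x xd; apply: h; rewrite /= mem_cat xd orbT.
Qed.
Lemma absorbs_all_disjs C D : (forall x, x \in disjs D -> absorbs COr C x) ->
  absorbs COr C D.
Proof.
elim: D => [||A|A|D1 _ D2 _|D1 IH1 D2 IH2|R D _|R D _] h; try by apply: h; rewrite mem_head.
apply: absorbs_op; try by constructor.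
  by apply: IH1 => x xd; apply: h; rewrite /= mem_cat xd.
by apply: IH2 => x xd; apply: h; rewrite /= mem_cat xd orbT.
Qed.

Lemma eqv_of_conjs C D : conjs C =i conjs D -> concept_eqv C D.
Proof.
move=> e; apply: (@absorbs_anti CAnd); first by constructor.
  by apply: absorbs_all_conjs => x; rewrite -e; apply: absorbs_conjs.
by apply: absorbs_all_conjs => x; rewrite e; apply: absorbs_conjs.
Qed.
Lemma eqv_of_disjs C D : disjs C =i disjs D -> concept_eqv C D.
Proof.
move=> e; apply: (@absorbs_anti COr); first by constructor.
  by apply: absorbs_all_disjs => x; rewrite -e; apply: absorbs_disjs.
by apply: absorbs_all_disjs => x; rewrite e; apply: absorbs_disjs.
Qed.

Lemma eqv_nf C : concept_eqv C (nf C).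
Proof.
rewrite /nf; elim: C => [||A|A|C IHC D IHD|C IHC D IHD|R C IHC|R C IHC] /=; try by constructor.
- apply: eqv_trans (eqv_and IHC IHD) _; apply: eqv_of_conjs => x.
  by rewrite conjs_nfA mem_canon.
- apply: eqv_trans (eqv_or IHC IHD) _; apply: eqv_of_disjs => x.
  by rewrite disjs_nfO mem_canon.
Qed.

Lemma concept_eqv_nf C D : concept_eqv C D <-> nf C = nf D.
Proof.
split=> [|e]; first exact: nf_complete.
by apply: eqv_trans (eqv_nf C) _; rewrite e; apply/eqv_sym/eqv_nf.
Qed.

(** * Presence of facts *)

Lemma flatmapP (A B : eqType) (f : A -> seq B) l y :
  reflect (exists2 x, x \in l & y \in f x) (y \in flatmap f l).
Proof. exact: flatten_mapP. Qed.

Definition nf_robj (r : robj) : robj :=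
  if nilp (as_rfresh r) then r
  else head RTop (map (fun p : name * concept => RFresh p.1 (nf p.2)) (as_rfresh r)).

Definition cobj_key (X : cobj) : seq cobj :=
  map (fun C : concept => OConcept (nf C)) (as_concept X) ++ map OInd (as_ind X) ++
  map (fun r : robj => OPiL (nf_robj r)) (as_pil X) ++
  map (fun r : robj => OPiR (nf_robj r)) (as_pir X).

Lemma ptime_nf_robj : ptime nf_robj.
Proof. by rewrite /nf_robj; pt. Qed.
#[export] Hint Resolve ptime_nf_robj : ptime.

Lemma ptime_cobj_key : ptime cobj_key.
Proof. by rewrite /cobj_key; pt. Qed.
#[export] Hint Resolve ptime_cobj_key : ptime.

Lemma robj_eqv_nf r q : robj_eqv r q <-> nf_robj r = nf_robj q.
Proof.
case: r => [R|a b|||R|R C]; case: q => [R'|a' b'|||R'|R' C'] //=.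
rewrite /nf_robj /=; split=> [[-> /concept_eqv_nf -> //]|[-> e]].
by split=> //; apply/concept_eqv_nf.
Qed.

Lemma cobj_eqv_key X Y : cobj_eqv X Y <-> cobj_key X = cobj_key Y.
Proof.
case: X => [C|a|r|r]; case: Y => [D|b|q|q] //=; rewrite /cobj_key /=.
- split=> [/concept_eqv_nf -> //|[e]]; exact/concept_eqv_nf.
- by split=> [[->]|[->]].
- split=> [/robj_eqv_nf -> //|[e]]; exact/robj_eqv_nf.
- split=> [/robj_eqv_nf -> //|[e]]; exact/robj_eqv_nf.
Qed.

Lemma cobj_eqv_refl X : cobj_eqv X X. Proof. exact/cobj_eqv_key. Qed.
Lemma robj_eqv_refl r : robj_eqv r r. Proof. exact/robj_eqv_nf. Qed.
Lemma cobj_eqv_trans X Y Z : cobj_eqv X Y -> cobj_eqv Y Z -> cobj_eqv X Z.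
Proof. by move=> /cobj_eqv_key e /cobj_eqv_key e'; apply/cobj_eqv_key; rewrite e. Qed.
Lemma robj_eqv_trans r q u : robj_eqv r q -> robj_eqv q u -> robj_eqv r u.
Proof. by move=> /robj_eqv_nf e /robj_eqv_nf e'; apply/robj_eqv_nf; rewrite e. Qed.

Lemma memb_fact (f : fact) (s : seq fact) : memb f s = (f \in s).
Proof. exact: (membP enc_fact_inj). Qed.

Definition presentb (s : seq fact) (f : fact) : bool :=
  [&& all (fun p : cobj * cobj => [&& memb (HasC p.1) s, memb (HasC p.2) s &
        has (fun g => has (fun q : cobj * cobj => enc_eq (cobj_key p.1) (cobj_key q.1) &&
          enc_eq (cobj_key p.2) (cobj_key q.2)) (as_arrc g)) s]) (as_arrc f),
      all (fun p : robj * robj => [&& memb (HasR p.1) s, memb (HasR p.2) s &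
        has (fun g => has (fun q : robj * robj => enc_eq (nf_robj p.1) (nf_robj q.1) &&
          enc_eq (nf_robj p.2) (nf_robj q.2)) (as_arrr g)) s]) (as_arrr f),
      nilp (as_hasc f) || memb f s & nilp (as_hasr f) || memb f s].

Lemma ptime_presentb : ptime (fun p => presentb p.1 p.2).
Proof. by rewrite /presentb; pt. Qed.
#[export] Hint Resolve ptime_presentb : ptime.

Lemma presentP s f : reflect (present s f) (presentb s f).
Proof.
rewrite /presentb; case: f => [X|r|X Y|r q] /=; rewrite ?andbT ?memb_fact ?orbF ?andbT.
- exact: idP.
- exact: idP.
- apply: (iffP and3P) => -[hX hY c]; split=> //.
    move: c => /hasP[g gs /hasP[[X' Y']]]; case: g gs => // X1 Y1 gs; rewrite inE.
    move=> /eqP[-> ->] /andP[/enc_eqP e1 /enc_eqP e2].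
    by exists X1, Y1; split=> //; apply/cobj_eqv_key.
  move: c => [X' [Y' [gs /cobj_eqv_key e1 /cobj_eqv_key e2]]].
  apply/hasP; exists (ArrC X' Y') => //; rewrite /= orbF.
  by apply/andP; split; apply/enc_eqP.
- apply: (iffP and3P) => -[hX hY c]; split=> //.
    move: c => /hasP[g gs /hasP[[X' Y']]]; case: g gs => // X1 Y1 gs; rewrite inE.
    move=> /eqP[-> ->] /andP[/enc_eqP e1 /enc_eqP e2].
    by exists X1, Y1; split=> //; apply/robj_eqv_nf.
  move: c => [X' [Y' [gs /robj_eqv_nf e1 /robj_eqv_nf e2]]].
  apply/hasP; exists (ArrR X' Y') => //; rewrite /= orbF.
  by apply/andP; split; apply/enc_eqP.
Qed.

Definition endpoints (f : fact) : seq fact :=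
  flatmap (fun p : cobj * cobj => [:: HasC p.1; HasC p.2]) (as_arrc f) ++
  flatmap (fun p : robj * robj => [:: HasR p.1; HasR p.2]) (as_arrr f) ++ [:: f].

Lemma endpointsE f : endpoints f = with_endpoints f.
Proof. by case: f. Qed.

Lemma ptime_add_facts : ptime (fun p : seq fact * seq fact => add_facts p.1 p.2).
Proof.
apply: (@ptime_ext _ _ (fun p : seq fact * seq fact => p.1 ++ flatmap endpoints p.2)).
  by move=> [s l]; rewrite /add_facts /flatmap (eq_map endpointsE).
by rewrite /endpoints; pt.
Qed.
#[export] Hint Resolve ptime_add_facts : ptime.

(** * Rule instances *)

Definition instance : Type := (seq fact * seq fact)%type.

Section Candidates.
Variables (O : ontology) (s : seq fact).

Definition cobjs : seq cobj := flatmap as_hasc s.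
Definition robjs : seq robj := flatmap as_hasr s.
Definition concepts : seq concept := flatmap as_concept cobjs.
Definition ands : seq (concept * concept) := flatmap as_and concepts.
Definition ors : seq (concept * concept) := flatmap as_or concepts.
Definition nots : seq name := flatmap as_not concepts.
Definition exs : seq (name * concept) := flatmap as_ex concepts.
Definition alls : seq (name * concept) := flatmap as_all concepts.
Definition pis : seq robj := flatmap as_pil cobjs ++ flatmap as_pir cobjs.
Definition rns : seq name := flatmap as_rname robjs.
Definition comps : seq name := flatmap as_rcomp robjs.
Definition rpairs : seq (name * name) := flatmap as_rpair robjs.

Definition axiom_arrows (ax : axiom) : seq fact :=
  map (fun p : concept * concept => ArrC (OConcept p.1) (OConcept p.2)) (as_gci ax) ++
  map (fun p : name * name => ArrR (RName p.1) (RName p.2)) (as_incl ax) ++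
  map (fun R : name => ArrR (RComp R) (RName R)) (as_trans ax) ++
  map (fun p : name * concept => ArrC (OInd p.1) (OConcept p.2)) (as_cassert ax) ++
  map (fun p : name * name * name => ArrR (RPair p.1.1 p.1.2) (RName p.2)) (as_rassert ax).

Lemma axiom_arrowsE ax : axiom_arrows ax = [:: axiom_arrow ax].
Proof. by case: ax. Qed.

Definition cand_objects : seq instance :=
  map (fun X : cobj => ([:: HasC X],
    [:: ArrC X (OConcept CTop); ArrC (OConcept CBot) X; ArrC X X])) cobjs ++
  map (fun r : robj => ([:: HasR r], [:: ArrR r RTop; ArrR RBot r; ArrR r r])) robjs ++
  map (fun r : robj => ([:: HasR r], [:: HasC (OPiL r); HasC (OPiR r)])) robjs ++
  map (fun r : robj =>
    ([:: ArrC (OPiL r) (OConcept CBot)], [:: ArrC (OPiR r) (OConcept CBot)])) pis ++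
  map (fun r : robj =>
    ([:: ArrC (OPiR r) (OConcept CBot)], [:: ArrC (OPiL r) (OConcept CBot)])) pis.

Definition cand_trans : seq instance :=
  flatmap (fun X : cobj => flatmap (fun Y : cobj => map (fun Z : cobj =>
    ([:: ArrC X Y; ArrC Y Z], [:: ArrC X Z])) cobjs) cobjs) cobjs ++
  flatmap (fun r : robj => flatmap (fun q : robj => map (fun u : robj =>
    ([:: ArrR r q; ArrR q u], [:: ArrR r u])) robjs) robjs) robjs.

Definition cand_axioms : seq instance :=
  flatmap (fun ax : axiom => map (fun f : fact => ([::], [:: f])) (axiom_arrows ax)) O.

Definition cand_and : seq instance :=
  map (fun p : concept * concept => ([:: HasC (OConcept (CAnd p.1 p.2))],
    [:: ArrC (OConcept (CAnd p.1 p.2)) (OConcept p.1);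
        ArrC (OConcept (CAnd p.1 p.2)) (OConcept p.2)])) ands ++
  flatmap (fun X : cobj => map (fun p : concept * concept =>
    ([:: ArrC X (OConcept p.1); ArrC X (OConcept p.2); HasC (OConcept (CAnd p.1 p.2))],
     [:: ArrC X (OConcept (CAnd p.1 p.2))])) ands) cobjs.

Definition cand_or : seq instance :=
  flatmap (fun X : cobj => flatmap (fun p : concept * concept => [::
    ([:: ArrC (OConcept (COr p.1 p.2)) X],
     [:: ArrC (OConcept p.1) X; ArrC (OConcept p.2) X]);
    ([:: ArrC (OConcept p.1) X; ArrC (OConcept p.2) X; HasC (OConcept (COr p.1 p.2))],
     [:: ArrC (OConcept (COr p.1 p.2)) X])]) ors) cobjs.

Definition cand_neg : seq instance :=
  flatmap (fun X : cobj => map (fun A : name =>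
    ([:: ArrC X (OConcept (CName A)); ArrC X (OConcept (CNot A))],
     [:: ArrC X (OConcept CBot)])) nots) cobjs.

Definition cand_ex : seq instance :=
  map (fun p : name * concept => ([:: HasC (OConcept (CEx p.1 p.2))],
    [:: HasC (OConcept p.2); ArrR (RFresh p.1 p.2) (RName p.1);
        ArrC (OConcept (CEx p.1 p.2)) (OPiL (RFresh p.1 p.2));
        ArrC (OPiL (RFresh p.1 p.2)) (OConcept (CEx p.1 p.2));
        ArrC (OPiR (RFresh p.1 p.2)) (OConcept p.2)])) exs ++
  flatmap (fun r : robj => map (fun p : name * concept =>
    ([:: HasC (OConcept (CEx p.1 p.2)); ArrR r (RName p.1); ArrC (OPiR r) (OConcept p.2)],
     [:: ArrC (OPiL r) (OPiL (RFresh p.1 p.2))])) exs) robjs ++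
  flatmap (fun X : cobj => flatmap (fun p : name * concept => map (fun q : name * concept =>
    ([:: ArrR (RComp p.1) (RName p.1); ArrC X (OConcept (CEx p.1 p.2));
         ArrC (OConcept p.2) (OConcept (CEx p.1 q.2))],
     [:: ArrC X (OConcept (CEx p.1 q.2))])) exs) exs) cobjs.

Definition cand_ex_all : seq instance :=
  flatmap (fun X : cobj => flatmap (fun p : name * concept => flatmap (fun q : name * concept => [::
    ([:: ArrC X (OConcept (CEx p.1 p.2)); ArrC X (OConcept (CAll q.1 q.2));
         ArrR (RName p.1) (RName q.1)],
     [:: HasC (OConcept (CAnd p.2 q.2))]);
    ([:: ArrC X (OConcept (CEx p.1 p.2)); ArrC X (OConcept (CAll q.1 q.2));
         ArrR (RName p.1) (RName q.1); ArrC (OConcept (CAnd p.2 q.2)) (OConcept CBot)],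
     [:: ArrC X (OConcept CBot)])]) alls) exs) cobjs.

Definition cand_ex_all_ind : seq instance :=
  flatmap (fun ab : name * name => flatmap (fun P : name => map (fun q : name * concept =>
    ([:: ArrR (RPair ab.1 ab.2) (RName P); ArrC (OInd ab.1) (OConcept (CAll q.1 q.2));
         ArrR (RName P) (RName q.1)],
     [:: ArrC (OInd ab.1) (OConcept (CEx P q.2)); ArrC (OInd ab.2) (OConcept q.2)]))
    alls) rns) rpairs.

Definition cand_ex_comp_all : seq instance :=
  flatmap (fun X : cobj => flatmap (fun p : name * concept => flatmap (fun q : name * concept =>
   flatmap (fun S : name => [::
    ([:: ArrR (RName p.1) (RName S); ArrR (RComp S) (RName S); ArrR (RName S) (RName q.1);
         ArrC X (OConcept (CEx p.1 p.2)); ArrC X (OConcept (CAll q.1 q.2))],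
     [:: HasC (OConcept (CAnd p.2 (CAll S q.2)))]);
    ([:: ArrR (RName p.1) (RName S); ArrR (RComp S) (RName S); ArrR (RName S) (RName q.1);
         ArrC X (OConcept (CEx p.1 p.2)); ArrC X (OConcept (CAll q.1 q.2));
         ArrC (OConcept (CAnd p.2 (CAll S q.2))) (OConcept CBot)],
     [:: ArrC X (OConcept CBot)])]) comps) alls) exs) cobjs.

Definition cand_ex_comp_all_ind : seq instance :=
  flatmap (fun ab : name * name => flatmap (fun P : name => flatmap (fun S : name =>
   map (fun q : name * concept =>
    ([:: ArrR (RName P) (RName S); ArrR (RComp S) (RName S); ArrR (RName S) (RName q.1);
         ArrR (RPair ab.1 ab.2) (RName P); ArrC (OInd ab.1) (OConcept (CAll q.1 q.2))],
     [:: ArrC (OInd ab.1) (OConcept (CEx P (CAll S q.2)));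
         ArrC (OInd ab.2) (OConcept (CAll S q.2))])) alls) comps) rns) rpairs.

Definition candidates : seq instance :=
  cand_objects ++ cand_trans ++ cand_axioms ++ cand_and ++ cand_or ++ cand_neg ++ cand_ex ++
  cand_ex_all ++ cand_ex_all_ind ++ cand_ex_comp_all ++ cand_ex_comp_all_ind.

Lemma mem_cobjs X : (X \in cobjs) = (HasC X \in s).
Proof.
apply/flatmapP/idP => [[f fs]|h]; last by exists (HasC X); rewrite ?inE.
by case: f fs => // Y fs; rewrite inE => /eqP ->.
Qed.

Lemma mem_robjs r : (r \in robjs) = (HasR r \in s).
Proof.
apply/flatmapP/idP => [[f fs]|h]; last by exists (HasR r); rewrite ?inE.
by case: f fs => // Y fs; rewrite inE => /eqP ->.
Qed.

Lemma mem_concepts C : (C \in concepts) = (HasC (OConcept C) \in s).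
Proof.
rewrite -mem_cobjs; apply/flatmapP/idP => [[f fs]|h]; last by exists (OConcept C); rewrite ?inE.
by case: f fs => // D fs; rewrite inE => /eqP ->.
Qed.

Ltac mem_conc := let h := fresh in rewrite -?mem_concepts -?mem_cobjs -?mem_robjs => h;
  apply/flatmapP; (eexists; first exact: h); by rewrite inE.

Lemma mem_ands C D : HasC (OConcept (CAnd C D)) \in s -> (C, D) \in ands.
Proof. by mem_conc. Qed.
Lemma mem_ors C D : HasC (OConcept (COr C D)) \in s -> (C, D) \in ors.
Proof. by mem_conc. Qed.
Lemma mem_nots A : HasC (OConcept (CNot A)) \in s -> A \in nots.
Proof. by mem_conc. Qed.
Lemma mem_exs R C : HasC (OConcept (CEx R C)) \in s -> (R, C) \in exs.
Proof. by mem_conc. Qed.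
Lemma mem_alls R C : HasC (OConcept (CAll R C)) \in s -> (R, C) \in alls.
Proof. by mem_conc. Qed.
Lemma mem_rns R : HasR (RName R) \in s -> R \in rns.
Proof. by mem_conc. Qed.
Lemma mem_comps R : HasR (RComp R) \in s -> R \in comps.
Proof. by mem_conc. Qed.
Lemma mem_rpairs a b : HasR (RPair a b) \in s -> (a, b) \in rpairs.
Proof. by mem_conc. Qed.
Lemma mem_pil r : HasC (OPiL r) \in s -> r \in pis.
Proof.
rewrite -mem_cobjs mem_cat => h; apply/orP; left.
by apply/flatmapP; exists (OPiL r); rewrite ?inE.
Qed.
Lemma mem_pir r : HasC (OPiR r) \in s -> r \in pis.
Proof.
rewrite -mem_cobjs mem_cat => h; apply/orP; right.
by apply/flatmapP; exists (OPiR r); rewrite ?inE.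
Qed.

Ltac cand_cases := repeat match goal with
  | |- is_true (_ \in _ ++ _) -> _ => rewrite mem_cat => /orP[]
  | |- is_true (_ \in flatmap _ _) -> _ => move=> /flatmapP[? _]
  | |- is_true (_ \in map _ _) -> _ => move=> /mapP[? _ ->]
  | |- is_true (_ \in _ :: _ :: _) -> _ => rewrite inE => /orP[/eqP ->|]
  | |- is_true (_ \in [:: _]) -> _ => rewrite inE => /eqP ->
  end; try by constructor.

Lemma candidates_sound i : i \in candidates -> rule O i.1 i.2.
Proof.
rewrite /candidates /cand_objects /cand_trans /cand_and /cand_or /cand_neg /cand_ex.
rewrite /cand_ex_all /cand_ex_all_ind /cand_ex_comp_all /cand_ex_comp_all_ind.
have ax : i \in cand_axioms -> rule O i.1 i.2.
  move=> /flatmapP[ax axO /mapP[f]]; rewrite axiom_arrowsE inE => /eqP -> -> /=.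
  exact: rule_ax.
by cand_cases.
Qed.

Ltac fm x := first
  [ apply/mapP; exists x; [assumption | reflexivity]
  | apply/flatmapP; exists x; [assumption | rewrite ?inE ?eqxx ?orbT //] ].

Ltac pick_cand tac := first [ by tac
  | rewrite mem_cat; apply/orP; first [ left; pick_cand tac | right; pick_cand tac ] ].

Definition has_ends (f : fact) : Prop := match f return Prop with
  | HasC _ | HasR _ => f \in s
  | ArrC X Y => HasC X \in s /\ HasC Y \in s
  | ArrR r q => HasR r \in s /\ HasR q \in s
  end.

Lemma present_has_ends f : present s f -> has_ends f.
Proof. by case: f => // X Y []. Qed.

Lemma candidates_complete prems concls : rule O prems concls ->
  (forall f, f \in prems -> present s f) -> (prems, concls) \in candidates.
Proof.
have P f l : (forall g, g \in f :: l -> present s g) ->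
    has_ends f /\ (forall g, g \in l -> present s g).
  move=> h; split; first by apply: present_has_ends; apply: h; rewrite mem_head.
  by move=> g gl; apply: h; rewrite inE gl orbT.
rewrite /candidates /cand_objects /cand_trans /cand_and /cand_or /cand_neg /cand_ex.
rewrite /cand_ex_all /cand_ex_all_ind /cand_ex_comp_all /cand_ex_comp_all_ind.
have hc X : HasC X \in s -> X \in cobjs by rewrite mem_cobjs.
have hr r : HasR r \in s -> r \in robjs by rewrite mem_robjs.
case.
- move=> X /P[/hc h _]; pick_cand ltac:(fm X).
- move=> r /P[/hr h _]; pick_cand ltac:(fm r).
- move=> r /P[/hr h _]; pick_cand ltac:(fm r).
- move=> X Y Z /P[[/hc hX /hc hY] /P[[_ /hc hZ] _]].
  pick_cand ltac:(fm X; fm Y; fm Z).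
- move=> X Y Z /P[[/hr hX /hr hY] /P[[_ /hr hZ] _]].
  pick_cand ltac:(fm X; fm Y; fm Z).
- move=> r /P[[/mem_pil h _] _]; pick_cand ltac:(fm r).
- move=> r /P[[/mem_pir h _] _]; pick_cand ltac:(fm r).
- move=> ax axO _; pick_cand ltac:(apply/flatmapP; exists ax => //;
    by rewrite axiom_arrowsE inE).
- move=> C D /P[/mem_ands h _]; pick_cand ltac:(fm (C, D)).
- move=> X C D /P[[/hc hX _] /P[_ /P[/mem_ands h _]]].
  pick_cand ltac:(fm X; fm (C, D)).
- move=> C D X /P[[/mem_ors h /hc hX] _]; pick_cand ltac:(fm X; fm (C, D)).
- move=> C D X /P[[_ /hc hX] /P[_ /P[/mem_ors h _]]]; pick_cand ltac:(fm X; fm (C, D)).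
- move=> X A /P[[/hc hX _] /P[[_ /mem_nots h] _]]; pick_cand ltac:(fm X; fm A).
- move=> R C /P[/mem_exs h _]; pick_cand ltac:(fm (R, C)).
- move=> R C r /P[/mem_exs h /P[[/hr hX _] _]]; pick_cand ltac:(fm r; fm (R, C)).
- move=> R X C D /P[_ /P[[/hc hX /mem_exs h1] /P[[_ /mem_exs h2] _]]].
  pick_cand ltac:(fm X; fm (R, C); fm (R, D)).
- move=> X P0 R C D /P[[/hc hX /mem_exs h1] /P[[_ /mem_alls h2] _]].
  pick_cand ltac:(fm X; fm (P0, C); fm (R, D)).
- move=> X P0 R C D /P[[/hc hX /mem_exs h1] /P[[_ /mem_alls h2] _]].
  pick_cand ltac:(fm X; fm (P0, C); fm (R, D)).
- move=> a b P0 R D /P[[/mem_rpairs h1 /mem_rns h2] /P[[_ /mem_alls h3] _]].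
  pick_cand ltac:(fm (a, b); fm P0; fm (R, D)).
- move=> X P0 S0 R C D /P[_ /P[[/mem_comps h4 _] /P[_ /P[[/hc hX /mem_exs h1]
    /P[[_ /mem_alls h2] _]]]]].
  pick_cand ltac:(fm X; fm (P0, C); fm (R, D); fm S0).
- move=> X P0 S0 R C D /P[_ /P[[/mem_comps h4 _] /P[_ /P[[/hc hX /mem_exs h1]
    /P[[_ /mem_alls h2] _]]]]].
  pick_cand ltac:(fm X; fm (P0, C); fm (R, D); fm S0).
- move=> a b P0 S0 R D /P[_ /P[[/mem_comps h4 _] /P[_ /P[[/mem_rpairs h1 /mem_rns h2]
    /P[[_ /mem_alls h3] _]]]]].
  pick_cand ltac:(fm (a, b); fm P0; fm S0; fm (R, D)).
Qed.

End Candidates.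

Section PtimeCandidates.
Local Notation onto := (prod_encType (seq_encType axiom_encType) (seq_encType fact_encType)).

Lemma ptime_cobjs : ptime cobjs. Proof. by rewrite /cobjs; pt. Qed.
Lemma ptime_robjs : ptime robjs. Proof. by rewrite /robjs; pt. Qed.
Hint Resolve ptime_cobjs ptime_robjs : ptime.
Lemma ptime_concepts : ptime concepts. Proof. by rewrite /concepts; pt. Qed.
Hint Resolve ptime_concepts : ptime.
Lemma ptime_ands : ptime ands. Proof. by rewrite /ands; pt. Qed.
Lemma ptime_ors : ptime ors. Proof. by rewrite /ors; pt. Qed.
Lemma ptime_nots : ptime nots. Proof. by rewrite /nots; pt. Qed.
Lemma ptime_exs : ptime exs. Proof. by rewrite /exs; pt. Qed.
Lemma ptime_alls : ptime alls. Proof. by rewrite /alls; pt. Qed.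
Lemma ptime_pis : ptime pis. Proof. by rewrite /pis; pt. Qed.
Lemma ptime_rns : ptime rns. Proof. by rewrite /rns; pt. Qed.
Lemma ptime_comps : ptime comps. Proof. by rewrite /comps; pt. Qed.
Lemma ptime_rpairs : ptime rpairs. Proof. by rewrite /rpairs; pt. Qed.
Lemma ptime_axiom_arrows : ptime axiom_arrows. Proof. by rewrite /axiom_arrows; pt. Qed.
Hint Resolve ptime_ands ptime_ors ptime_nots ptime_exs ptime_alls ptime_pis ptime_rns
  ptime_comps ptime_rpairs ptime_axiom_arrows : ptime.
Lemma ptime_cand_objects : ptime cand_objects. Proof. by rewrite /cand_objects; pt. Qed.
Lemma ptime_cand_trans : ptime cand_trans. Proof. by rewrite /cand_trans; pt. Qed.
Lemma ptime_cand_axioms : ptime cand_axioms. Proof. by rewrite /cand_axioms; pt. Qed.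
Lemma ptime_cand_and : ptime cand_and. Proof. by rewrite /cand_and; pt. Qed.
Lemma ptime_cand_or : ptime cand_or. Proof. by rewrite /cand_or; pt. Qed.
Lemma ptime_cand_neg : ptime cand_neg. Proof. by rewrite /cand_neg; pt. Qed.
Lemma ptime_cand_ex : ptime cand_ex. Proof. by rewrite /cand_ex; pt. Qed.
Lemma ptime_cand_ex_all : ptime cand_ex_all. Proof. by rewrite /cand_ex_all; pt. Qed.
Lemma ptime_cand_ex_all_ind : ptime cand_ex_all_ind.
Proof. by rewrite /cand_ex_all_ind; pt. Qed.
Lemma ptime_cand_ex_comp_all : ptime cand_ex_comp_all.
Proof. by rewrite /cand_ex_comp_all; pt. Qed.
Lemma ptime_cand_ex_comp_all_ind : ptime cand_ex_comp_all_ind.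
Proof. by rewrite /cand_ex_comp_all_ind; pt. Qed.
Hint Resolve ptime_cand_objects ptime_cand_trans ptime_cand_axioms ptime_cand_and
  ptime_cand_or ptime_cand_neg ptime_cand_ex ptime_cand_ex_all ptime_cand_ex_all_ind
  ptime_cand_ex_comp_all ptime_cand_ex_comp_all_ind : ptime.
Lemma ptime_candidates : ptime (fun p : onto => candidates p.1 p.2).
Proof. by rewrite /candidates; pt. Qed.

End PtimeCandidates.
#[export] Hint Resolve ptime_candidates : ptime.

(** * The finite universe of facts *)

Definition sub_cnames (C : concept) : seq name := as_name C ++ as_not C.
Definition sub_rnames (C : concept) : seq name :=
  map (fun p : name * concept => p.1) (as_ex C) ++ map (fun p : name * concept => p.1) (as_all C).

Lemma concept_cnamesE C : concept_cnames C = flatmap sub_cnames (subs C).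
Proof.
elim: C => [||A|A|C IHC D IHD|C IHC D IHD|R C IHC|R C IHC] //=;
  by rewrite flatmap_cons ?flatmap_cat -?IHC -?IHD.
Qed.

Lemma concept_rnamesE C : concept_rnames C = flatmap sub_rnames (subs C).
Proof.
elim: C => [||A|A|C IHC D IHD|C IHC D IHD|R C IHC|R C IHC] //=;
  by rewrite flatmap_cons ?flatmap_cat -?IHC -?IHD.
Qed.

Definition axiom_concepts (ax : axiom) : seq concept :=
  flatmap (fun p : concept * concept => [:: p.1; p.2]) (as_gci ax) ++
  map (fun p : name * concept => p.2) (as_cassert ax).

Definition axiom_roles (ax : axiom) : seq name :=
  flatmap (fun p : name * name => [:: p.1; p.2]) (as_incl ax) ++ as_trans ax ++
  map (fun p : name * name * name => p.2) (as_rassert ax).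

Definition axiom_individuals (ax : axiom) : seq name :=
  map (fun p : name * concept => p.1) (as_cassert ax) ++
  flatmap (fun p : name * name * name => [:: p.1.1; p.1.2]) (as_rassert ax).

Definition ontology_subs (O : ontology) : seq concept :=
  flatmap (fun ax : axiom => flatmap subs (axiom_concepts ax)) O.

Lemma cnamesE O : cnames O = flatmap sub_cnames (ontology_subs O).
Proof.
rewrite /cnames /ontology_subs; elim: O => //= ax O ->.
rewrite flatmap_cons flatmap_cat; congr cat.
by case: ax => * //=; rewrite ?concept_cnamesE /axiom_concepts /flatmap /= ?cats0 ?map_cat ?flatten_cat.
Qed.

Lemma rnamesE O : rnames O =
  flatmap (fun ax : axiom => flatmap sub_rnames (flatmap subs (axiom_concepts ax)) ++ axiom_roles ax) O.
Proof.
rewrite /rnames; elim: O => //= ax O ->; rewrite flatmap_cons; congr cat.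
by case: ax => * //=; rewrite ?concept_rnamesE /axiom_concepts /flatmap /= ?cats0 ?map_cat ?flatten_cat.
Qed.

Lemma indsE O : inds O = flatmap axiom_individuals O.
Proof. by rewrite /inds; elim: O => //= ax O ->; rewrite flatmap_cons; case: ax. Qed.

Lemma ptime_sub_cnames : ptime sub_cnames. Proof. by rewrite /sub_cnames; pt. Qed.
Lemma ptime_sub_rnames : ptime sub_rnames. Proof. by rewrite /sub_rnames; pt. Qed.
#[export] Hint Resolve ptime_sub_cnames ptime_sub_rnames : ptime.
Lemma ptime_axiom_concepts : ptime axiom_concepts.
Proof. by rewrite /axiom_concepts; pt. Qed.
Lemma ptime_axiom_roles : ptime axiom_roles. Proof. by rewrite /axiom_roles; pt. Qed.
Lemma ptime_axiom_individuals : ptime axiom_individuals.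
Proof. by rewrite /axiom_individuals; pt. Qed.
#[export] Hint Resolve ptime_axiom_concepts ptime_axiom_roles ptime_axiom_individuals : ptime.
Lemma ptime_ontology_subs : ptime ontology_subs.
Proof. by rewrite /ontology_subs; pt. Qed.
#[export] Hint Resolve ptime_ontology_subs : ptime.
Lemma ptime_cnames : ptime cnames.
Proof.
by apply: (@ptime_ext _ _ (fun O => flatmap sub_cnames (ontology_subs O)));
  [move=> O; rewrite cnamesE | pt].
Qed.
Lemma ptime_rnames : ptime rnames.
Proof.
by apply: (@ptime_ext _ _ (fun O => flatmap (fun ax : axiom =>
    flatmap sub_rnames (flatmap subs (axiom_concepts ax)) ++ axiom_roles ax) O));
  [move=> O; rewrite rnamesE | pt].
Qed.
Lemma ptime_inds : ptime inds.
Proof.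
by apply: (@ptime_ext _ _ (fun O => flatmap axiom_individuals O));
  [move=> O; rewrite indsE | pt].
Qed.
#[export] Hint Resolve ptime_cnames ptime_rnames ptime_inds : ptime.

Lemma ptime_initial : ptime initial.
Proof. by rewrite /initial; pt. Qed.
#[export] Hint Resolve ptime_initial : ptime.

Section Universe.
Variable O : ontology.

(* Fillers of value restrictions are always among [u_base]; the transitivity rules only
   wrap them once, in [u_fillers], whence the polynomial bound. *)
Definition u_base : seq concept :=
  [:: CTop; CBot] ++ map (fun A : name => CName A) (cnames O) ++ ontology_subs O.
Definition u_fillers : seq concept :=
  u_base ++ flatmap (fun R : name => map (fun C : concept => CAll R C) u_base) (rnames O).
Definition u_concepts : seq concept :=
  u_fillers ++ flatmap (fun R : name => map (fun C : concept => CEx R C) u_fillers) (rnames O) ++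
  flatmap (fun C : concept => map (fun D : concept => CAnd C D) u_fillers) u_fillers.
Definition u_robjs : seq robj :=
  [:: RTop; RBot] ++ map (fun R : name => RName R) (rnames O) ++
  map (fun R : name => RComp R) (rnames O) ++
  flatmap (fun a : name => map (fun b : name => RPair a b) (inds O)) (inds O) ++
  flatmap (fun R : name => map (fun C : concept => RFresh R C) u_fillers) (rnames O).
Definition u_cobjs : seq cobj :=
  map (fun C : concept => OConcept C) u_concepts ++ map (fun a : name => OInd a) (inds O) ++
  map (fun r : robj => OPiL r) u_robjs ++ map (fun r : robj => OPiR r) u_robjs.
Definition univ : seq fact :=
  map (fun X : cobj => HasC X) u_cobjs ++ map (fun r : robj => HasR r) u_robjs ++
  flatmap (fun X : cobj => map (fun Y : cobj => ArrC X Y) u_cobjs) u_cobjs ++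
  flatmap (fun r : robj => map (fun q : robj => ArrR r q) u_robjs) u_robjs.

Definition in_univ (f : fact) : bool :=
  match f with
  | HasC X => X \in u_cobjs
  | HasR r => r \in u_robjs
  | ArrC X Y => (X \in u_cobjs) && (Y \in u_cobjs)
  | ArrR r q => (r \in u_robjs) && (q \in u_robjs)
  end.

Lemma mem_univ f : in_univ f -> f \in univ.
Proof.
rewrite /univ 3!mem_cat; case: f => [X|r|X Y|r q]; rewrite /in_univ.
- by move=> h; apply/or4P/Or41/mapP; exists X.
- by move=> h; apply/or4P/Or42/mapP; exists r.
- move=> /andP[hX hY]; apply/or4P/Or43/flatmapP; exists X => //; exact: map_f.
- move=> /andP[hX hY]; apply/or4P/Or44/flatmapP; exists r => //; exact: map_f.
Qed.

Lemma base_top : CTop \in u_base. Proof. by rewrite inE eqxx. Qed.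
Lemma base_bot : CBot \in u_base. Proof. by rewrite !inE eqxx orbT. Qed.

Lemma base_subs C : C \in u_base -> {subset subs C <= u_base}.
Proof.
rewrite mem_cat => /orP[|].
  by rewrite !inE => /orP[]/eqP -> D; rewrite inE => /eqP ->; rewrite ?base_top ?base_bot.
rewrite mem_cat => /orP[/mapP[A AO ->] D|].
  by rewrite inE => /eqP ->; rewrite /u_base 2!mem_cat; apply/or3P/Or32/mapP; exists A.
move=> /flatmapP[ax axO /flatmapP[E Eax CE]] D DC; rewrite /u_base 2!mem_cat.
apply/or3P/Or33/flatmapP; exists ax => //.
by apply/flatmapP; exists E => //; apply: subs_trans DC.
Qed.

Lemma base_role C R : C \in u_base -> R \in sub_rnames C -> R \in rnames O.
Proof.
rewrite /u_base 2!mem_cat => /or3P[|/mapP[A _ ->//]|].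
  by rewrite !inE => /orP[]/eqP ->.
move=> /flatmapP[ax axO /flatmapP[E Eax CE]] RC; rewrite rnamesE.
apply/flatmapP; exists ax => //; rewrite mem_cat; apply/orP; left.
by apply/flatmapP; exists C => //; apply/flatmapP; exists E.
Qed.

Lemma fillersP C : reflect (C \in u_base \/
  exists R D, [/\ C = CAll R D, R \in rnames O & D \in u_base]) (C \in u_fillers).
Proof.
rewrite /u_fillers (mem_cat C u_base); apply: (iffP orP) => -[h|h]; try by left.
  by right; move: h => /flatmapP[R hR /mapP[D hD ->]]; exists R, D.
move: h => [R [D [-> hR hD]]]; right.
by apply/flatmapP; exists R => //; apply/mapP; exists D.
Qed.

Lemma base_fillers C : C \in u_base -> C \in u_fillers.
Proof. by move=> h; apply/fillersP; left. Qed.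

Lemma all_fillers R C : R \in rnames O -> C \in u_base -> CAll R C \in u_fillers.
Proof. by move=> hR hC; apply/fillersP; right; exists R, C. Qed.

Lemma conceptsP C : reflect [\/ C \in u_fillers,
    exists R D, [/\ C = CEx R D, R \in rnames O & D \in u_fillers] |
    exists D E, [/\ C = CAnd D E, D \in u_fillers & E \in u_fillers]] (C \in u_concepts).
Proof.
rewrite /u_concepts (mem_cat C u_fillers) (mem_cat C (flatmap _ _)); apply: (iffP or3P) => -[h|h|h]; try by constructor.
- by constructor 2; move: h => /flatmapP[R hR /mapP[D hD ->]]; exists R, D.
- by constructor 3; move: h => /flatmapP[R hR /mapP[D hD ->]]; exists R, D.
- move: h => [R [D [-> hR hD]]]; constructor 2.
  by apply/flatmapP; exists R => //; apply/mapP; exists D.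
- move: h => [R [D [-> hR hD]]]; constructor 3.
  by apply/flatmapP; exists R => //; apply/mapP; exists D.
Qed.

Lemma fillers_concepts C : C \in u_fillers -> C \in u_concepts.
Proof. by move=> h; apply/conceptsP; constructor. Qed.

Lemma concepts_all R C : CAll R C \in u_concepts -> R \in rnames O /\ C \in u_base.
Proof.
move=> /conceptsP[/fillersP[h|[R' [D [[-> ->] hR hD]]] //]|[? [? [//]]]|[? [? [//]]]].
split; first by apply: base_role h _; rewrite inE.
by apply: base_subs h _ _; rewrite inE subs_refl orbT.
Qed.

Lemma concepts_ex R C : CEx R C \in u_concepts -> R \in rnames O /\ C \in u_fillers.
Proof.
move=> /conceptsP[/fillersP[h|[? [? [//]]]]|[R' [D [[-> ->] hR hD]]] //|[? [? [//]]]].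
split; first by apply: base_role h _; rewrite inE.
by apply: base_fillers; apply: base_subs h _ _; rewrite inE subs_refl orbT.
Qed.

Lemma concepts_and C D : CAnd C D \in u_concepts -> C \in u_concepts /\ D \in u_concepts.
Proof.
move=> /conceptsP[/fillersP[h|[? [? [//]]]]|[? [? [//]]]|[C' [D' [[-> ->] hC hD]]]];
  last by split; apply: fillers_concepts.
by split; apply/fillers_concepts/base_fillers; apply: base_subs h _ _;
  rewrite inE mem_cat subs_refl ?orbT.
Qed.

Lemma concepts_or C D : COr C D \in u_concepts -> C \in u_concepts /\ D \in u_concepts.
Proof.
move=> /conceptsP[/fillersP[h|[? [? [//]]]]|[? [? [//]]]|[? [? [//]]]].
by split; apply/fillers_concepts/base_fillers; apply: base_subs h _ _;
  rewrite inE mem_cat subs_refl ?orbT.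
Qed.

Lemma concepts_ex_intro R C : R \in rnames O -> C \in u_fillers -> CEx R C \in u_concepts.
Proof. by move=> hR hC; apply/conceptsP; constructor 2; exists R, C. Qed.

Lemma concepts_and_intro C D : C \in u_fillers -> D \in u_fillers -> CAnd C D \in u_concepts.
Proof. by move=> hC hD; apply/conceptsP; constructor 3; exists C, D. Qed.

Lemma mem_u_cobjs X : X \in u_cobjs = match X with
  | OConcept C => C \in u_concepts
  | OInd a => a \in inds O
  | OPiL r | OPiR r => r \in u_robjs
  end.
Proof.
apply/idP/idP.
  by rewrite /u_cobjs 3!mem_cat => /or4P[]/mapP[? ? ->].
rewrite /u_cobjs 3!mem_cat; case: X => [C|a|r|r] h; apply/or4P.
- by apply: Or41; apply: map_f.
- by apply: Or42; apply: map_f.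
- by apply: Or43; apply: map_f.
- by apply: Or44; apply: map_f.
Qed.

Lemma mem_u_robjs r : r \in u_robjs = match r with
  | RName R | RComp R => R \in rnames O
  | RPair a b => (a \in inds O) && (b \in inds O)
  | RTop | RBot => true
  | RFresh R C => (R \in rnames O) && (C \in u_fillers)
  end.
Proof.
apply/idP/idP.
  rewrite /u_robjs 4!mem_cat => /orP[|/or4P[]]; first by rewrite !inE => /orP[]/eqP ->.
  - by move=> /mapP[? ? ->].
  - by move=> /mapP[? ? ->].
  - by move=> /flatmapP[a ha /mapP[b hb ->]]; rewrite ha.
  - by move=> /flatmapP[a ha /mapP[b hb ->]]; rewrite ha.
rewrite /u_robjs 4!mem_cat; case: r => [R|a b|||R|R C] h.
- by apply/orP; right; apply/or4P/Or41/map_f.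
- move: h => /andP[ha hb]; apply/orP; right; apply/or4P/Or43/flatmapP.
  by exists a => //; apply: map_f.
- by rewrite !inE eqxx.
- by rewrite !inE eqxx orbT.
- by apply/orP; right; apply/or4P/Or42/map_f.
- move: h => /andP[ha hb]; apply/orP; right; apply/or4P/Or44/flatmapP.
  by exists R => //; apply: map_f.
Qed.

Lemma concepts_top : CTop \in u_concepts.
Proof. exact/fillers_concepts/base_fillers/base_top. Qed.
Lemma concepts_bot : CBot \in u_concepts.
Proof. exact/fillers_concepts/base_fillers/base_bot. Qed.

Lemma axiom_in_univ ax : ax \in O -> in_univ (axiom_arrow ax).
Proof.
move=> axO.
have hC C : C \in axiom_concepts ax -> C \in u_concepts.
  move=> h; apply/fillers_concepts/base_fillers; rewrite /u_base 2!mem_cat.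
  apply/or3P/Or33/flatmapP; exists ax => //; apply/flatmapP; exists C => //.
  exact: subs_refl.
have hR R : R \in axiom_roles ax -> R \in rnames O.
  by move=> h; rewrite rnamesE; apply/flatmapP; exists ax => //; rewrite mem_cat h orbT.
have hI a : a \in axiom_individuals ax -> a \in inds O.
  by move=> h; rewrite indsE; apply/flatmapP; exists ax.
case: ax axO hC hR hI => [C D|R R'|R|a C|a b R] axO hC hR hI /=;
  rewrite ?mem_u_cobjs ?mem_u_robjs.
- by rewrite !hC // !inE eqxx ?orbT.
- by rewrite !hR // !inE eqxx ?orbT.
- by rewrite !hR // !inE eqxx ?orbT.
- by rewrite hI ?hC // !inE eqxx ?orbT.
- by rewrite !hI ?hR // !inE eqxx ?orbT.
Qed.

Lemma rule_in_univ prems concls : rule O prems concls ->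
  all in_univ prems -> all in_univ concls.
Proof.
case=> [X|r|r|X Y Z|r q u|r|r|ax axO|C D|X C D|C D X|C D X|X A|R C|R C r|S X C D|X P R C D
  |X P R C D|a b P R D|X P S R C D|X P S R C D|a b P S R D];
  rewrite /= ?andbT ?mem_u_cobjs ?mem_u_robjs ?concepts_top ?concepts_bot /= ?andbT //.
- by move=> ->.
- by move=> ->.
- by move=> ->.
- by move=> /andP[/andP[-> _] /andP[_ ->]].
- by move=> /andP[/andP[-> _] /andP[_ ->]].
- by move=> _; apply: axiom_in_univ.
- by move=> h; have [-> ->] := concepts_and h; rewrite h.
- by move=> /and3P[/andP[-> _] _ ->].
- by move=> /andP[h ->]; have [-> ->] := concepts_or h.
- by move=> /and3P[/andP[_ ->] _ ->].
- by move=> /andP[/andP[-> _] _].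
- move=> h; have [hR hC] := concepts_ex h.
  by rewrite h hR hC (fillers_concepts hC).
- move=> /and3P[h /andP[-> _] _]; have [-> ->] := concepts_ex h.
  by [].
- by move=> /and3P[_ /andP[-> _] /andP[_ ->]].
- move=> /and3P[/andP[_ /concepts_ex[_ hC]] /andP[_ /concepts_all[_ hD]] _].
  by apply: concepts_and_intro => //; apply: base_fillers.
- by move=> /and4P[/andP[->]].
- move=> /and3P[/andP[/andP[ha hb] hP] /andP[_ /concepts_all[_ hD]] _].
  by rewrite ha hb concepts_ex_intro ?base_fillers // fillers_concepts ?base_fillers.
- move=> /and5P[/andP[_ hS] _ _ /andP[_ /concepts_ex[_ hC]] /andP[_ /concepts_all[_ hD]]].
  by apply: concepts_and_intro => //; apply: all_fillers.
- by move=> /and5P[_ _ _ /andP[->]].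
- move=> /and5P[/andP[hP hS] _ _ /andP[/andP[ha hb] _] /andP[_ /concepts_all[_ hD]]].
  by rewrite ha hb concepts_ex_intro ?all_fillers // fillers_concepts ?all_fillers.
Qed.

Lemma initial_in_univ : all in_univ (initial O).
Proof.
rewrite /initial !all_cat /= !mem_u_cobjs !mem_u_robjs concepts_top concepts_bot /=.
apply/and3P; split; apply/allP=> f /mapP[A hA ->] /=; rewrite ?mem_u_cobjs ?mem_u_robjs //.
apply/fillers_concepts/base_fillers; rewrite /u_base 2!mem_cat.
by apply/or3P/Or32/mapP; exists A.
Qed.

Lemma present_in_univ s f : all in_univ s -> present s f -> in_univ f.
Proof.
move=> /allP h /present_has_ends; case: f => [X|r|X Y|r q] /=; try exact: h.
  by move=> [/h /= -> /h].
by move=> [/h /= -> /h].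
Qed.

Lemma endpoints_in_univ f : in_univ f -> all in_univ (with_endpoints f).
Proof. by case: f => [X|r|X Y|r q] /= h; rewrite ?h //; move: h => /andP[-> ->]. Qed.

Lemma run_in_univ n s : run O n s -> all in_univ s.
Proof.
elim=> [|{}n {}s prems concls _ IH ru [hp _]]; first exact: initial_in_univ.
rewrite /add_facts all_cat IH /=.
have : all in_univ prems by apply/allP=> f /hp; apply: present_in_univ.
move=> /(rule_in_univ ru)/allP hc; apply/allP=> g /flatten_mapP[f /hc h].
exact/allP/endpoints_in_univ.
Qed.

Lemma not_present_new s f : ~ present s f -> exists2 g, g \in with_endpoints f & g \notin s.
Proof.
move=> np; apply/hasP; apply: contra_notT np => /hasPn h.
have {}h g : g \in with_endpoints f -> g \in s by move/h; rewrite negbK.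
case: f h => [X|r|X Y|r q] h /=; try by apply: h; rewrite !inE eqxx ?orbT.
  split; try by apply: h; rewrite !inE eqxx ?orbT.
  exists X, Y; split; try exact: cobj_eqv_refl.
  by apply: h; rewrite !inE eqxx ?orbT.
split; try by apply: h; rewrite !inE eqxx ?orbT.
exists r, q; split; try exact: robj_eqv_refl.
by apply: h; rewrite !inE eqxx ?orbT.
Qed.

Lemma run_undup n s : run O n s -> n <= size (undup s).
Proof.
elim=> // {}n {}s prems concls _ IH _ [_ [f fc /not_present_new[g gf gs]]].
apply: leq_trans (_ : size (g :: undup s) <= _); first by [].
apply: uniq_leq_size; first by rewrite /= mem_undup gs undup_uniq.
move=> h; rewrite inE !mem_undup mem_cat => /orP[/eqP ->|->//].
by apply/orP; right; apply/flatten_mapP; exists f.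
Qed.

Lemma run_bound n s : run O n s -> n <= size univ.
Proof.
move=> r; apply: leq_trans (run_undup r) _; apply: uniq_leq_size; first exact: undup_uniq.
by move=> f; rewrite mem_undup => fs; apply: mem_univ; apply: (allP (run_in_univ r)).
Qed.

End Universe.

Lemma ptime_u_base : ptime u_base. Proof. by rewrite /u_base; pt. Qed.
#[export] Hint Resolve ptime_u_base : ptime.
Lemma ptime_u_fillers : ptime u_fillers. Proof. by rewrite /u_fillers; pt. Qed.
#[export] Hint Resolve ptime_u_fillers : ptime.
Lemma ptime_u_concepts : ptime u_concepts. Proof. by rewrite /u_concepts; pt. Qed.
Lemma ptime_u_robjs : ptime u_robjs. Proof. by rewrite /u_robjs; pt. Qed.
#[export] Hint Resolve ptime_u_concepts ptime_u_robjs : ptime.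
Lemma ptime_u_cobjs : ptime u_cobjs. Proof. by rewrite /u_cobjs; pt. Qed.
#[export] Hint Resolve ptime_u_cobjs : ptime.
Lemma ptime_univ : ptime univ. Proof. by rewrite /univ; pt. Qed.
#[export] Hint Resolve ptime_univ : ptime.

(** * Saturation *)

Definition applicableb (s : seq fact) (i : instance) : bool :=
  all (presentb s) i.1 && has (fun f => ~~ presentb s f) i.2.

Lemma applicableP s i : reflect (applicable s i.1 i.2) (applicableb s i).
Proof.
apply: (iffP andP) => -[h1 h2]; split.
- by move=> f fi; apply/presentP/(allP h1).
- by move/hasP: h2 => [f fi /presentP np]; exists f.
- by apply/allP=> f /h1 /presentP.
- by case: h2 => f fi np; apply/hasP; exists f => //; apply/presentP.
Qed.

Definition applicables (O : ontology) (s : seq fact) : seq instance :=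
  filter (applicableb s) (candidates O s).

Definition sat_step (O : ontology) (s : seq fact) : seq fact :=
  if nilp (applicables O s) then s
  else add_facts s (head ([::], [::]) (applicables O s)).2.

Definition saturate (O : ontology) : seq fact :=
  iter (esize (univ O)) (sat_step O) (initial O).

Lemma saturated_applicables O s : applicables O s = [::] -> saturated O s.
Proof.
move=> e prems concls ru ap.
have : (prems, concls) \in applicables O s.
  rewrite mem_filter; apply/andP; split; first exact/applicableP.
  by apply: candidates_complete => //; case: ap.
by rewrite e.
Qed.

Lemma sat_stepP O s n : run O n s ->
  (applicables O s = [::] /\ sat_step O s = s) \/
  (exists i, [/\ rule O i.1 i.2, applicable s i.1 i.2 & sat_step O s = add_facts s i.2]).
Proof.
move=> r; rewrite /sat_step; case e : (applicables O s) => [|i l]; first by left.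
right; exists i; have : i \in applicables O s by rewrite e mem_head.
by rewrite mem_filter => /andP[/applicableP ap /candidates_sound ru].
Qed.

Lemma iter_sat_step O k : exists n, run O n (iter k (sat_step O) (initial O)) /\
  (n = k \/ applicables O (iter k (sat_step O) (initial O)) = [::]).
Proof.
elim: k => [|k [n [r h]]]; first by exists 0; split; [constructor | left].
have [[e f]|[i [ru ap f]]] := sat_stepP r; rewrite iterS f.
  by exists n; split=> //; right.
exists n.+1; split; first exact: run_step r ru ap.
case: h => [->|e]; first by left.
have : i \in applicables O (iter k (sat_step O) (initial O)).
  rewrite mem_filter; apply/andP; split; first exact/applicableP.
  by case: (i) ru ap => prems concls ru [ap _]; apply: candidates_complete.
by rewrite e.
Qed.

Lemma saturation_saturate O : saturation O (saturate O).
Proof.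
have [n [r h]] := iter_sat_step O (esize (univ O)); split; first by exists n.
apply: saturated_applicables; case: h => // en; rewrite en in r.
by have := run_bound r; rewrite leqNgt size_esize.
Qed.

Lemma rule_size O prems concls : rule O prems concls -> size concls <= 5.
Proof. by case. Qed.

Lemma size_add_facts s concls :
  size (add_facts s concls) <= size s + 3 * size concls.
Proof.
rewrite /add_facts size_cat leq_add2l; elim: concls => //= f l IH.
by rewrite size_cat mulnS leq_add //; case: f.
Qed.

Lemma size_iter_sat_step O k :
  size (iter k (sat_step O) (initial O)) <= size (initial O) + 15 * k.
Proof.
elim: k => [|k IH]; first by rewrite addn0.
have [n [r _]] := iter_sat_step O k.
have [[e f]|[i [ru ap f]]] := sat_stepP r; rewrite iterS f; first by lia.
apply: leq_trans (size_add_facts _ _) _; have := rule_size ru; lia.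
Qed.

Lemma esize_mem (s : seq fact) f : f \in s -> esize f < esize s.
Proof.
elim: s => // g s IH; rewrite inE => /orP[/eqP ->|/IH]; rewrite esize_cons //; last by lia.
by rewrite ltnS leq_addr.
Qed.

Lemma esize_all_le m (s : seq fact) : (forall f, f \in s -> esize f <= m) ->
  esize s <= size s * m.+1 + 1.
Proof.
elim: s => // f s IH h; rewrite esize_cons [size _]/= mulSn.
have hf : esize f <= m by apply: h; rewrite mem_head.
have hs : esize s <= size s * m.+1 + 1.
  by apply: IH => g gs; apply: h; rewrite inE gs orbT.
lia.
Qed.

Lemma esize_iter_sat_step O k : esize (iter k (sat_step O) (initial O)) <=
  (esize (initial O) + 15 * k) * (esize (univ O)).+1 + 1.
Proof.
have [n [r _]] := iter_sat_step O k.
apply: leq_trans (_ : size (iter k (sat_step O) (initial O)) * (esize (univ O)).+1 + 1 <= _).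
  apply: esize_all_le => f fs; apply/ltnW/esize_mem/mem_univ.
  exact: (allP (run_in_univ r)).
rewrite leq_add2r leq_mul2r; apply/orP; right.
apply: leq_trans (size_iter_sat_step O k) _; rewrite leq_add2r; exact/ltnW/size_esize.
Qed.

Lemma ptime_sat_step : ptime (fun p : seq axiom * seq fact => sat_step p.1 p.2).
Proof. by rewrite /sat_step /applicables /applicableb; pt. Qed.
#[export] Hint Resolve ptime_sat_step : ptime.

Lemma ptime_saturate : ptime saturate.
Proof.
pose f (p : seq axiom * seq fact) := (p.1, sat_step p.1 p.2).
have fE O k s : iter k f (O, s) = (O, iter k (sat_step O) s) by elim: k => //= k ->.
apply: (@ptime_ext _ _ (fun O : seq axiom => (iter (esize (univ O)) f (O, initial O)).2)).
  by move=> O; rewrite fE.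
apply: (ptime_comp (ptime_snd _ _)).
apply: ptime_iter; [by pt | by pt | by rewrite /f; pt |].
have bu := ptime_esize ptime_univ; have bi := ptime_esize ptime_initial.
have : pbounded (@esize (seq_encType axiom_encType)) (fun O =>
   esize O + ((esize (initial O) + 15 * esize (univ O)) * (esize (univ O) + 1) + 1) + 1).
  by pbound.
case=> K bK; exists K => O n le; apply: leq_trans (bK O).
rewrite fE esize_pair -addn1 leq_add2r leq_add2l.
apply: leq_trans (esize_iter_sat_step O n) _; rewrite leq_add2r addn1 leq_mul2r.
by apply/orP; right; rewrite leq_add2l leq_mul2l le orbT.
Qed.
#[export] Hint Resolve ptime_saturate : ptime.

Definition clash (O : ontology) (s : seq fact) : bool :=
  has (fun a : name => presentb s (ArrC (OInd a) (OConcept CBot))) (inds O).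

Lemma clashP O s : reflect (has_clash O s) (clash O s).
Proof.
apply: (iffP hasP) => -[a aO h]; exists a => //; exact/presentP.
Qed.

Definition report (w : seq symbol) : seq symbol :=
  ser_verdict (~~ clash (parse_ontology w) (saturate (parse_ontology w)))
  :: ser_structure (saturate (parse_ontology w)).

Lemma ptime_ser_verdict : ptime ser_verdict.
Proof. by rewrite /ser_verdict; pt. Qed.
#[export] Hint Resolve ptime_ser_verdict : ptime.

Lemma ptime_report : ptime report.
Proof. by rewrite /report /clash; pt. Qed.

(** * Confluence *)

Lemma present_trans s t f : (forall g, g \in s -> present t g) -> present s f -> present t f.
Proof.
move=> h; case: f => [X|r|X Y|r q]; try exact: h.
  move=> [/h hX /h hY [X' [Y' [/h [_ _ [X1 [Y1 [m eX eY]]]] e1 e2]]]]; split=> //.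
  by exists X1, Y1; split=> //; [apply: cobj_eqv_trans eX | apply: cobj_eqv_trans eY].
move=> [/h hX /h hY [X' [Y' [/h [_ _ [X1 [Y1 [m eX eY]]]] e1 e2]]]]; split=> //.
by exists X1, Y1; split=> //; [apply: robj_eqv_trans eX | apply: robj_eqv_trans eY].
Qed.

Lemma present_endpoints t f g : present t f -> g \in with_endpoints f -> present t g.
Proof.
case: f => [X|r|X Y|r q] h /=; rewrite !inE; try by move/eqP ->.
  by case: (h) => hX hY _ /or3P[]/eqP ->.
by case: (h) => hX hY _ /or3P[]/eqP ->.
Qed.

Lemma run_initial O n s : run O n s -> {subset initial O <= s}.
Proof. by elim=> // {}n {}s prems concls _ IH _ _ f /IH fs; rewrite mem_cat fs. Qed.

Lemma run_present O n s t : run O n s -> saturation O t -> forall f, f \in s -> present t f.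
Proof.
move=> r [[m rt] st]; elim: r => [|{}n {}s prems concls _ IH ru [hp _]] f.
  have : all (fun f => if f is (HasC _ | HasR _) then true else false) (initial O).
    by rewrite /initial !all_cat /= !all_map; apply/and3P; split; apply/allP.
  by move=> /allP h fi; have := h _ fi; have := run_initial rt fi; case: (f).
rewrite mem_cat => /orP[/IH //|/flatten_mapP[g gc]].
suff : present t g by apply: present_endpoints.
apply/presentP; apply/negPn/negP => /presentP np.
apply: (st _ _ ru); split; last by exists g.
by move=> h /hp; apply: present_trans.
Qed.

Lemma saturation_clash O s t : saturation O s -> saturation O t ->
  has_clash O s -> has_clash O t.
Proof.
move=> [[n r] _] st [a aO h]; exists a => //.
apply: present_trans h; exact: run_present r st.
Qed.

Lemma consistent_saturation O s : saturation O s -> consistent O <-> ~ has_clash O s.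
Proof.
move=> ss; split=> [c h|h [t st ht]]; first by apply: c; exists s.
exact: h (saturation_clash st ss ht).
Qed.

(** * Input and output *)

Definition dispatch (i : ix) (l : seq symbol) (f : symbol -> cmd) : cmd :=
  foldr (fun a c => If (TopIs i (Some a)) (f a) c) Skip l.

Lemma ex_dispatch i l f T a r n T' : get T i = a :: r -> a \in l ->
  ex (f a) T n T' -> ex (dispatch i l f) T (n + size l) T'.
Proof.
move=> e + h; elim: l => //= b l IH; rewrite inE => al.
apply: (@ex_le _ _ (n + size l).+1); last by rewrite addnS.
apply: ex_if; rewrite /= /top e /= -[Some a == Some b]/(a == b).
by case: eqVneq al => [<- _|_ /= /IH //]; apply: ex_le h _; apply: leq_addr.
Qed.

Definition read_in : cmd :=
  Push I1 Send ;; Push I1 Stop ;;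
  While (GNot (TopIs I0 None)) (dispatch I0 symbols (fun a =>
    Pop I0 ;; push_string I1 (tser (enc a)) ;; Push I1 Sand)) ;;
  Push I2 Send ;; shift I1 I2 ;; shift I2 I0.

Lemma ex_read_in (w : seq symbol) : ex read_in (Stacks w [::] [::] [::])
  (400 * size w + 20 * esize w + 100) (Stacks (tser (enc (rev w))) [::] [::] [::]).
Proof.
have loop (v u : seq symbol) : ex (While (GNot (TopIs I0 None)) (dispatch I0 symbols (fun a =>
      Pop I0 ;; push_string I1 (tser (enc a)) ;; Push I1 Sand)))
    (Stacks v (tser (enc u) ++ [:: Send]) [::] [::]) (400 * size v + 1)
    (Stacks [::] (tser (enc (catrev v u)) ++ [:: Send]) [::] [::]).
  elim: v u => [|a v IH] u; first exact: ex_while_false.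
  apply: ex_le.
    apply: ex_while_true (IH (a :: u)) => //.
    apply: (ex_dispatch (a := a)) => //; first exact: mem_symbols.
    apply: ex_seq; first exact: ex_pop.
    apply: ex_seq; first exact: ex_push_string.
    by apply: ex_eq; [exact: ex_push | rewrite /= catA].
  by have := esize_symbol a; rewrite /esize /tsize [size symbols]/= [size (_ :: _)]/=; lia.
have dr : all digit (tser (enc (rev w))) by apply: tser_digit.
apply: ex_le.
  do 2 (apply: ex_seq; first exact: ex_push).
  apply: ex_seq; first exact: (loop w [::]).
  apply: ex_seq; first exact: ex_push.
  apply: ex_seq; first exact: (@ex_shift _ (tser (enc (rev w))) [::] I1 I2).
  apply: ex_eq; first by apply: (@ex_shift _ (rev (tser (enc (rev w)))) [::] I2 I0);
    rewrite ?all_rev.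
  by rewrite /= revK cats0.
by rewrite size_rev -/(tsize _) -/(esize _) esize_rev; lia.
Qed.

Fixpoint decode (l : seq symbol) : cmd :=
  if l is a :: l' then If (TopIs I0 (Some Stop)) (Pop I0 ;; Push I1 a)
    (Pop I0 ;; Pop I0 ;; decode l')
  else Skip.

Lemma ex_decode l n r0 r1 r2 r3 : n < size l ->
  ex (decode l) (Stacks (tser (unary n) ++ r0) r1 r2 r3) (10 * n + 10)
    (Stacks r0 (nth Sno l n :: r1) r2 r3).
Proof.
elim: l n => // a l IH [|n] lt /=.
  by apply: ex_le; first by apply: ex_if; ex_line.
apply: ex_le; first by apply: ex_if; do 2 (apply: ex_seq; first exact: ex_pop); apply: IH.
by lia.
Qed.

Definition write_out : cmd :=
  While (TopIs I0 (Some Sand)) (Pop I0 ;; decode symbols) ;; Pop I0 ;;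
  While (GNot (TopIs I1 None)) (dispatch I1 symbols (fun a => Pop I1 ;; Push I0 a)).

Lemma ex_write_out (v : seq symbol) : ex write_out (Stacks (tser (enc v)) [::] [::] [::])
  (500 * size v + 20) (Stacks v [::] [::] [::]).
Proof.
have loop1 (u r : seq symbol) : ex (While (TopIs I0 (Some Sand)) (Pop I0 ;; decode symbols))
    (Stacks (tser (enc u)) r [::] [::]) (400 * size u + 1)
    (Stacks [:: Stop] (catrev u r) [::] [::]).
  elim: u r => [|a u IH] r; first exact: ex_while_false.
  apply: ex_le.
    apply: ex_while_true (IH (a :: r)) => //.
    apply: ex_seq; first exact: ex_pop.
    apply: ex_eq; first by apply: (@ex_decode _ (symbol_code a)); case: (a) => // -[].
    by rewrite -/(symbol_decode _) symbol_codeK.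
  have : symbol_code a <= 31 by case: (a) => // -[].
  by rewrite [size (_ :: _)]/=; lia.
have loop2 (u r : seq symbol) : ex (While (GNot (TopIs I1 None))
      (dispatch I1 symbols (fun a => Pop I1 ;; Push I0 a)))
    (Stacks r u [::] [::]) (40 * size u + 1) (Stacks (catrev u r) [::] [::] [::]).
  elim: u r => [|a u IH] r; first exact: ex_while_false.
  apply: ex_le.
    apply: ex_while_true (IH (a :: r)) => //.
    by apply: (ex_dispatch (a := a)); [|exact: mem_symbols | ex_line].
  by rewrite [size symbols]/= [size (_ :: _)]/=; lia.
apply: ex_le.
  apply: ex_seq; first exact: loop1.
  apply: ex_seq; first exact: ex_pop.
  apply: ex_eq; first exact: loop2.
  by rewrite -/(rev v) -/(rev (rev v)) revK.
by rewrite -/(rev v) size_rev; lia.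
Qed.

Lemma esize_symbols (w : seq symbol) : esize w <= 64 * size w + 1.
Proof.
elim: w => // a w IH; rewrite esize_cons [size _]/=; have := esize_symbol a; lia.
Qed.

Lemma machine_of_ptime (f : seq symbol -> seq symbol) : ptime f -> exists M cost,
  pbounded size cost /\ forall w t, cost w <= t -> computes_in M w t (f (rev w)).
Proof.
move=> pf; have [c [cost [bc hc]]] := transforms_elim pf; have bf := ptime_esize pf.
pose time (w : seq symbol) := 400 * size w + 20 * esize w + cost (rev w)
  + 500 * esize (f (rev w)) + 200.
exists (frag_machine (compile (read_in ;; c ;; write_out))), time; split.
  have b0 : pbounded size (fun w : seq symbol => esize w).
    apply: (@pbounded_le _ _ _ (fun w : seq symbol => 64 * size w + 1)); last by pbound.
    exact: esize_symbols.
  have b1 : pbounded size (fun w : seq symbol => cost (rev w)).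
    apply: pbounded_trans b0 _; have [k bk] := bc; exists k => w.
    by apply: leq_trans (bk (rev w)) _; rewrite /= -/(esize _) esize_rev.
  have b2 : pbounded size (fun w : seq symbol => esize (f (rev w))).
    apply: pbounded_trans b0 _; have [k bk] := bf; exists k => w.
    by apply: leq_trans (bk (rev w)) _; rewrite esize_rev.
  by rewrite /time; pbound.
move=> w t le.
have [n ln e] : ex (read_in ;; c ;; write_out) (Stacks w [::] [::] [::]) (time w)
    (Stacks (f (rev w)) [::] [::] [::]).
  apply: ex_le.
    apply: ex_seq; first exact: ex_read_in.
    apply: ex_seq; last exact: ex_write_out.
    by have := hc (rev w) [::] [::] [::] [::]; rewrite !cats0 => h; exact: h.
  have : size (f (rev w)) < esize (f (rev w)) by apply: size_esize.
  by rewrite /time; lia.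
by apply: (compile_computes e); apply: leq_trans le.
Qed.

Lemma polynomial_bound (f : ontology -> nat) : pbounded ontology_size f ->
  exists p : {poly nat}, forall O, f O <= (p.[ontology_size O])%R.
Proof.
move=> [k bk]; exists (('X + 2%:P) ^+ k)%R => O.
by rewrite horner_exp hornerD hornerX hornerC; apply: bk.
Qed.

Theorem theorem4 :
  exists p : {poly nat},
    (forall (O : ontology) (n : nat) (s : structure),
        run O n s -> n <= (p.[ontology_size O])%R) /\
    (exists M : machine, forall O : ontology,
        exists (s : structure) (b : bool),
          [/\ saturation O s,
              b = true <-> consistent O,
              b = false <-> has_clash O s &
              computes_in M (ser_ontology O) (p.[ontology_size O])%R
                (ser_verdict b :: ser_structure s)]).
Proof.
have [M [cost [bM hM]]] := machine_of_ptime ptime_report.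
have bu : pbounded ontology_size (fun O => esize (univ O)).
  have pu : ptime (fun w : seq symbol => univ (parse_ontology w)) by pt.
  apply: (@pbounded_trans _ _ (fun O => esize (rev (ser_ontology O)))).
    apply: (@pbounded_le _ _ _ (fun O => 64 * ontology_size O + 1)); last by pbound.
    by move=> O; rewrite esize_rev esize_symbols.
  have [k bk] := ptime_esize pu; exists k => O.
  by have := bk (rev (ser_ontology O)); rewrite parse_ontologyK.
have bc : pbounded ontology_size (fun O => cost (ser_ontology O)).
  by have [k bk] := bM; exists k => O; apply: bk.
have [p bp] : exists p : {poly nat}, forall O,
    esize (univ O) + cost (ser_ontology O) <= (p.[ontology_size O])%R.
  by apply: polynomial_bound; pbound.
exists p; split=> [O n s r|].
  apply: leq_trans (bp O); apply: leq_trans (run_bound r) _.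
  exact: leq_trans (ltnW (size_esize _)) (leq_addr _ _).
exists M => O; exists (saturate O), (~~ clash O (saturate O)).
have sat := saturation_saturate O; split=> //.
- have c := consistent_saturation sat.
  by split=> [/negP h|/c h]; [apply/c => /clashP | apply/clashP].
- by split=> [/negbFE /clashP|/clashP ->].
have := hM (ser_ontology O) (p.[ontology_size O])%R; rewrite /report parse_ontologyK.
by apply; apply: leq_trans (bp O); apply: leq_addl.
Qed.
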